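(* Let $\mathbb P_s=\{(y_a)_{a\in\mathbb A}\in(\Delta(S))^A:\ \sum_{a\in\mathbb A}\mathrm{KL}(y_a,y^0_a)\le\alpha\}$ be a Kullback-Leibler uncertainty set, where $y^0\in(\Delta(S))^A$ and $\alpha>0$, and consider the proximal update $$\mathrm{prox}_y(g,y')=\arg\max_{y\in\mathbb P_s}\{\langle g,y\rangle-D_Y(y,y')\},\qquad g\in\mathbb R^{A\times S}.$$ (i) For the $\ell_2$ setup, i.e. $D_Y(y,y')=\frac12\|y-y'\|_2^2$, the proximal update can be approximated up to $\epsilon$ in a number of arithmetic operations in $O\left(AS\log^2(\epsilon^{-1})\right)$. (ii) For the $\ell_1$ setup, i.e. $D_Y(y,y')=\frac A2\sum_{a=1}^A\mathrm{KL}(y_a,y'_a)$, the proximal update can be approximated up to $\epsilon$ in a number of arithmetic operations in $O\left(AS\log(\epsilon^{-1})\right)$.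
   Context: $S,A$ are positive integers, $\mathbb A=\{1,\dots,A\}$, and $\Delta(S)$ is the probability simplex in $\mathbb R^S$. $\mathrm{KL}(y,y')=\sum_{s'=1}^S y_{s'}\log(y_{s'}/y'_{s'})$ (with $0\log 0=0$). Here $y'\in\mathbb P_s$ is the current point (with positive entries in the $\ell_1$ setup). ''Approximated up to $\epsilon$'' means computing a point of $\mathbb P_s$ whose objective value is within $\epsilon$ of the optimal value of the proximal problem. In the count of arithmetic operations, evaluations of elementary functions ($\exp$, $\log$, powers) and of the principal branch of the Lambert $W$ function have unit cost, and the implied constants may depend on the magnitude of the data ($g,y',y^0,\alpha$) but not on $S,A,\epsilon$. *)

(* Defs.v *)
From HB Require Import structures.
From mathcomp Require Import all_boot all_order all_algebra.
From mathcomp Require Import all_classical all_reals all_analysis.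

Set Implicit Arguments.
Unset Strict Implicit.
Unset Printing Implicit Defensive.

Import Order.TTheory GRing.Theory Num.Theory.
Import numFieldNormedType.Exports.

Local Open Scope classical_set_scope.
Local Open Scope ring_scope.

(** * The proximal problem *)

Section Prox.
Context {R : realType}.

Definition simplex (S : nat) (p : 'rV[R]_S) : Prop :=
  (forall s, 0 <= p 0 s) /\ \sum_(s < S) p 0 s = 1.

(* Extended-real valued: [ln] and division are total in the library, so the
   real number [p * ln (p / 0)] would be 0 instead of +oo. *)
Definition kl_term (p q : R) : \bar R :=
  if p == 0 then 0%E else if q == 0 then +oo%E else (p * ln (p / q))%:E.

Definition KL (S : nat) (p q : 'rV[R]_S) : \bar R :=
  (\sum_(s < S) kl_term (p 0%R s) (q 0%R s))%E.

(* Row a of an A x S matrix y is y_a. *)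
Definition kl_ball (A S : nat) (y0 : 'M[R]_(A, S)) (alpha : R) :
    set 'M[R]_(A, S) :=
  [set y | (forall a, simplex (row a y)) /\
           (\sum_(a < A) KL (row a y) (row a y0) <= alpha%:E)%E].

Definition inner (A S : nat) (g y : 'M[R]_(A, S)) : R :=
  \sum_(a < A) \sum_(s < S) g a s * y a s.

Definition D_l2 (A S : nat) (y y' : 'M[R]_(A, S)) : \bar R :=
  (2^-1 * \sum_(a < A) \sum_(s < S) (y a s - y' a s) ^+ 2)%:E.

Definition D_l1 (A S : nat) (y y' : 'M[R]_(A, S)) : \bar R :=
  ((A%:R / 2)%:E * \sum_(a < A) KL (row a y) (row a y'))%E.

Definition objective (A S : nat)
    (D : 'M[R]_(A, S) -> 'M[R]_(A, S) -> \bar R) (g y' y : 'M[R]_(A, S)) :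
    \bar R :=
  ((inner g y)%:E - D y y')%E.

Definition optimal_value (A S : nat)
    (D : 'M[R]_(A, S) -> 'M[R]_(A, S) -> \bar R)
    (P : set 'M[R]_(A, S)) (g y' : 'M[R]_(A, S)) : \bar R :=
  ereal_sup [set objective D g y' y | y in P].

Definition approx_prox (A S : nat)
    (D : 'M[R]_(A, S) -> 'M[R]_(A, S) -> \bar R)
    (P : set 'M[R]_(A, S)) (g y' : 'M[R]_(A, S)) (eps : R)
    (y : 'M[R]_(A, S)) : Prop :=
  P y /\ (optimal_value D P g y' <= objective D g y' y + eps%:E)%E.

End Prox.

Arguments D_l2 {R A S} y y'.
Arguments D_l1 {R A S} y y'.

(* Principal branch: for -1/e <= x, the unique w >= -1 with w e^w = x;
   outside this domain the set is empty and the value is 0. *)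
Definition lambertW {R : realType} (x : R) : R :=
  xget 0 [set w : R | -1 <= w /\ w * expR w = x].

(** * A real random-access machine

   Programs are finite syntax trees that do not mention [R]: the only literals
   are natural numbers, so a program cannot hide an arbitrary real constant.
   Memory consists of natural-number variables and of doubly indexed arrays of
   exact reals.  Every node of every evaluated expression, memory accesses and
   index computations included, has unit cost, and so has every command.
   Real operations inherit the totality conventions of the library
   (x / 0 = 0, ln x = 0 for x <= 0). *)

Inductive nexpr : Type :=
| NConst of nat
| NVar of nat
| NAdd of nexpr & nexpr.

Inductive rexpr : Type :=
| RNat of nexpr
| RGet of nat & nexpr & nexpr (* array name, row index, column index *)
| RAdd of rexpr & rexpr
| RSub of rexpr & rexpr
| RMul of rexpr & rexpr
| RDiv of rexpr & rexpr
| RPow of rexpr & rexpr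
| RExp of rexpr
| RLn of rexpr
| RLambertW of rexpr.

Inductive bexpr : Type :=
| BNLt of nexpr & nexpr
| BRLe of rexpr & rexpr.

Inductive cmd : Type :=
| Skip
| NSet of nat & nexpr
| RSet of nat & nexpr & nexpr & rexpr
| Seq of cmd & cmd
| If of bexpr & cmd & cmd
| While of bexpr & cmd.

Section Semantics.
Context {R : realType}.

Record state : Type := State {
  nmem : nat -> nat;
  rmem : nat -> nat -> nat -> R
}.

Implicit Types st : state.

Fixpoint neval st (e : nexpr) : nat :=
  match e with
  | NConst k => k
  | NVar x => nmem st x
  | NAdd e1 e2 => (neval st e1 + neval st e2)%N
  end.

Fixpoint reval st (e : rexpr) : R :=
  match e with
  | RNat e => (neval st e)%:R
  | RGet x i j => rmem st x (neval st i) (neval st j)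
  | RAdd e1 e2 => reval st e1 + reval st e2
  | RSub e1 e2 => reval st e1 - reval st e2
  | RMul e1 e2 => reval st e1 * reval st e2
  | RDiv e1 e2 => reval st e1 / reval st e2
  | RPow e1 e2 => reval st e1 `^ reval st e2
  | RExp e => expR (reval st e)
  | RLn e => ln (reval st e)
  | RLambertW e => lambertW (reval st e)
  end.

Definition beval st (b : bexpr) : bool :=
  match b with
  | BNLt e1 e2 => (neval st e1 < neval st e2)%N
  | BRLe e1 e2 => reval st e1 <= reval st e2
  end.

Fixpoint ncost (e : nexpr) : nat :=
  match e with
  | NConst _ | NVar _ => 1
  | NAdd e1 e2 => (1 + ncost e1 + ncost e2)%N
  end.

Fixpoint rcost (e : rexpr) : nat :=
  match e with
  | RNat e => (1 + ncost e)%N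
  | RGet _ i j => (1 + ncost i + ncost j)%N
  | RAdd e1 e2 | RSub e1 e2 | RMul e1 e2 | RDiv e1 e2 | RPow e1 e2 =>
      (1 + rcost e1 + rcost e2)%N
  | RExp e | RLn e | RLambertW e => (1 + rcost e)%N
  end.

Definition bcost (b : bexpr) : nat :=
  match b with
  | BNLt e1 e2 => (1 + ncost e1 + ncost e2)%N
  | BRLe e1 e2 => (1 + rcost e1 + rcost e2)%N
  end.

Definition nupd st (x v : nat) : state :=
  State (fun z => if z == x then v else nmem st z) (rmem st).

Definition rupd st (x i j : nat) (v : R) : state :=
  State (nmem st)
    (fun z k l => if [&& z == x, k == i & l == j] then v else rmem st z k l).

(* [exec c st n st'] : from state [st], command [c] halts in state [st'] after
   [n] unit-cost steps. *)
Inductive exec : cmd -> state -> nat -> state -> Prop :=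
| ExecSkip st : exec Skip st 1 st
| ExecNSet st x e :
    exec (NSet x e) st (1 + ncost e) (nupd st x (neval st e))
| ExecRSet st x i j e :
    exec (RSet x i j e) st (1 + ncost i + ncost j + rcost e)
      (rupd st x (neval st i) (neval st j) (reval st e))
| ExecSeq c1 c2 st1 st2 st3 n1 n2 :
    exec c1 st1 n1 st2 -> exec c2 st2 n2 st3 ->
    exec (Seq c1 c2) st1 (1 + n1 + n2) st3
| ExecIf b c1 c2 st st' n :
    exec (if beval st b then c1 else c2) st n st' ->
    exec (If b c1 c2) st (1 + bcost b + n) st'
| ExecWhileStop b c st :
    ~~ beval st b -> exec (While b c) st (1 + bcost b) st
| ExecWhileStep b c st1 st2 st3 n1 n2 :
    beval st1 b -> exec c st1 n1 st2 -> exec (While b c) st2 n2 st3 ->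
    exec (While b c) st1 (1 + bcost b + n1 + n2) st3.

(* Hence the existential over runs in the complexity claims is not angelic. *)
Lemma exec_deterministic c st n1 st1 n2 st2 :
  exec c st n1 st1 -> exec c st n2 st2 -> n1 = n2 /\ st1 = st2.
Proof.
move=> H; elim: H n2 st2 => {c st n1 st1}.
- by move=> s n2 s2 H; inversion H.
- by move=> s x e n2 s2 H; inversion H.
- by move=> s x i j e n2 s2 H; inversion H.
- move=> c1 c2 s1 s2 s3 n1 n2 _ I1 _ I2 m t H; inversion H; subst.
  by repeat match goal with
  | E : exec c1 _ _ _ |- _ => case: (I1 _ _ E) => ? ?; clear E; subst
  | E : exec c2 _ _ _ |- _ => case: (I2 _ _ E) => ? ?; clear E; subst
  end.
- move=> b c1 c2 s s' n _ I m t H; inversion H; subst.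
  by match goal with E : exec _ _ _ t |- _ => case: (I _ _ E) => ? ? end; subst.
- by move=> b c s /negbTE nb m t H; inversion H; subst => //; congruence.
- move=> b c s1 s2 s3 n1 n2 hb _ I1 _ I2 m t H; inversion H; subst.
    by match goal with E : is_true (~~ beval _ _) |- _ => rewrite hb in E end.
  by repeat match goal with
  | E : exec c _ _ _ |- _ => case: (I1 _ _ E) => ? ?; clear E; subst
  | E : exec (While b c) _ _ t |- _ =>
      case: (I2 _ _ E) => ? ?; clear E; subst
  end.
Qed.

(** Input/output convention: variables 0 and 1 hold S and A; arrays 0, 1, 2
   hold g, y', y^0; entries (0, 0) of arrays 3 and 4 hold alpha and epsilon;
   the result is read from array 5.  All other cells initially hold 0. *)

Definition mx_cells (A S : nat) (m : 'M[R]_(A, S)) (i j : nat) : R :=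
  match (insub i : option 'I_A), (insub j : option 'I_S) with
  | Some a, Some s => m a s
  | _, _ => 0
  end.

Definition scalar_cell (x : R) (i j : nat) : R :=
  if (i == 0%N) && (j == 0%N) then x else 0.

Definition input (A S : nat) (g y' y0 : 'M[R]_(A, S)) (alpha eps : R) : state :=
  State (nth 0%N [:: S; A])
    (nth (fun _ _ => 0)
      [:: mx_cells g; mx_cells y'; mx_cells y0;
          scalar_cell alpha; scalar_cell eps]).

Definition output (A S : nat) (st : state) : 'M[R]_(A, S) :=
  \matrix_(a < A, s < S) rmem st 5 a s.

End Semantics.

Arguments state R : clear implicits.

(** * Magnitude of the data *)

Section Magnitude.
Context {R : realType}.

Definition magnitude_le (A S : nat) (M : R) (g : 'M[R]_(A, S)) (alpha : R) :
    Prop :=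
  [/\ forall a s, `|g a s| <= M, alpha <= M & alpha^-1 <= M].

(* The magnitude of positive y', y^0 is measured by their log-likelihood ratio:
   lower bounds on the entries themselves would bound S. *)
Definition log_ratio_le (A S : nat) (M : R) (y' y0 : 'M[R]_(A, S)) : Prop :=
  forall a s, `|ln (y' a s / y0 a s)| <= M.

End Magnitude.

(* Main.v *)
(** In both parts the multiplier lambda of the divergence constraint is found by
   bisection.  What keeps the iteration counts independent of A and S is the
   choice of the intervals and of the stopping rules.

   l2.  Given lambda, row a of the maximiser of the Lagrangian solves
   z = y0 exp ((g + y' - mu - z) / lambda), which is a Lambert W value; mu is
   bisected until the mass N of the row is close to 1, and the row is
   normalised.  The resulting loss is at most (N - 1)^2 / 2, and starting from
   mu = E_y0 [g + y' - y0], with a bracket proportional to |ln N|, a number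
   O(log (1/eps)) of steps makes it at most eps^2 times the divergence of that
   row, so that the losses of the rows add up to O(eps).  The optimal lambda is
   within O(1) of lambda0 = sqrt (sum_a Var_y0 (g_a) / (2 alpha)).  Mixing the
   points obtained at both ends of the final bracket so that the constraint
   becomes tight loses at most alpha times the width of the bracket, whatever
   the slope of the divergence in lambda.

   l1.  The maximiser is the exponential tilt of y0 by b h, where
   h = ln (y' / y0) + 2 g / A and b = (A / 2) / (A / 2 + lambda).  Its divergence
   from y0 is Lipschitz in b uniformly in A and S, and comparison with the
   feasible point y' shows that infeasible lambda are O(sqrt A).  Hence
   lambda = sqrt A * z / (1 - z) is bisected over z in [0, 1] until the duality
   gap lambda (alpha - K) is at most eps. *)

Require Import Defs.
From HB Require Import structures.
From mathcomp Require Import all_boot all_order all_algebra.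
From mathcomp Require Import all_classical all_reals all_analysis.
From mathcomp Require Import ring lra zify.

Set Implicit Arguments.
Unset Strict Implicit.
Unset Printing Implicit Defensive.

Import Order.TTheory GRing.Theory Num.Theory.
Import numFieldNormedType.Exports.

Local Open Scope ring_scope.

(** * Scalar inequalities *)

Section Scalar.
Context {R : realType}.
Implicit Types a b p q u w x y : R.

(** Two obstacles shape the proof. The programs are quantified before [M], so nothing that they
    execute may depend on it: the l2 bracket and tolerances are computed from the data, the l1 loop
    stops on a gap that it can evaluate, and [M] enters only the iteration counts. Moreover every
    error is summed over [A] rows, and a tolerance [eps / A] per row would put a logarithm of [A]
    into the cost. Errors are therefore measured in a quantity whose total over the rows the
    constraint already bounds, the divergence from [y0]. To make this precise, a computed l2 row is
    not treated as an approximate maximiser. It is an exact stationary point of a neighbouring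
    problem, in which the quadratic term has a coefficient [N] close to 1 instead of 1. Computed
    points are handled through exponents, [p i = q i * expR (u i)], so that duality reduces to the
    single inequality [gibbs], zero entries of [y0] included. *)

Lemma expR_sub_le a b : expR a - expR b <= expR a * (a - b).
Proof.
have -> : expR b = expR a * expR (b - a) by rewrite -expRD addrC subrK.
have := expR_ge1Dx (b - a); have := expR_gt0 a => /ltW; nra.
Qed.

Lemma expR_sub_mul_le a b c : a <= c -> b <= c ->
  (expR a - expR b) * (a - b) <= expR c * (a - b) ^+ 2.
Proof.
move=> ac bc.
wlog ab : a b ac bc / b <= a.
  move=> h; have [/h|/ltW/h] := leP b a; first exact.
  by move=> /(_ bc ac); rewrite -[X in _ <= _ * X]sqrrN opprB -mulrNN !opprB.
rewrite expr2 mulrA ler_wpM2r ?subr_ge0//.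
by apply: (le_trans (expR_sub_le a b)); rewrite ler_wpM2r ?subr_ge0// ler_expR.
Qed.

(** Convexity of [expR] at [ln (y / q)], as the Fenchel-Young inequality for [y * ln (y / q) - y]
    and its conjugate [q * expR u]. The last hypothesis excludes the case in which division by 0
    would turn an infinite divergence into 0. *)
Lemma fenchel_young q y u : 0 <= q -> 0 <= y -> (q = 0 -> y = 0) ->
  y * u + y - q * expR u <= y * ln (y / q).
Proof.
move=> q0 y0 qy.
have [qz|qnz] := eqVneq q 0; first by rewrite (qy qz) qz !mul0r subr0 addr0.
have [->|ynz] := eqVneq y 0.
  by rewrite !mul0r !add0r oppr_le0 mulr_ge0 // expR_ge0.
have qp : 0 < q by rewrite lt_def qnz.
have yp : 0 < y by rewrite lt_def ynz.
have yq : y = q * expR (ln (y / q)).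
  by rewrite lnK ?posrE ?divr_gt0// mulrCA divff// mulr1.
set l := ln _ in yq *.
have := ler_wpM2l q0 (expR_sub_le l u); rewrite mulrBr mulrA -yq; lra.
Qed.

(** Both sides are compared with the Hellinger term [(expR (u / 2) - 1) ^+ 2]. Smallness of [u] is
    not assumed: the l1 part has exponents bounded only by multiples of [M]. *)
Lemma kl_fun_quad_lb u : expR (- `|u|) * u ^+ 2 / 4 <= u * expR u - expR u + 1.
Proof.
have e2 : expR u = expR (u / 2) ^+ 2 by rewrite -expRM_natl; congr expR; lra.
have hell : (expR (u / 2) - 1) ^+ 2 <= u * expR u - expR u + 1.
  have h := expR_ge1Dx (- (u / 2)).
  have : expR (u / 2) * expR (- (u / 2)) = 1 by rewrite -expRD subrr expR0.
  have := expR_gt0 (u / 2); move: h; rewrite e2; set t := expR (u / 2).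
  set w := expR (- _) => h t0 tw.
  have : 0 <= t ^+ 2 * (w - 1 + u / 2) by rewrite mulr_ge0 ?sqr_ge0//; lra.
  nra.
apply: le_trans hell.
have [u0|u0] := leP 0 u.
  have h := expR_ge1Dx (u / 2).
  have : expR (- u) <= 1 by rewrite expR_le1; lra.
  have := expR_ge0 (- u); move: h; rewrite ger0_norm//.
  set t := expR (- u); set w := expR _ => h t0 t1.
  have h2 : (u / 2) ^+ 2 <= (w - 1) ^+ 2 by rewrite lerXn2r ?nnegrE; lra.
  apply: le_trans h2; have -> : (u / 2) ^+ 2 = u ^+ 2 / 4 by field.
  by have := sqr_ge0 u; nra.
have h := expR_ge1Dx (- (u / 2)).
rewrite ltr0_norm// opprK e2.
have := expR_sub_le (u / 2) 0; rewrite expR0 subr0.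
have := expR_gt0 (u / 2); set t := expR (u / 2) => t0 tw.
have h2 : (- (t * (u / 2))) ^+ 2 <= (- (t - 1)) ^+ 2.
  by rewrite lerXn2r ?nnegrE; nra.
by move: h2; rewrite !sqrrN; apply: le_trans; rewrite le_eqVlt; apply/orP; left; apply/eqP; field.
Qed.

Lemma hellinger_le q y : 0 <= q -> 0 <= y -> (q = 0 -> y = 0) ->
  (Num.sqrt y - Num.sqrt q) ^+ 2 <= y * ln (y / q) - y + q.
Proof.
move=> q0 y0 qy.
have [yz|ynz] := eqVneq y 0; first by rewrite yz mul0r sqrtr0 sub0r sqrrN sqr_sqrtr ?subr0 ?add0r.
have qnz : q != 0 by apply: contra_neq ynz => /qy.
have qp : 0 < q by rewrite lt_def qnz.
have yp : 0 < y by rewrite lt_def ynz.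
have yq : y = q * expR (ln (y / q)).
  by rewrite lnK ?posrE ?divr_gt0// mulrCA divff// mulr1.
set l := ln _ in yq *.
have e2 : expR l = expR (l / 2) ^+ 2 by rewrite -expRM_natl; congr expR; lra.
have sy : Num.sqrt y = Num.sqrt q * expR (l / 2).
  by rewrite yq e2 sqrtrM// sqrtr_sqr ger0_norm ?expR_ge0.
rewrite sy yq e2.
have h := expR_ge1Dx (- (l / 2)).
have : expR (l / 2) * expR (- (l / 2)) = 1 by rewrite -expRD subrr expR0.
have := expR_gt0 (l / 2); move: h; set t := expR (l / 2); set w := expR (- _) => h t0 tw.
have : 0 <= t ^+ 2 * (w - 1 + l / 2) by rewrite mulr_ge0 ?sqr_ge0//; lra.
set s := Num.sqrt q => h2.
have hs : 0 <= s ^+ 2 * (t ^+ 2 * (w - 1 + l / 2)) by rewrite mulr_ge0 ?sqr_ge0.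
have E : t ^+ 2 * (w - 1 + l / 2) = t - t ^+ 2 + t ^+ 2 * (l / 2).
  by rewrite mulrDr mulrBr mulr1 {1}expr2 -mulrA tw mulr1.
by rewrite E in hs; move: hs; rewrite (_ : s ^+ 2 = q) ?sqr_sqrtr// => hs; have : (s * t - s) ^+ 2 = q * (t ^+ 2 - 2 * t + 1); [rewrite -[in RHS](sqr_sqrtr q0) -/s; ring | lra].
Qed.

Lemma is_derive_ge0_le (f df : R -> R) x : 0 <= x ->
  (forall t : R, is_derive t (1 : R) f (df t)) ->
  (forall t, 0 <= t <= x -> 0 <= df t) -> f 0 <= f x.
Proof.
move=> x0 fd df0.
have fc : {within `[0, x], continuous f}%classic.
  by apply: derivable_within_continuous => t _; have [] := fd t.
have [c cx] := MVT_segment x0 (fun t _ => fd t) fc.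
rewrite subr0 => e; rewrite -subr_ge0 e mulr_ge0// df0//.
Qed.

Lemma expR_quad_ub u : u <= 2^-1 -> expR u <= 1 + u + 2 * u ^+ 2.
Proof.
move=> u1; have := expR_ge1Dx (- u).
have : expR u * expR (- u) = 1 by rewrite -expRD subrr expR0.
have := expR_gt0 u; set t := expR u; set w := expR (- u) => t0 tw h.
have h1 : t * (1 - u) <= 1 by have := ler_wpM2l (ltW t0) h; rewrite tw.
have h2 : 1 <= (1 + u + 2 * u ^+ 2) * (1 - u).
  have : 0 <= u ^+ 2 * (1 - 2 * u) by apply: mulr_ge0; [exact: sqr_ge0 | lra].
  lra.
have p : 0 < 1 - u by lra.
by rewrite -(ler_pM2r p); lra.
Qed.

(** The middle expression has derivative [u * expR u], whose bounds are integrated from 0. The sharp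
    coefficient 1/2, with relative error proportional to [|u|], is what locates the l2 multiplier up
    to an additive rather than a multiplicative error. *)
Lemma kl_fun_bounds u : `|u| <= 8^-1 ->
  (1 - `|u|) * (u ^+ 2 / 2) <= u * expR u - expR u + 1 <=
  (1 + 2 * `|u|) * (u ^+ 2 / 2).
Proof.
move=> u8.
have [u0|u0] := leP 0 u.
  rewrite (ger0_norm u0) in u8 *.
  pose f t : R := t * expR t - expR t + 1 - t ^+ 2 / 2.
  pose g t : R := (1 + 2 * t) * (t ^+ 2 / 2) - (t * expR t - expR t + 1).
  have f0 : f 0 = 0 by rewrite /f expR0; ring.
  have g0 : g 0 = 0 by rewrite /g expR0; ring.
  have fu : f 0 <= f u.
    apply: (@is_derive_ge0_le f (fun t => t * expR t - t)) => [//|t|t].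
      by apply: is_derive_eq; rewrite /GRing.scale /=; field.
    move=> /andP[t0 tu]; have := expR_ge1Dx t; have := expR_gt0 t; nra.
  have gu : g 0 <= g u.
    apply: (@is_derive_ge0_le g (fun t => t + 3 * t ^+ 2 - t * expR t)) => [//|t|t].
      by apply: is_derive_eq; rewrite /GRing.scale /=; field.
    move=> /andP[t0 tu]; have : expR t <= 1 + t + 2 * t ^+ 2.
      by apply: expR_quad_ub; lra.
    nra.
  rewrite f0 /f in fu; rewrite g0 /g in gu.
  by apply/andP; split; [nra | lra].
rewrite (ltr0_norm u0) in u8 *.
(* [is_derive_ge0_le] integrates to the right of 0, hence the passage to [v = - u]. *)
have -> : u = - (- u) by rewrite opprK.
move: (- u) (oppr_gt0 u) u8 => v; rewrite u0 => v0 v8.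
rewrite opprK sqrrN {u u0}.
pose f t : R := 1 - (1 + t) * expR (- t) - (1 - t) * (t ^+ 2 / 2).
pose g t : R := t ^+ 2 / 2 - (1 - (1 + t) * expR (- t)).
have f0 : f 0 = 0 by rewrite /f oppr0 expR0; ring.
have g0 : g 0 = 0 by rewrite /g oppr0 expR0; ring.
have fu : f 0 <= f v.
  apply: (@is_derive_ge0_le f (fun t => t * expR (- t) - t + 3 / 2 * t ^+ 2)) => [|t|t].
  - exact: ltW.
  - by apply: is_derive_eq; rewrite /GRing.scale /=; field.
  - move=> /andP[t0 tu]; have := expR_ge1Dx (- t); nra.
have gu : g 0 <= g v.
  apply: (@is_derive_ge0_le g (fun t => t - t * expR (- t))) => [|t|t].
  - exact: ltW.
  - by apply: is_derive_eq; rewrite /GRing.scale /=; field.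
  - move=> /andP[t0 tu]; have : expR (- t) <= 1 by rewrite expR_le1; lra.
    nra.
rewrite f0 /f in fu; rewrite g0 /g in gu.
have v2 := sqr_ge0 v.
by apply/andP; split; [lra | nra].
Qed.

End Scalar.

(** * Finite distributions and relative entropy *)

Section Finite.
Context {R : realType} {I : finType}.
Implicit Types p q w x y : I -> R.

Lemma cauchy_schwarz x y :
  (\sum_i x i * y i) ^+ 2 <= (\sum_i x i ^+ 2) * (\sum_i y i ^+ 2).
Proof.
set a := \sum_i x i ^+ 2; set b := \sum_i x i * y i; set c := \sum_i y i ^+ 2.
have a0 : 0 <= a by apply: sumr_ge0 => i _; exact: sqr_ge0.
have disc t : 0 <= a * t ^+ 2 - 2 * t * b + c.
  have -> : a * t ^+ 2 - 2 * t * b + c = \sum_i (t * x i - y i) ^+ 2.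
    rewrite /a /b /c mulr_suml mulr_sumr -sumrB -big_split /=.
    by apply: eq_bigr => i _; ring.
  by apply: sumr_ge0 => i _; exact: sqr_ge0.
have [az|anz] := eqVneq a 0.
  have x0 i : x i = 0.
    apply/eqP; rewrite -sqrf_eq0; apply/eqP.
    by apply: (psumr_eq0P _ az) => // j _; exact: sqr_ge0.
  by rewrite /b big1 ?expr0n ?az ?mul0r// => i _; rewrite x0 mul0r.
have ap : 0 < a by rewrite lt_def anz.
have := disc (b / a).
have -> : a * (b / a) ^+ 2 - 2 * (b / a) * b + c = (a * c - b ^+ 2) / a by field.
by rewrite pmulr_lge0 ?invr_gt0// subr_ge0.
Qed.

Definition wnorm w x : R := Num.sqrt (\sum_i w i * x i ^+ 2).

Lemma wnorm_ge0 w x : 0 <= wnorm w x. Proof. exact: sqrtr_ge0. Qed.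

Lemma wnorm_sum_ge0 w x : (forall i, 0 <= w i) -> 0 <= \sum_i w i * x i ^+ 2.
Proof. by move=> w0; apply: sumr_ge0 => i _; rewrite mulr_ge0 ?sqr_ge0. Qed.

Lemma sqr_wnorm w x : (forall i, 0 <= w i) ->
  wnorm w x ^+ 2 = \sum_i w i * x i ^+ 2.
Proof. by move=> w0; rewrite sqr_sqrtr// wnorm_sum_ge0. Qed.

Lemma wnorm_triangle w x y : (forall i, 0 <= w i) ->
  wnorm w (fun i => x i + y i) <= wnorm w x + wnorm w y.
Proof.
move=> w0.
have cs : \sum_i w i * (x i * y i) <= wnorm w x * wnorm w y.
  have := cauchy_schwarz (fun i => Num.sqrt (w i) * x i) (fun i => Num.sqrt (w i) * y i).
  have sq z : \sum_i (Num.sqrt (w i) * z i) ^+ 2 = wnorm w z ^+ 2.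
    by rewrite sqr_wnorm//; apply: eq_bigr => i _; rewrite exprMn sqr_sqrtr.
  rewrite !sq -exprMn.
  have -> : \sum_i Num.sqrt (w i) * x i * (Num.sqrt (w i) * y i) =
            \sum_i w i * (x i * y i).
    by apply: eq_bigr => i _; rewrite mulrACA -expr2 sqr_sqrtr.
  move=> h; apply: le_trans (ler_norm _) _.
  by rewrite -ler_sqr ?nnegrE ?mulr_ge0 ?wnorm_ge0// real_normK ?num_real.
rewrite -ler_sqr ?nnegrE ?addr_ge0 ?wnorm_ge0// sqrrD !sqr_wnorm//.
have -> : \sum_i w i * (x i + y i) ^+ 2 =
  \sum_i w i * x i ^+ 2 + (\sum_i w i * (x i * y i)) *+ 2 + \sum_i w i * y i ^+ 2.
  rewrite mulr2n -!big_split /=; apply: eq_bigr => i _; ring.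
by rewrite lerD2r lerD2l lerMn2r cs orbT.
Qed.

Definition distr p := (forall i, 0 <= p i) /\ \sum_i p i = 1.
Definition abscont p q := forall i, q i = 0 -> p i = 0.
Definition klr p q := \sum_i p i * ln (p i / q i).

Lemma distr_le1 p i : distr p -> p i <= 1.
Proof.
by move=> [p0 <-]; rewrite (bigD1 i)//= lerDl sumr_ge0.
Qed.

(** The Gibbs variational principle: when [fenchel_young] is summed, its affine terms cancel because
    [p] and the tilt [q * expR u] both have mass 1. The duality arguments of both setups rest on
    it. *)
Lemma gibbs p q u : distr p -> (forall i, 0 <= q i) -> abscont p q ->
  \sum_i q i * expR (u i) = 1 -> \sum_i p i * u i <= klr p q.
Proof.
move=> [p0 p1] q0 pq qu.
have -> : \sum_i p i * u i = \sum_i (p i * u i + p i - q i * expR (u i)).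
  by rewrite sumrB big_split /= p1 qu addrK.
by apply: ler_sum => i _; apply: fenchel_young => //; exact: pq.
Qed.

Lemma sum_expR_distr q : distr q -> \sum_i q i * expR 0 = 1.
Proof. by move=> [_ <-]; apply: eq_bigr => i _; rewrite expR0 mulr1. Qed.

Lemma klr_ge0 p q : distr p -> distr q -> abscont p q -> 0 <= klr p q.
Proof.
move=> hp hq pq; apply: le_trans (gibbs hp hq.1 pq (sum_expR_distr hq)).
by rewrite big1// => i _; rewrite mulr0.
Qed.

Let hell p q := \sum_i (Num.sqrt (p i) - Num.sqrt (q i)) ^+ 2.

Let hell_le p q : distr p -> distr q -> abscont p q -> hell p q <= klr p q.
Proof.
move=> [p0 p1] [q0 q1] pq.
have -> : klr p q = \sum_i (p i * ln (p i / q i) - p i + q i).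
  by rewrite big_split/= sumrB p1 q1 subrK.
by apply: ler_sum => i _; apply: hellinger_le => //; exact: pq.
Qed.

Let sqrt_le1 p i : distr p -> Num.sqrt (p i) <= 1.
Proof. by move=> hp; rewrite -sqrtr1 ler_wsqrtr// distr_le1. Qed.

Lemma l2_le_klr p q : distr p -> distr q -> abscont p q ->
  \sum_i (p i - q i) ^+ 2 <= 4 * klr p q.
Proof.
move=> hp hq pq; apply: (@le_trans _ _ (4 * hell p q)); last by rewrite ler_wpM2l// hell_le.
rewrite mulr_sumr; apply: ler_sum => i _.
rewrite -{1}(sqr_sqrtr (hp.1 i)) -{1}(sqr_sqrtr (hq.1 i)) subr_sqr exprMn mulrC.
rewrite ler_wpM2r ?sqr_ge0//.
have := sqrt_le1 i hp; have := sqrt_le1 i hq.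
have := sqrtr_ge0 (p i); have := sqrtr_ge0 (q i); nra.
Qed.

(** Pinsker's inequality with 4 in place of the optimal 2, from the Hellinger bound and
    Cauchy-Schwarz. *)
Lemma l1_le_klr p q : distr p -> distr q -> abscont p q ->
  (\sum_i `|p i - q i|) ^+ 2 <= 4 * klr p q.
Proof.
move=> hp hq pq; apply: (@le_trans _ _ (hell p q * 4)); last first.
  by rewrite mulrC ler_wpM2l// hell_le.
have -> : \sum_i `|p i - q i| = \sum_i `|Num.sqrt (p i) - Num.sqrt (q i)| * `|Num.sqrt (p i) + Num.sqrt (q i)|.
  apply: eq_bigr => i _.
  by rewrite -normrM -subr_sqr !sqr_sqrtr ?hp.1 ?hq.1.
apply: le_trans (cauchy_schwarz _ _) _.
have -> : \sum_i `|Num.sqrt (p i) - Num.sqrt (q i)| ^+ 2 = hell p q.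
  by apply: eq_bigr => i _; rewrite real_normK ?num_real.
rewrite ler_wpM2l ?sumr_ge0// => [i _|]; first exact: sqr_ge0.
have -> : 4 = \sum_i (2 * p i + 2 * q i) :> R.
  by rewrite big_split /= -!mulr_sumr hp.2 hq.2; lra.
apply: ler_sum => i _; rewrite real_normK ?num_real//.
rewrite -{2}(sqr_sqrtr (hp.1 i)) -{2}(sqr_sqrtr (hq.1 i)).
have := sqr_ge0 (Num.sqrt (p i) - Num.sqrt (q i)); nra.
Qed.

(* The form [q e^u] keeps the coordinates with [q i = 0] harmless. *)
Lemma klr_expR p q u : (forall i, p i = q i * expR (u i)) ->
  klr p q = \sum_i p i * u i.
Proof.
move=> pu; apply: eq_bigr => i _; rewrite pu.
have [->|qn] := eqVneq (q i) 0; first by rewrite !mul0r.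
by congr (_ * _); rewrite mulrAC divff// mul1r expRK.
Qed.

(** Adding the two masses, which cancel, makes every summand nonnegative, so that divergences can be
    estimated coordinate by coordinate. *)
Lemma klr_kl_fun p q u : distr p -> distr q -> (forall i, p i = q i * expR (u i)) ->
  klr p q = \sum_i q i * (u i * expR (u i) - expR (u i) + 1).
Proof.
move=> [_ p1] [_ q1] pu; rewrite (klr_expR pu).
have -> : \sum_i p i * u i = \sum_i (p i * u i - p i + q i).
  by rewrite big_split/= sumrB p1 q1 subrK.
by apply: eq_bigr => i _; rewrite pu; ring.
Qed.

End Finite.

(** * One row of the l2 problem *)

Section Lambert.
Context {R : realType}.
Implicit Types x : R.

Lemma lambertWP x : 0 <= x ->
  0 <= lambertW x /\ lambertW x * expR (lambertW x) = x.
Proof.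
move=> x0.
have cf : {within `[0, x], continuous (fun w : R => w * expR w)}%classic.
  by apply: derivable_within_continuous => t _.
have [|w _ we] := IVT x0 cf (v := x).
  rewrite mul0r min_l ?max_r ?x0//= ?mulr_ge0 ?expR_ge0//.
  by rewrite ler_peMr// -expR0 ler_expR.
have /xgetPex : ([set w : R | -1 <= w /\ w * expR w = x] !=set0)%classic.
  exists w; split => //; have := expR_gt0 w; nra.
move=> /(_ 0)[_]; rewrite -/(lambertW x) => e; split => //.
by have := expR_gt0 (lambertW x); nra.
Qed.

End Lambert.

Section Row.
Context {R : realType} {I : finType}.
Variables (q c : I -> R) (lam : R).
Hypotheses (hq : distr q) (lam_gt0 : 0 < lam).

(** With [z = lam * w], the stationarity equation of [zrowE] becomes [w * expR w = q i / lam * expR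
    ((c i - mu) / lam)], whose right-hand side is nonnegative. *)
Definition zrow (mu : R) (i : I) : R :=
  lam * lambertW (q i / lam * expR ((c i - mu) / lam)).

Definition nrow (mu : R) : R := \sum_i zrow mu i.

Let lam_neq0 : lam != 0. Proof. by rewrite gt_eqF. Qed.

Let harg mu i : 0 <= q i / lam * expR ((c i - mu) / lam).
Proof. by rewrite mulr_ge0 ?expR_ge0// divr_ge0 ?hq.1// ltW. Qed.

Lemma zrow_ge0 mu i : 0 <= zrow mu i.
Proof. by rewrite mulr_ge0 ?(ltW lam_gt0)//; case: (lambertWP (harg mu i)). Qed.

Lemma zrowE mu i : zrow mu i = q i * expR ((c i - mu - zrow mu i) / lam).
Proof.
have [_] := lambertWP (harg mu i); rewrite /zrow; set w := lambertW _ => we.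
rewrite mulrBl expRD [lam * w / lam]mulrAC divff// mul1r expRN.
have : lam * (w * expR w) = q i * expR ((c i - mu) / lam) by rewrite we; field.
by move=> h; rewrite mulrA -h mulrA mulfK// gt_eqF ?expR_gt0.
Qed.

Lemma zrow_anti mu1 mu2 i : mu1 <= mu2 -> zrow mu2 i <= zrow mu1 i.
Proof.
move=> h; rewrite leNgt; apply/negP => lt.
suff : zrow mu2 i <= zrow mu1 i by rewrite leNgt lt.
rewrite zrowE [leRHS]zrowE ler_wpM2l ?hq.1// ler_expR ler_wpM2r ?invr_ge0 ?(ltW lam_gt0)//; lra.
Qed.

Lemma zrow_le_expR mu1 mu2 i : mu1 <= mu2 ->
  zrow mu1 i <= zrow mu2 i * expR ((mu2 - mu1) / lam).
Proof.
move=> h; rewrite zrowE [X in _ <= X * _]zrowE -mulrA -expRD ler_wpM2l ?hq.1//.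
rewrite ler_expR -mulrDl ler_wpM2r ?invr_ge0 ?(ltW lam_gt0)//.
have := zrow_anti i h; lra.
Qed.

(** Differentiating [zrowE] gives [ln z] the slope [- 1 / (lam + z)] in [mu]. A bound [Z] at the
    left end, where [z] is largest, therefore forces a minimal decay; [zrow_le_expR] is the opposite
    bound, with slope [1 / lam]. *)
Lemma zrow_ge_expR mu1 mu2 Z i : 0 <= Z -> mu1 <= mu2 -> zrow mu1 i <= Z ->
  zrow mu2 i * expR ((mu2 - mu1) / (lam + Z)) <= zrow mu1 i.
Proof.
move=> Z0 h z1Z; rewrite leNgt; apply/negP => lt.
set x := (mu2 - mu1) / (lam + Z) in lt.
have lZ : 0 < lam + Z by rewrite ltr_wpDr.
have dx : mu2 - mu1 = (lam + Z) * x by rewrite /x; field; rewrite gt_eqF.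
have x0 : 0 <= x by rewrite /x divr_ge0 ?subr_ge0// ltW.
have zz : zrow mu1 i = zrow mu2 i * expR ((mu2 - mu1 - (zrow mu1 i - zrow mu2 i)) / lam).
  rewrite [LHS]zrowE [X in _ = X * _]zrowE -mulrA -expRD.
  by congr (_ * expR _); field.
set z1 := zrow mu1 i in z1Z lt zz *; set z2 := zrow mu2 i in lt zz *.
have z20 : 0 <= z2 := zrow_ge0 _ _; have z10 : 0 <= z1 := zrow_ge0 _ _.
have [z2z|z2n] := eqVneq z2 0.
  by move: lt; rewrite zz z2z !mul0r ltxx.
have z2p : 0 < z2 by rewrite lt_def z2n.
move: (lt); rewrite {1}zz ltr_pM2l// ltr_expR ltr_pdivrMr// => l1.
have e1 := expR_ge1Dx (- x).
have e2 : expR x * expR (- x) = 1 by rewrite -expRD subrr expR0.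
have : z1 * expR (- x) <= z2.
  apply: ltW; move: lt; rewrite -(ltr_pM2r (expR_gt0 (- x))) -(mulrA z2) e2 mulr1.
  by [].
nra.
Qed.

Lemma nrow_gt0 mu : 0 < nrow mu.
Proof.
rewrite lt_def sumr_ge0 ?andbT => [|i _]; last exact: zrow_ge0.
apply/eqP => n0.
have q0 i : q i = 0.
  have : zrow mu i = 0 by apply: (psumr_eq0P _ n0) => // j _; exact: zrow_ge0.
  by rewrite zrowE => /eqP; rewrite mulf_eq0 (gt_eqF (expR_gt0 _)) orbF => /eqP.
by have := hq.2; rewrite big1// => /esym/eqP; rewrite oner_eq0.
Qed.

Lemma nrow_anti mu1 mu2 : mu1 <= mu2 -> nrow mu2 <= nrow mu1.
Proof. by move=> h; apply: ler_sum => i _; exact: zrow_anti. Qed.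

Lemma ln_nrow_anti mu1 mu2 : mu1 <= mu2 -> ln (nrow mu2) <= ln (nrow mu1).
Proof. by move=> h; rewrite ler_ln ?posrE ?nrow_gt0// nrow_anti. Qed.

Lemma ln_nrow_le mu1 mu2 : mu1 <= mu2 ->
  ln (nrow mu1) <= ln (nrow mu2) + (mu2 - mu1) / lam.
Proof.
move=> h; rewrite -ler_expR expRD !lnK ?posrE ?nrow_gt0//.
by rewrite /nrow mulr_suml; apply: ler_sum => i _; exact: zrow_le_expR.
Qed.

Lemma ln_nrow_lip mu1 mu2 :
  `|ln (nrow mu1) - ln (nrow mu2)| <= `|mu1 - mu2| / lam.
Proof.
wlog h : mu1 mu2 / mu1 <= mu2.
  move=> H; have [/H//|/ltW/H] := leP mu1 mu2.
  by rewrite distrC [`|mu2 - _|]distrC.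
have := ln_nrow_anti h; have := ln_nrow_le h => h1 h2.
rewrite ger0_norm ?subr_ge0// ler0_norm ?subr_le0// opprB; lra.
Qed.

(** The multiplier at which the [q]-average of the exponent in [zrowE] vanishes for the guess
    [z = q]. *)
Definition mu_init : R := \sum_i q i * (c i - q i).

Variables (G D : R).
Hypotheses (G_ge0 : 0 <= G) (hc : forall i, - G <= c i <= G + 1)
  (hD : 2 * G + 4 <= D).

Let mu_init_bound : - (G + 1) <= mu_init <= G + 1.
Proof.
have -> : G + 1 = \sum_i q i * (G + 1) by rewrite -mulr_suml hq.2 mul1r.
rewrite -sumrN; apply/andP; split; apply: ler_sum => i _.
  rewrite -mulrN ler_wpM2l ?hq.1//; have := distr_le1 i hq; have /andP[] := hc i; lra.
by rewrite ler_wpM2l ?hq.1//; have := hq.1 i; have /andP[] := hc i; lra.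
Qed.

Let c0_bound i : `|c i - q i - mu_init| <= 2 * G + 2.
Proof.
rewrite ler_norml; have /andP[? ?] := hc i; have /andP[? ?] := mu_init_bound.
by have := distr_le1 i hq; have := hq.1 i; lra.
Qed.

Let zrow_init_le i : zrow mu_init i <= D.
Proof.
have hD' := hD; have G0' := G_ge0.
have [h|h] := leP (zrow mu_init i) 1.
  by apply: (le_trans h); lra.
have : q i <= zrow mu_init i by have := distr_le1 i hq; lra.
rewrite {1}zrowE => h1; have := c0_bound i; rewrite ler_norml => /andP[_ h2].
have [h3|h3] := leP 0 ((c i - mu_init - zrow mu_init i) / lam).
  have : 0 <= c i - mu_init - zrow mu_init i by move: h3; rewrite pmulr_lge0 ?invr_gt0.
  by have := distr_le1 i hq; lra.
move: h; rewrite zrowE => h; exfalso.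
suff : q i * expR ((c i - mu_init - zrow mu_init i) / lam) <= 1 by lra.
have : expR ((c i - mu_init - zrow mu_init i) / lam) <= 1 by rewrite expR_le1 ltW.
move=> h4; apply: le_trans (distr_le1 i hq); rewrite ler_piMr ?hq.1//.
Qed.

Let ln_init_le : `|ln (nrow mu_init)| <= D / lam.
Proof.
have hD' := hD; have G0' := G_ge0.
have cb i : `|c i - q i - mu_init| <= D by have := c0_bound i; lra.
have li : 0 <= lam^-1 by rewrite invr_ge0 ltW.
have hub i : zrow mu_init i <= q i * expR (D / lam).
  have [h|h] := leP (zrow mu_init i) (q i).
    apply: (le_trans h); rewrite ler_peMr ?hq.1// -expR0 ler_expR divr_ge0// ?ltW//; lra.
  rewrite zrowE ler_wpM2l ?hq.1// ler_expR ler_wpM2r//.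
  by have := cb i; rewrite ler_norml; lra.
have hlb i : q i * expR (- (D / lam)) <= zrow mu_init i.
  have [h|h] := leP (q i) (zrow mu_init i).
    apply: le_trans h; rewrite ler_piMr ?hq.1// expR_le1 oppr_le0 divr_ge0// ?ltW//; lra.
  rewrite zrowE ler_wpM2l ?hq.1// ler_expR -mulNr ler_wpM2r//.
  by have := cb i; rewrite ler_norml; lra.
rewrite ler_norml -ler_expR -[X in _ && X]ler_expR lnK ?posrE ?nrow_gt0//.
apply/andP; split.
  by rewrite -[leLHS]mul1r -hq.2 mulr_suml; exact: ler_sum.
by rewrite -[leRHS]mul1r -hq.2 mulr_suml; exact: ler_sum.
Qed.

Definition bstep (f : R -> bool) (p : R * R) : R * R :=
  let m := (p.1 + p.2) / 2 in if f m then (m, p.2) else (p.1, m).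

(** While the entries stay below [D], [ln (nrow mu)] has slope at least [1 / (lam + D)] in absolute
    value, so a displacement by [wid] carries it past 0. Proportionality to the initial error is
    what later lets the final error shrink with the divergence of the row. *)
Definition wid : R := (lam + D) * `|ln (nrow mu_init)|.

Definition bracket (k : nat) : R * R :=
  iter k (bstep (fun m => 1 <= nrow m)) (mu_init - wid, mu_init + wid).

(** The left end is taken because the mass is at least 1 there. *)
Definition mu_hat (k : nat) : R := (bracket k).1.

Definition yrow (k : nat) (i : I) : R := zrow (mu_hat k) i / nrow (mu_hat k).

Let wid_ge0 : 0 <= wid.
Proof.
by have := hD; have := G_ge0; have := lam_gt0 => *; rewrite mulr_ge0//; lra.
Qed.

Let bracketP k : [/\ 1 <= nrow (bracket k).1, nrow (bracket k).2 <= 1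
  & (bracket k).2 - (bracket k).1 = 2 * wid * 2^-1 ^+ k].
Proof.
elim: k => [|k [h1 h2 h3]]; last first.
  rewrite /bracket iterS -/(bracket k) /bstep; case: ifPn => [h|h] /=; split=> //.
  - by rewrite exprS mulrCA -h3; field.
  - by rewrite -ltNge in h; exact: ltW.
  - by rewrite exprS mulrCA -h3; field.
have hD' := hD; have G0' := G_ge0; have l0' := lam_gt0; have w0 := wid_ge0.
have D0 : 0 <= D by lra.
have lD : 0 < lam + D by lra.
have lDn : lam + D != 0 by rewrite gt_eqF.
have n0 := nrow_gt0 mu_init.
have we : wid / (lam + D) = `|ln (nrow mu_init)| by rewrite /wid; field.
rewrite /bracket/=; split; last by rewrite expr0; ring.
- have [l0|l0] := leP 0 (ln (nrow mu_init)).
    apply: (@le_trans _ _ (nrow mu_init)); last by apply: nrow_anti; lra.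
    by rewrite -(lnK n0) -expR0 ler_expR.
  (* Entries grow to the left of [mu_init], so the bound [D] known there is not inherited. Either
     some entry exceeds 1, and the mass is already large enough, or all are at most 1, hence at most
     [D], and the slope bound applies. *)
  have [[i zi]|no] := pselect (exists i, 1 < zrow (mu_init - wid) i).
    apply: (le_trans (ltW zi)); rewrite /nrow (bigD1 i)//= lerDl sumr_ge0// => j _.
    exact: zrow_ge0.
  have -> : 1 = nrow mu_init * expR (wid / (lam + D)).
    by rewrite we ltr0_norm// expRN lnK// divff// gt_eqF.
  rewrite /nrow mulr_suml; apply: ler_sum => i _.
  have -> : wid / (lam + D) = (mu_init - (mu_init - wid)) / (lam + D) by congr (_ / _); ring.
  apply: zrow_ge_expR; rewrite ?gerBl//.
  by have : ~ (1 < zrow (mu_init - wid) i) by [move=> ?; apply: no; exists i]; move/negP; rewrite -leNgt; lra.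
- have h : nrow (mu_init + wid) * expR (wid / (lam + D)) <= nrow mu_init.
    rewrite /nrow mulr_suml; apply: ler_sum => i _.
    have -> : wid / (lam + D) = (mu_init + wid - mu_init) / (lam + D) by congr (_ / _); ring.
    by apply: zrow_ge_expR; rewrite ?lerDl.
  rewrite -(ler_pM2r (expR_gt0 (wid / (lam + D)))) mul1r; apply: (le_trans h).
  by rewrite -[leLHS]lnK// ler_expR we ler_norm.
Qed.

Let nh k := nrow (mu_hat k).
Let uh k i := (c i - nh k * yrow k i - (mu_hat k + lam * ln (nh k))) / lam.

(** Dividing by the mass [N] shifts the multiplier by [lam * ln N] and replaces [- z] by [- N * y]
    in the exponent: the row is exactly stationary for a quadratic term with coefficient [N]. *)
Lemma yrow_expR k i : yrow k i = q i * expR (uh k i).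
Proof.
rewrite {1}/yrow zrowE -mulrA; congr (_ * _).
have n0 : 0 < nh k := nrow_gt0 _.
rewrite -/(nh k) -[X in _ / X](lnK n0) -expRN -expRD; congr expR.
by rewrite /uh /yrow -/(nh k); field; rewrite lam_neq0 gt_eqF.
Qed.

Lemma yrow_distr k : distr (yrow k).
Proof.
split=> [i|]; first by rewrite divr_ge0 ?zrow_ge0// ltW ?nrow_gt0.
by rewrite -mulr_suml divff// gt_eqF ?nrow_gt0.
Qed.

Lemma yrow_abscont k : abscont (yrow k) q.
Proof. by move=> i qi; rewrite yrow_expR qi mul0r. Qed.

(** The [q]-average of the exponent is [mu_init] minus the multiplier, over [lam], up to terms in
    [y - q] and [N - 1]. It is at most 0 by [gibbs]. It is at least a multiple of [- l], because the
    average under [y] is a divergence, hence nonnegative, and the two averages differ by a sum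
    against [y - q]. So a row close to [q] had a good starting point. *)
Let mult_close k : nh k <= 2 -> 1 <= nh k ->
  `|mu_hat k + lam * ln (nh k) - mu_init| <=
  D * (\sum_i `|yrow k i - q i|) + (nh k - 1).
Proof.
have hD' := hD; have G0' := G_ge0.
move=> n2 n1; set l := \sum_i _; set N := nh k; set y := yrow k.
set m := mu_hat k + _; pose u := uh k.
have hy : distr y := yrow_distr k.
have yE : forall i, y i = q i * expR (u i) := yrow_expR k.
have l0 : 0 <= l by apply: sumr_ge0.
have uE i : lam * u i = c i - N * y i - m by rewrite /u /uh -/N -/y -/m; field.
have qu_le0 : \sum_i q i * u i <= 0.
  have qq : abscont q q by [].
  apply: le_trans (gibbs hq hq.1 qq _) _.
    by have := hy.2; rewrite (eq_bigr _ (fun i _ => yE i)).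
  rewrite /klr big1// => i _; have [->|qn] := eqVneq (q i) 0; first by rewrite mul0r.
  by rewrite divff// ln1 mulr0.
have yu_ge0 : 0 <= \sum_i y i * u i.
  by rewrite -(klr_expR yE) klr_ge0//; exact: yrow_abscont.
have split1 : lam * \sum_i q i * u i = mu_init - m - \sum_i q i * (N * y i - q i).
  rewrite mulr_sumr -[m]mul1r -hq.2 mulr_suml /mu_init -!sumrB.
  by apply: eq_bigr => i _; rewrite mulrCA uE; ring.
have dyu : lam * (\sum_i y i * u i - \sum_i q i * u i) =
           \sum_i (y i - q i) * (c i - N * y i).
  have -> : \sum_i (y i - q i) * (c i - N * y i) =
            \sum_i ((y i - q i) * (c i - N * y i) - (y i - q i) * m).
    by rewrite [RHS]sumrB -[X in _ = _ - X]mulr_suml sumrB hy.2 hq.2 subrr mul0r subr0.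
  rewrite -sumrB mulr_sumr; apply: eq_bigr => i _.
  by rewrite -mulrBl mulrCA uE; ring.
have dyu_le : \sum_i (y i - q i) * (c i - N * y i) <= (G + 2) * l.
  rewrite mulr_sumr; apply: ler_sum => i _.
  apply: le_trans (ler_norm _) _; rewrite normrM mulrC ler_wpM2r//.
  rewrite ler_norml; have /andP[? ?] := hc i.
  have := distr_le1 i hy; have := hy.1 i => ? ?.
  have : 0 <= N * y i <= 2 by apply/andP; split; rewrite -/N in n1 n2; nra.
  by lra.
have rest : `|\sum_i q i * (N * y i - q i)| <= l + (N - 1).
  have -> : \sum_i q i * (N * y i - q i) =
            \sum_i q i * (y i - q i) + \sum_i q i * ((N - 1) * y i).
    by rewrite -big_split/=; apply: eq_bigr => i _; ring.
  apply: (le_trans (ler_normD _ _)); apply: lerD.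
    apply: (le_trans (ler_norm_sum _ _ _)); apply: ler_sum => i _.
    by rewrite normrM ler_piMl// ger0_norm ?hq.1// distr_le1.
  rewrite ger0_norm; last first.
    apply: sumr_ge0 => i _; apply: mulr_ge0; first exact: hq.1.
    by apply: mulr_ge0; [rewrite subr_ge0 | exact: hy.1].
  rewrite [leRHS](_ : _ = \sum_i (N - 1) * y i); last by rewrite -mulr_sumr hy.2 mulr1.
  apply: ler_sum => i _.
  rewrite ler_piMl ?distr_le1//.
  by apply: mulr_ge0; [rewrite subr_ge0 | exact: hy.1].
have key : lam * \sum_i q i * u i >= - ((G + 2) * l).
  have : 0 <= lam * \sum_i y i * u i by rewrite mulr_ge0// ltW.
  by move: dyu dyu_le; rewrite mulrBr; lra.
have key2 : lam * \sum_i q i * u i <= 0 by rewrite mulr_ge0_le0// ltW.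
move: rest; rewrite !ler_norml => /andP[r1 r2].
have lD : (G + 3) * l <= D * l by rewrite ler_wpM2r//; lra.
by apply/andP; split; lra.
Qed.

Variables (e : R) (k : nat).
Hypotheses (e_gt0 : 0 < e) (eD : 2 * e * D <= 1) (elam : e <= lam)
  (hk : 2^-1 ^+ k <= e ^+ 6).

Let e8 : e <= 8^-1. Proof.
have := e_gt0; have := eD; have := hD; have := G_ge0 => G0 D0 eD' e0.
have : e * 4 <= e * D by rewrite ler_pM2l//; lra.
by lra.
Qed.

(** The halvings contribute [e ^+ 6]; the ratio [(lam + D) / lam] of initial width to slope costs at
    most [e ^- 2], which leaves [e ^+ 4]. *)
Let contraction :
  0 <= ln (nh k) <= 2 * e ^+ 4 * `|ln (nrow mu_init)|.
Proof.
have hD' := hD; have G0' := G_ge0; have el := elam; have e0 := e_gt0; have eD' := eD.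
have [h1 h2 h3] := bracketP k; rewrite -/(mu_hat k) -/(nh k) in h1 h3.
have n0 : 0 <= ln (nh k) by rewrite ln_ge0.
rewrite n0 /=.
have w0 : 0 <= 2^-1 ^+ k :> R by rewrite exprn_ge0.
have le12 : mu_hat k <= (bracket k).2.
  by rewrite -subr_ge0 h3; apply: mulr_ge0 => //; exact: mulr_ge0.
have := ln_nrow_le le12; rewrite h3 -/(nh k) => h4.
have l2 : ln (nrow (bracket k).2) <= 0 by rewrite ln_le0.
have L0 := normr_ge0 (ln (nrow mu_init)).
have h5 : ln (nh k) <= 2 * wid * 2^-1 ^+ k / lam by lra.
apply: (le_trans h5); rewrite /wid; set L := `|ln (nrow mu_init)| in L0 *.
have -> : 2 * ((lam + D) * L) * 2^-1 ^+ k / lam = 2 * ((1 + D / lam) * 2^-1 ^+ k) * L by field.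
rewrite ler_wpM2r// ler_wpM2l//.
have dl : D / lam <= D / e.
  by rewrite ler_wpM2l ?lef_pV2 ?posrE//; lra.
have de : 1 + D / e <= 1 / e ^+ 2.
  rewrite -[leLHS](mulfK (_ : e ^+ 2 != 0)) ?expf_neq0 ?gt_eqF// ler_wpM2r ?invr_ge0 ?sqr_ge0//.
  have -> : (1 + D / e) * e ^+ 2 = e ^+ 2 + e * D by field; rewrite gt_eqF.
  by have := e_gt0; have := e8; nra.
have h6 : 0 <= 1 + D / lam by rewrite addr_ge0// divr_ge0 ?(ltW lam_gt0)//; lra.
apply: (@le_trans _ _ (1 / e ^+ 2 * e ^+ 6)).
  by apply: ler_pM => //; lra.
by rewrite le_eqVlt; apply/orP; left; apply/eqP; field; rewrite gt_eqF.
Qed.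

(** A circular estimate that closes by smallness. [contraction] bounds [n = ln N] by [e ^+ 4] times
    the initial error [L], while [ln_nrow_lip] and [mult_close] bound [L] by [n] and the l1 distance
    [l] from the row to [q]. Absorbing [n] gives [e ^+ 2 * L <= l], hence [n <= 2 * e ^+ 2 * l], and
    [l1_le_klr] turns [l] into the divergence. *)
Lemma yrow_resid : [/\ 1 <= nh k, nh k <= 2 &
  (nh k - 1) ^+ 2 <= e ^+ 2 * klr (yrow k) q].
Proof.
have hD' := hD; have G0' := G_ge0; have el := elam; have eD' := eD.
have [h1 _ _] := bracketP k; rewrite -/(mu_hat k) -/(nh k) in h1.
have /andP[n0 n1] := contraction.
set L := `|ln (nrow mu_init)| in n1; set n := ln (nh k) in n0 n1.
have e0 := e_gt0; have e8' := e8.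
have L0 : 0 <= L := normr_ge0 _.
have le2 : L * (2 * e ^+ 2) <= 1.
  have LD : L <= D / e.
    apply: (le_trans ln_init_le).
    by rewrite ler_wpM2l ?lef_pV2 ?posrE//; lra.
  have h : L * e <= D by rewrite -ler_pdivlMr.
  have : L * e * (2 * e) <= D * (2 * e) by rewrite ler_wpM2r//; lra.
  have -> : L * (2 * e ^+ 2) = L * e * (2 * e) by ring.
  by lra.
have nsmall : n <= e ^+ 2.
  have -> : e ^+ 2 = e ^+ 2 * 1 by rewrite mulr1.
  apply: le_trans (ler_wpM2l (sqr_ge0 e) le2); apply: (le_trans n1).
  by rewrite le_eqVlt; apply/orP; left; apply/eqP; ring.
have ehalf : e ^+ 2 <= 64^-1.
  by have : 0 <= (8^-1 - e) * (8^-1 + e) by [apply: mulr_ge0; lra]; lra.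
have N1 : nh k - 1 <= 2 * n.
  have : expR n <= 1 + n + 2 * n ^+ 2 by apply: expR_quad_ub; lra.
  rewrite lnK ?posrE ?nrow_gt0//; nra.
have N2 : nh k <= 2 by lra.
split=> //.
set l := \sum_i `|yrow k i - q i|.
have l0 : 0 <= l by apply: sumr_ge0.
have lK : l ^+ 2 <= 4 * klr (yrow k) q.
  by apply: l1_le_klr => //; [exact: yrow_distr | exact: yrow_abscont].
have mc := mult_close N2 h1; rewrite -/l -/n in mc.
have muc : `|mu_init - mu_hat k| <= D * l + 2 * n + lam * n.
  rewrite distrC; have -> : mu_hat k - mu_init = (mu_hat k + lam * n - mu_init) + - (lam * n) by ring.
  apply: (le_trans (ler_normD _ _)); rewrite normrN (ger0_norm (_ : 0 <= lam * n)) ?mulr_ge0 ?(ltW lam_gt0)//.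
  by lra.
have LB : e * L <= e * n + D * l + 2 * n + e * n.
  have h := ln_nrow_lip mu_init (mu_hat k); rewrite -/(nh k) -/n in h.
  have h' : L <= n + `|mu_init - mu_hat k| / lam.
    have := lerB_dist (ln (nrow mu_init)) n; rewrite -/L (ger0_norm n0); lra.
  have h'' : `|mu_init - mu_hat k| / lam <= (D * l + 2 * n) / e + n.
    apply: (@le_trans _ _ ((D * l + 2 * n + lam * n) / lam)).
      by rewrite ler_wpM2r ?invr_ge0// ltW.
    have -> : (D * l + 2 * n + lam * n) / lam = (D * l + 2 * n) / lam + n by field.
    rewrite lerD2r ler_wpM2l ?lef_pV2 ?posrE// addr_ge0 ?mulr_ge0//; lra.
  have : L <= n + ((D * l + 2 * n) / e + n) by lra.
  rewrite -(ler_pM2l e0) => /le_trans; apply.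
  by rewrite le_eqVlt; apply/orP; left; apply/eqP; field; rewrite gt_eqF.
have LB2 : e * L <= 2 * (D * l).
  have : n * (2 + 2 * e) <= n * 3 by rewrite ler_wpM2l//; lra.
  have : n * 3 <= 6 * e ^+ 4 * L by lra.
  have -> : 6 * e ^+ 4 * L = (6 * e ^+ 3) * (e * L) by ring.
  have : (6 * e ^+ 3) * (e * L) <= 2^-1 * (e * L).
    rewrite ler_wpM2r ?mulr_ge0 ?(ltW e0)//.
    have -> : e ^+ 3 = e * e ^+ 2 by ring.
    by have := sqr_ge0 e; nra.
  by lra.
have LB3 : e ^+ 2 * L <= l.
  have : e * (e * L) <= e * (2 * (D * l)) by rewrite ler_wpM2l ?(ltW e0).
  have : (2 * e * D) * l <= 1 * l by rewrite ler_wpM2r.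
  by lra.
have nl : n <= 2 * e ^+ 2 * l.
  have : 2 * e ^+ 2 * (e ^+ 2 * L) <= 2 * e ^+ 2 * l by rewrite ler_wpM2l// mulr_ge0 ?sqr_ge0.
  by have -> : 2 * e ^+ 2 * (e ^+ 2 * L) = 2 * e ^+ 4 * L by [ring]; lra.
have Nl : (nh k - 1) ^+ 2 <= (4 * e ^+ 2 * l) ^+ 2.
  rewrite lerXn2r ?nnegrE ?subr_ge0 ?mulr_ge0 ?sqr_ge0//; lra.
apply: (le_trans Nl).
have -> : (4 * e ^+ 2 * l) ^+ 2 = 16 * e ^+ 2 * e ^+ 2 * l ^+ 2 by ring.
have K0 : 0 <= klr (yrow k) q.
  by apply: klr_ge0 => //; [exact: yrow_distr | exact: yrow_abscont].
apply: (@le_trans _ _ (16 * e ^+ 2 * e ^+ 2 * (4 * klr (yrow k) q))).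
  rewrite ler_wpM2l//; apply: mulr_ge0; last exact: sqr_ge0.
  by apply: mulr_ge0 => //; exact: sqr_ge0.
have -> : 16 * e ^+ 2 * e ^+ 2 * (4 * klr (yrow k) q) =
          (64 * e ^+ 2) * (e ^+ 2 * klr (yrow k) q) by ring.
rewrite -[leRHS]mul1r ler_wpM2r ?mulr_ge0 ?sqr_ge0//; lra.
Qed.

End Row.

(** * Duality for the l2 problem *)

Section RowGap.
Context {R : realType} {I : finType}.
Implicit Types q c y z : I -> R.

Definition frow c z : R := \sum_i (c i * z i - z i ^+ 2 / 2).

(** The form of a normalised row, with [m] the shifted multiplier of [yrow_expR]. Since
    [(N - 1) ^+ 2] is compared with the divergence of the row itself, its sum over the rows is at
    most [e ^+ 2] times the total divergence, whatever their number. *)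
Definition near_opt (e lam : R) q c y :=
  exists N m : R, [/\ 1 <= N <= 2, (N - 1) ^+ 2 <= e ^+ 2 * klr y q
    & forall i, y i = q i * expR ((c i - N * y i - m) / lam)].

(** [gibbs] treats the divergence without loss. The wrong coefficient [N] leaves the linear error
    [(N - 1) * y * (z - y)], which the strong concavity of the quadratic term absorbs at the price
    of [(N - 1) ^+ 2 * y ^+ 2 / 2]. *)
Lemma near_opt_gap e lam q c y z : 0 < lam -> distr q -> distr y ->
  near_opt e lam q c y -> distr z -> abscont z q ->
  frow c z - lam * klr z q <=
  frow c y - lam * klr y q + e ^+ 2 / 2 * klr y q.
Proof.
move=> l0 hq hy [N [m [N12 Ne yE]]] hz zq.
pose u i := (c i - N * y i - m) / lam.
have uE i : lam * u i = c i - N * y i - m by rewrite /u; field; rewrite gt_eqF.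
have qu : \sum_i q i * expR (u i) = 1.
  by rewrite -hy.2; apply: eq_bigr => i _; rewrite yE.
have zu : lam * \sum_i z i * u i <= lam * klr z q by rewrite ler_pM2l//; apply: gibbs => //; exact: hq.1.
have yu : lam * klr y q = lam * \sum_i y i * u i by rewrite (klr_expR (u := u)).
have e1 : lam * \sum_i z i * u i - lam * \sum_i y i * u i =
    \sum_i (z i - y i) * (c i - N * y i).
  rewrite -mulrBr -sumrB mulr_sumr.
  have -> : \sum_i (z i - y i) * (c i - N * y i) =
            \sum_i ((z i - y i) * (c i - N * y i) - (z i - y i) * m).
    by rewrite [RHS]sumrB -[X in _ = _ - X]mulr_suml sumrB hz.2 hy.2 subrr mul0r subr0.
  by apply: eq_bigr => i _; rewrite -mulrBl mulrCA uE; ring.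
have e2 : frow c z - frow c y - \sum_i (z i - y i) * (c i - N * y i) <=
    (N - 1) ^+ 2 / 2.
  rewrite [leRHS](_ : _ = \sum_i (N - 1) ^+ 2 / 2 * y i); last first.
    by rewrite -mulr_sumr hy.2 mulr1.
  rewrite /frow -!sumrB; apply: ler_sum => i _.
  have := hy.1 i; have := distr_le1 i hy => y1 y0.
  have h1 : 0 <= (N - 1) ^+ 2 * (y i * (1 - y i)).
    by rewrite mulr_ge0 ?sqr_ge0// mulr_ge0// subr_ge0.
  have h2 := sqr_ge0 ((z i - y i) - (N - 1) * y i).
  nra.
lra.
Qed.

(** Two exponents of one row differ by at most [D / lam], and their exponentials have [q]-average 1,
    so 0 lies between their extremes. *)
Lemma near_opt_exponent_le lam q c y G D (N m : R) : 0 < lam -> distr q -> distr y ->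
  1 <= N <= 2 -> (forall i, y i = q i * expR ((c i - N * y i - m) / lam)) ->
  (forall i, - G <= c i <= G + 1) -> 2 * G + 4 <= D ->
  forall i, `|(c i - N * y i - m) / lam| <= D / lam.
Proof.
move=> l0 hq hy N12 yE hc hD i.
pose u i := (c i - N * y i - m) / lam.
have ny j : 0 <= N * y j <= 2.
  have := hy.1 j; have := distr_le1 j hy => y1 y0; apply/andP; split; nra.
have osc j1 j2 : u j1 - u j2 <= D / lam.
  rewrite /u -mulrBl ler_wpM2r ?invr_ge0 ?ltW//.
  have /andP[? ?] := hc j1; have /andP[? ?] := hc j2.
  by have /andP[? ?] := ny j1; have /andP[? ?] := ny j2; lra.
have qu : \sum_i q i * expR (u i) = 1.
  by rewrite -hy.2; apply: eq_bigr => j _; rewrite yE.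
rewrite -/(u i) ler_norml; apply/andP; split; rewrite leNgt; apply/negP => h.
- suff : \sum_i q i * expR (u i) < 1 by rewrite qu ltxx.
  apply: (@le_lt_trans _ _ (\sum_j q j * expR (u i + D / lam))).
    apply: ler_sum => j _; rewrite ler_wpM2l ?hq.1// ler_expR.
    by have := osc j i; lra.
  by rewrite -mulr_suml hq.2 mul1r -expR0 ltr_expR; lra.
- suff : 1 < \sum_i q i * expR (u i) by rewrite qu ltxx.
  apply: (@lt_le_trans _ _ (\sum_j q j * expR (u i - D / lam))).
    by rewrite -mulr_suml hq.2 mul1r -expR0 ltr_expR; lra.
  apply: ler_sum => j _; rewrite ler_wpM2l ?hq.1// ler_expR.
  by have := osc i j; lra.
Qed.

(** Both endpoints are bounded below by [fenchel_young] at the log-ratio of the mixture, where it is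
    an equality for the mixture itself. *)
Lemma klr_convex q y z (t : R) : 0 <= t <= 1 -> (forall i, 0 <= q i) ->
  (forall i, 0 <= y i) -> (forall i, 0 <= z i) -> abscont y q -> abscont z q ->
  klr (fun i => (1 - t) * y i + t * z i) q <= (1 - t) * klr y q + t * klr z q.
Proof.
move=> /andP[t0 t1] q0 y0 z0 yq zq; rewrite /klr !mulr_sumr -big_split/=.
apply: ler_sum => i _; set x := _ + t * z i.
have s0 : 0 <= 1 - t by rewrite subr_ge0.
have x0 : 0 <= x by rewrite addr_ge0// mulr_ge0.
have [xz|xn] := eqVneq x 0.
  have : (1 - t) * y i = 0 /\ t * z i = 0.
    have h1 : 0 <= (1 - t) * y i by rewrite mulr_ge0.
    have h2 : 0 <= t * z i by rewrite mulr_ge0.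
    by rewrite /x in xz; split; lra.
  by rewrite xz mul0r !mulrA => -[-> ->]; rewrite !mul0r addr0.
have qn : q i != 0.
  by apply: contra_neq xn => qi; rewrite /x (yq _ qi) (zq _ qi) !mulr0 addr0.
have qp : 0 < q i by rewrite lt_def qn q0.
have xp : 0 < x by rewrite lt_def xn.
have xq : q i * expR (ln (x / q i)) = x.
  by rewrite lnK ?posrE ?divr_gt0// mulrCA divff// mulr1.
have := fenchel_young (ln (x / q i)) (q0 i) (y0 i) (yq i).
have := fenchel_young (ln (x / q i)) (q0 i) (z0 i) (zq i).
rewrite xq; set l := ln (x / q i) => hz hy.
have hz' := ler_wpM2l t0 hz; have hy' := ler_wpM2l s0 hy.
have -> : x * l = (1 - t) * (y i * l + y i - x) + t * (z i * l + z i - x).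
  have -> : (1 - t) * (y i * l + y i - x) + t * (z i * l + z i - x) =
    ((1 - t) * y i + t * z i) * (l + 1) - x by ring.
  by rewrite -/x; ring.
by lra.
Qed.

Lemma frow_concave c y z (t : R) : 0 <= t <= 1 ->
  (1 - t) * frow c y + t * frow c z <=
  frow c (fun i => (1 - t) * y i + t * z i).
Proof.
move=> /andP[t0 t1]; rewrite /frow !mulr_sumr -big_split/=; apply: ler_sum => i _.
have : 0 <= t * (1 - t) * (y i - z i) ^+ 2.
  by apply: mulr_ge0; [apply: mulr_ge0; rewrite ?subr_ge0 | exact: sqr_ge0].
lra.
Qed.

End RowGap.

Section Outer.
Context {R : realType} {T I : finType}.
Variables (y0 c : T -> I -> R) (alpha e : R).
Hypothesis hy0 : forall a, distr (y0 a).

Definition ftot (z : T -> I -> R) : R := \sum_a frow (c a) (z a).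
Definition ktot (z : T -> I -> R) : R := \sum_a klr (z a) (y0 a).
Definition feasible (z : T -> I -> R) :=
  [/\ forall a, distr (z a), forall a, abscont (z a) (y0 a) & ktot z <= alpha].

Definition solves (lam : R) (y : T -> I -> R) :=
  [/\ forall a, distr (y a), forall a, abscont (y a) (y0 a)
    & forall a, near_opt e lam (y0 a) (c a) (y a)].

Lemma solves_gap lam y z : 0 < lam -> solves lam y -> feasible z ->
  ftot z <= ftot y + lam * (alpha - ktot y) + e ^+ 2 / 2 * ktot y.
Proof.
move=> l0 [hy yq ny] [hz zq Kz].
have : ftot z - lam * ktot z <= ftot y - lam * ktot y + e ^+ 2 / 2 * ktot y.
  rewrite /ftot /ktot !mulr_sumr -!sumrB -big_split/=; apply: ler_sum => a _.
  exact: near_opt_gap.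
have := ler_wpM2l (ltW l0) Kz; lra.
Qed.

Lemma ktot_ge0 y : (forall a, distr (y a)) -> (forall a, abscont (y a) (y0 a)) ->
  0 <= ktot y.
Proof. by move=> hy yq; apply: sumr_ge0 => a _; exact: klr_ge0. Qed.

Definition mix (t : R) (y z : T -> I -> R) a i : R := (1 - t) * y a i + t * z a i.

(** The slacks [alpha - ktot y] and [alpha - ktot z] have opposite signs, and [t] makes their
    weighted sum vanish. In the weighted sum of the two duality gaps only
    [(1 - t) * (alpha - ktot y) * (hi - lo)] survives, besides the row errors. *)
Lemma mix_gap lo hi y z t x : 0 < lo -> lo <= hi -> solves hi y -> solves lo z ->
  ktot y <= alpha < ktot z -> t = (alpha - ktot y) / (ktot z - ktot y) ->
  feasible x ->
  feasible (mix t y z) /\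
  ftot x <= ftot (mix t y z) + alpha * (hi - lo) + e ^+ 2 / 2 * alpha.
Proof.
move=> lo0 lohi sy sz /andP[Fy Fz] tE hx.
have hi0 : 0 < hi by exact: lt_le_trans lohi.
have gy := solves_gap hi0 sy hx; have gz := solves_gap lo0 sz hx.
have [hy yq _] := sy; have [hz zq _] := sz.
have K0 := ktot_ge0 hy yq.
have d0 : 0 < ktot z - ktot y by lra.
have t01 : 0 <= t <= 1.
  rewrite tE; apply/andP; split; first by rewrite divr_ge0// ?(ltW d0)// subr_ge0.
  by rewrite ler_pdivrMr//; lra.
have tK : (1 - t) * ktot y + t * ktot z = alpha.
  by rewrite tE; field; rewrite gt_eqF.
have /andP[t0 t1] := t01; have s0 : 0 <= 1 - t by rewrite subr_ge0.
have Kmix : ktot (mix t y z) <= alpha.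
  rewrite -tK /ktot !mulr_sumr -big_split/=; apply: ler_sum => a _.
  apply: klr_convex => //; [exact: (hy0 a).1 | exact: (hy a).1 | exact: (hz a).1].
split.
  split=> // a.
    split=> [i|]; first by rewrite addr_ge0// mulr_ge0// ?(hy a).1 ?(hz a).1.
    by rewrite big_split/= -!mulr_sumr (hy a).2 (hz a).2; ring.
  by move=> i qi; rewrite /mix (yq _ _ qi) (zq _ _ qi) !mulr0 addr0.
have fm : (1 - t) * ftot y + t * ftot z <= ftot (mix t y z).
  by rewrite /ftot !mulr_sumr -big_split/=; apply: ler_sum => a _; exact: frow_concave.
have gy' := ler_wpM2l s0 gy; have gz' := ler_wpM2l t0 gz.
have m0 : (1 - t) * (alpha - ktot y) = t * (ktot z - alpha) by lra.
have m1 : (1 - t) * (alpha - ktot y) <= alpha.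
  have : (1 - t) * (alpha - ktot y) <= 1 * (alpha - ktot y) by rewrite ler_wpM2r//; lra.
  lra.
have m2 := ler_wpM2r (_ : 0 <= hi - lo) m1; have {}m2 := m2 _.
have {}m2 : (1 - t) * (alpha - ktot y) * (hi - lo) <= alpha * (hi - lo).
  by apply: m2; rewrite subr_ge0.
have m3 : e ^+ 2 / 2 * ((1 - t) * ktot y + t * ktot z) = e ^+ 2 / 2 * alpha by rewrite tK.
have m4 : (1 - t) * (hi * (alpha - ktot y)) = (1 - t) * (alpha - ktot y) * hi by ring.
have m5 : t * (lo * (alpha - ktot z)) = - ((1 - t) * (alpha - ktot y) * lo) by rewrite m0; ring.
lra.
Qed.

End Outer.

(** * Location of the optimal l2 multiplier *)

Section Bracket.
Context {R : realType} {T I : finType}.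
Variables (y0 g y' : T -> I -> R) (alpha e G D : R).
Hypotheses (hy0 : forall a, distr (y0 a)) (alpha_gt0 : 0 < alpha).

(** The L2 norm weighted by [y0], over all rows at once. Composed with [cen] it gives the root of
    the sum of the row variances and ignores the unknown row multipliers. *)
Definition nm (x : T -> I -> R) : R :=
  wnorm (fun p : T * I => y0 p.1 p.2) (fun p => x p.1 p.2).

Definition mean (x : T -> I -> R) (a : T) : R := \sum_i y0 a i * x a i.

Definition cen (x : T -> I -> R) (a : T) (i : I) : R := x a i - mean x a.

Let w0 (p : T * I) : 0 <= y0 p.1 p.2. Proof. exact: (hy0 _).1. Qed.

Lemma sqr_nm x : nm x ^+ 2 = \sum_a \sum_i y0 a i * x a i ^+ 2.
Proof. by rewrite sqr_wnorm// pair_bigA. Qed.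

Lemma nm_ge0 x : 0 <= nm x. Proof. exact: wnorm_ge0. Qed.

Lemma nmD x z : nm (fun a i => x a i + z a i) <= nm x + nm z.
Proof. exact: wnorm_triangle. Qed.

Lemma nm_eq x z : (forall a i, x a i = z a i) -> nm x = nm z.
Proof.
by move=> xz; congr Num.sqrt; apply: eq_bigr => p _; rewrite xz.
Qed.

Lemma nmN x : nm (fun a i => - x a i) = nm x.
Proof. by congr Num.sqrt; apply: eq_bigr => p _; rewrite sqrrN. Qed.

Lemma nmZ l x : 0 <= l -> nm (fun a i => l * x a i) = l * nm x.
Proof.
move=> l0; apply/eqP; rewrite -(eqrXn2 (n := 2))// ?mulr_ge0 ?nm_ge0//.
rewrite exprMn !sqr_nm mulr_sumr; apply/eqP; apply: eq_bigr => a _.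
by rewrite mulr_sumr; apply: eq_bigr => i _; rewrite exprMn; ring.
Qed.

Lemma row_cen x a : \sum_i y0 a i * cen x a i ^+ 2 =
  \sum_i y0 a i * x a i ^+ 2 - mean x a ^+ 2.
Proof.
have -> : \sum_i y0 a i * cen x a i ^+ 2 =
   \sum_i (y0 a i * x a i ^+ 2 - 2 * mean x a * (y0 a i * x a i) + y0 a i * mean x a ^+ 2).
  by apply: eq_bigr => i _; rewrite /cen; ring.
by rewrite big_split/= sumrB -mulr_sumr -mulr_suml (hy0 a).2 -/(mean x a); ring.
Qed.

Lemma sqr_nm_cen x : nm (cen x) ^+ 2 = nm x ^+ 2 - \sum_a mean x a ^+ 2.
Proof. by rewrite !sqr_nm -sumrB; apply: eq_bigr => a _; exact: row_cen. Qed.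

Lemma nm_cen_le x : nm (cen x) <= nm x.
Proof.
rewrite -ler_sqr ?nnegrE ?nm_ge0// sqr_nm_cen gerBl sumr_ge0// => a _.
exact: sqr_ge0.
Qed.

Lemma nm_le l x : 0 <= l -> \sum_a \sum_i x a i ^+ 2 <= l ^+ 2 -> nm x <= l.
Proof.
move=> l0 h; rewrite -ler_sqr ?nnegrE ?nm_ge0// sqr_nm; apply: le_trans h.
apply: ler_sum => a _; apply: ler_sum => i _.
by rewrite ler_piMl ?sqr_ge0// distr_le1.
Qed.

Lemma nm_sub_le z : (forall a, distr (z a)) -> (forall a, abscont (z a) (y0 a)) ->
  nm (fun a i => z a i - y0 a i) <= 3 / 2 * Num.sqrt (2 * ktot y0 z).
Proof.
move=> hz zq; have K0 := ktot_ge0 hy0 hz zq.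
apply: nm_le; first by rewrite mulr_ge0 ?sqrtr_ge0.
rewrite exprMn sqr_sqrtr ?mulr_ge0//.
(* The factor 3/2 is a rational upper bound for the square root of 2. *)
apply: (@le_trans _ _ (4 * ktot y0 z)); last by lra.
by rewrite mulr_sumr; apply: ler_sum => a _; exact: l2_le_klr.
Qed.

Let c a i := g a i + y' a i.

Hypotheses (G_ge0 : 0 <= G) (hg : forall a i, `|g a i| <= G)
  (hD : 2 * G + 4 <= D) (e_ge0 : 0 <= e) (e_le : e <= 2^-1)
  (hy' : feasible y0 alpha y').

Let hc a i : - G <= c a i <= G + 1.
Proof.
have [hy _ _] := hy'; have := hg a i; rewrite ler_norml.
by have := (hy a).1 i; have := distr_le1 i (hy a); rewrite /c; lra.
Qed.

Let a_ := Num.sqrt (2 * alpha).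
(** To second order in [1 / lam], the tilt of [y0] by [g / lam] has divergence
    [nm (cen g) ^+ 2 / (2 * lam ^+ 2)]; at [lam0] this equals [alpha]. *)
Definition lam0 : R := Num.sqrt (nm (cen g) ^+ 2 / (2 * alpha)).

Let a_gt0 : 0 < a_. Proof. by rewrite sqrtr_gt0 mulr_gt0. Qed.

Let lam0E : a_ * lam0 = nm (cen g).
Proof.
rewrite /lam0 sqrtrM ?sqr_ge0// sqrtr_sqr ger0_norm ?nm_ge0//.
rewrite mulrCA sqrtrV ?mulr_ge0 ?ltW// divff ?mulr1//.
by rewrite gt_eqF.
Qed.

(* With [tau = D / lam], the exponent [u] of the computed point has sup norm at
   most [tau], so [2 K = |u|^2 (1 + O(tau))] and [|u|] is [|cen u|] up to
   [1 + O(tau)], while [lam cen u = cen g] up to [O(sqrt alpha + sqrt K)]. *)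
Let estimates lam y : solves y0 c e lam y -> 8 * D <= lam ->
  let tau := D / lam in let phi := Num.sqrt (2 * ktot y0 y) in
  exists nu : R, [/\ 0 <= nu, phi <= (1 + 2 * tau) * nu,
    (1 - tau) * nu <= phi,
    lam * nu <= a_ * lam0 + 3 / 2 * a_ + 2 * phi &
    a_ * lam0 - 3 / 2 * a_ - 2 * phi <= lam * nu].
Proof.
move=> [hy yq ny] lD tau phi.
have G0' := G_ge0; have hD' := hD; have e0' := e_ge0; have el' := e_le.
have D0 : 0 < D by lra.
have l0 : 0 < lam by lra.
have ln : lam != 0 by rewrite gt_eqF.
have tau0 : 0 <= tau by rewrite divr_ge0 ?ltW.
have tau8 : tau <= 8^-1 by rewrite /tau ler_pdivrMr//; lra.
have [N /choice[m hN]] := choice ny.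
pose u a i := (c a i - N a * y a i - m a) / lam.
have yE a i : y a i = y0 a i * expR (u a i) by have [_ _ ->] := hN a.
have ut a i : `|u a i| <= tau.
  have [N12 _ yE'] := hN a.
  exact: (near_opt_exponent_le l0 (hy0 a) (hy a) N12 yE' (hc a) hD).
have K0 := ktot_ge0 hy0 hy yq.
have phi2 : phi ^+ 2 = 2 * ktot y0 y by rewrite sqr_sqrtr ?mulr_ge0.
have phi0 : 0 <= phi by exact: sqrtr_ge0.
have KE : ktot y0 y = \sum_a \sum_i y0 a i * (u a i * expR (u a i) - expR (u a i) + 1).
  by apply: eq_bigr => a _; exact: klr_kl_fun.
have lb : (1 - tau) * nm u ^+ 2 <= phi ^+ 2.
  rewrite phi2 KE sqr_nm !mulr_sumr; apply: ler_sum => a _.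
  rewrite !mulr_sumr; apply: ler_sum => i _.
  have /kl_fun_bounds/andP[h _] : `|u a i| <= 8^-1 by exact: le_trans (ut a i) _.
  have h2 : (1 - tau) * (u a i ^+ 2 / 2) <= (1 - `|u a i|) * (u a i ^+ 2 / 2).
    by rewrite ler_wpM2r ?divr_ge0 ?sqr_ge0// lerD2l lerN2.
  have := ler_wpM2l (w0 (a, i)) (le_trans h2 h); rewrite /=; lra.
have ub : phi ^+ 2 <= (1 + 2 * tau) * nm u ^+ 2.
  rewrite phi2 KE sqr_nm !mulr_sumr; apply: ler_sum => a _.
  rewrite !mulr_sumr; apply: ler_sum => i _.
  have /kl_fun_bounds/andP[_ h] : `|u a i| <= 8^-1 by exact: le_trans (ut a i) _.
  have h2 : (1 + 2 * `|u a i|) * (u a i ^+ 2 / 2) <= (1 + 2 * tau) * (u a i ^+ 2 / 2).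
    by rewrite ler_wpM2r ?divr_ge0 ?sqr_ge0// lerD2l ler_pM2l.
  have := ler_wpM2l (w0 (a, i)) (le_trans h h2); rewrite /=; lra.
(* Since [expR u] has [y0]-average 1, the mean of [u] is only of second order in [u], and centring
   changes the squared norm by a factor [1 - O(tau ^+ 2)]. *)
have mean_u a : mean u a ^+ 2 <= 4 * tau ^+ 2 * \sum_i y0 a i * u a i ^+ 2.
  set s := \sum_i y0 a i * u a i ^+ 2.
  have s0 : 0 <= s by apply: sumr_ge0 => i _; rewrite mulr_ge0 ?sqr_ge0// (hy0 a).1.
  have m1 : mean u a <= 0.
    rewrite -(subrr 1) -{1}(hy a).2 -(hy0 a).2 -sumrB; apply: ler_sum => i _.
    rewrite yE; have := expR_ge1Dx (u a i); have := (hy0 a).1 i; nra.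
  have m2 : - (2 * s) <= mean u a.
    have : mean u a + 2 * s >= \sum_i (y a i - y0 a i).
      rewrite /mean /s mulr_sumr -big_split/=; apply: ler_sum => i _.
      have h : expR (u a i) <= 1 + u a i + 2 * u a i ^+ 2.
        apply: expR_quad_ub; have := ler_norm (u a i); have := ut a i; lra.
      have := ler_wpM2l (w0 (a, i)) h; rewrite yE /=; lra.
    by rewrite sumrB (hy a).2 (hy0 a).2; lra.
  have s1 : s <= tau ^+ 2.
    rewrite -[leRHS]mul1r -(hy0 a).2 mulr_suml; apply: ler_sum => i _.
    rewrite ler_wpM2l ?(hy0 a).1// -[leLHS]real_normK ?num_real//.
    by rewrite lerXn2r ?nnegrE.
  have h1 : mean u a ^+ 2 <= (2 * s) ^+ 2.
    by rewrite -[leLHS]sqrrN lerXn2r ?nnegrE//; lra.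
  apply: (le_trans h1); have := ler_wpM2r s0 s1; lra.
have cenu : (1 - 4 * tau ^+ 2) * nm u ^+ 2 <= nm (cen u) ^+ 2.
  have : \sum_a mean u a ^+ 2 <= 4 * tau ^+ 2 * nm u ^+ 2.
    by rewrite [in leRHS]sqr_nm mulr_sumr; apply: ler_sum.
  by rewrite sqr_nm_cen; lra.
have nu0 := nm_ge0 (cen u); have nuu := nm_cen_le u; have nmu0 := nm_ge0 u.
have eK : e ^+ 2 * ktot y0 y <= 2^-1 ^+ 2 * (2 * ktot y0 y).
  have e2 : e ^+ 2 <= 2^-1 by have := e_ge0; nra.
  by have := ler_wpM2r K0 e2; lra.
exists (nm (cen u)); split=> //.
- rewrite -ler_sqr ?nnegrE ?mulr_ge0//; last by lra.
  apply: (le_trans ub); rewrite exprMn.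
  apply: (@le_trans _ _ ((1 + 2 * tau) ^+ 2 * ((1 - 4 * tau ^+ 2) * nm u ^+ 2))).
    rewrite [leRHS]mulrA ler_wpM2r ?sqr_ge0//.
    have -> : (1 + 2 * tau) ^+ 2 * (1 - 4 * tau ^+ 2) =
      (1 + 2 * tau) * ((1 + 2 * tau) ^+ 2 * (1 - 2 * tau)) by ring.
    rewrite ler_peMr//; first by lra.
    have : 0 <= tau * (8^-1 - tau) by rewrite mulr_ge0//; lra.
    have : tau ^+ 3 = tau ^+ 2 * tau by ring.
    have := sqr_ge0 tau; nra.
  by rewrite ler_wpM2l ?sqr_ge0.
- rewrite -ler_sqr ?nnegrE ?mulr_ge0//; last by lra.
  apply: le_trans lb; rewrite exprMn.
  have h1 : nm (cen u) ^+ 2 <= nm u ^+ 2 by rewrite lerXn2r ?nnegrE.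
  have h2 : (1 - tau) ^+ 2 <= 1 - tau by nra.
  by apply: ler_pM => //; rewrite ?sqr_ge0.
all: have [hyp yq' Kp] := hy'.
all: have d1 : nm (cen (fun a i => y' a i - y0 a i)) <= 3 / 2 * a_;
  [apply: (le_trans (nm_cen_le _)); apply: (le_trans (nm_sub_le hyp yq'));
   rewrite ler_wpM2l// ler_wsqrtr// ler_pM2l// | ].
all: have d3 : nm (fun a i => (N a - 1) * y a i) <= 2^-1 * phi;
  [ apply: nm_le; [by rewrite mulr_ge0 | ];
    rewrite exprMn phi2; apply: (@le_trans _ _ (e ^+ 2 * ktot y0 y));
    [ rewrite mulr_sumr; apply: ler_sum => a _; have [_ Ne _] := hN a; apply: le_trans Ne;
      rewrite [leRHS](_ : _ = \sum_i (N a - 1) ^+ 2 * y a i); [ | by rewrite -mulr_sumr (hy a).2 mulr1];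
      apply: ler_sum => i _; rewrite exprMn ler_wpM2l ?sqr_ge0// expr2 ler_piMl ?(hy a).1// distr_le1//
    | exact: eK ] | ].
all: have d2 : nm (cen (fun a i => - (N a * y a i - y0 a i))) <= 2 * phi;
  [ apply: (le_trans (nm_cen_le _)); rewrite nmN;
    rewrite (@nm_eq _ (fun a i => (N a - 1) * y a i + (y a i - y0 a i)));
    [ apply: (le_trans (nmD _ _)); have := nm_sub_le hy yq; rewrite -/phi; lra
    | by move=> a i; ring ] | ].
(* Centring removes [m a]. The two perturbations of [cen g] are bounded by [d1], because [y'] is
   feasible, and by [d2], in terms of the divergence of [y]. *)
all: have cE a i : lam * cen u a i = cen g a i +
   (cen (fun a i => y' a i - y0 a i) a i + cen (fun a i => - (N a * y a i - y0 a i)) a i);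
  [ have uE b j : lam * u b j = g b j + (y' b j - y0 b j) + - (N b * y b j - y0 b j) - m b;
    [ by rewrite /u /c; field | ];
    rewrite /cen mulrBr uE;
    have -> : lam * mean u a = mean g a + mean (fun a i => y' a i - y0 a i) a
       + mean (fun a i => - (N a * y a i - y0 a i)) a - m a;
    [ rewrite /mean mulr_sumr -[m a]mul1r -(hy0 a).2 mulr_suml -!big_split/= -sumrB;
      apply: eq_bigr => j _; rewrite mulrCA uE; ring | ]; ring | ].
- rewrite -nmZ ?(ltW l0)// (nm_eq cE) lam0E.
  apply: (le_trans (nmD _ _)); have := nmD (cen (fun a i => y' a i - y0 a i))
    (cen (fun a i => - (N a * y a i - y0 a i))); lra.
- rewrite -nmZ ?(ltW l0)// lam0E.
  have := nmD (fun a i => lam * cen u a i)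
     (fun a i => - (cen (fun a i => y' a i - y0 a i) a i + cen (fun a i => - (N a * y a i - y0 a i)) a i)).
  rewrite (@nm_eq _ (cen g)); last by move=> a i; rewrite cE; ring.
  rewrite nmN; have := nmD (cen (fun a i => y' a i - y0 a i))
    (cen (fun a i => - (N a * y a i - y0 a i))); lra.
Qed.

(** The relative error [D / lam] in [estimates], applied to [a_ * lam0] with [lam0 <= lam], costs
    only a multiple of [a_ * D], and the other errors are multiples of [a_] and [phi]. The margin
    [8 * D] pays for all of them; [ktot_below] is symmetric. *)
Lemma ktot_above lam y : solves y0 c e lam y -> lam0 + 8 * D <= lam -> ktot y0 y <= alpha.
Proof.
move=> sy hl; have hD' := hD; have G0' := G_ge0.
have l00 : 0 <= lam0 by exact: sqrtr_ge0.
have [|nu [nu0 h1 _ h3 _]] := estimates sy; first by lra.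
have l0 : 0 < lam by lra.
have a0 := a_gt0.
set phi := Num.sqrt _ in h1 h3; set tau := D / lam in h1.
have phi0 : 0 <= phi by exact: sqrtr_ge0.
have tl : tau * lam = D by rewrite /tau; field; rewrite gt_eqF.
have tau0 : 0 <= tau by rewrite divr_ge0 ?ltW//; lra.
have tau8 : tau <= 8^-1 by rewrite /tau ler_pdivrMr//; lra.
have h4 : lam * phi <= (1 + 2 * tau) * (a_ * lam0 + 3 / 2 * a_ + 2 * phi).
  have := ler_wpM2l (ltW l0) h1.
  have : 0 <= 1 + 2 * tau by lra.
  by move=> /ler_wpM2l/(_ _ _ h3); lra.
have h5 : tau * lam0 <= D by rewrite -tl ler_wpM2l//; lra.
have h6 : a_ * (tau * lam0) <= a_ * D by rewrite ler_wpM2l// ltW.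
have h7 : tau * phi <= 8^-1 * phi by rewrite ler_wpM2r.
have h8 : tau * a_ <= 8^-1 * a_ by rewrite ler_wpM2r// ltW.
have h9 : phi * (lam - 4) <= a_ * (lam - 4).
  have : a_ * (lam0 + 8 * D) <= a_ * lam by rewrite ler_wpM2l// ltW.
  have : a_ * 6 <= a_ * (6 * D - 6) by rewrite ler_wpM2l ?(ltW a0)//; lra.
  by lra.
have : phi <= a_ by rewrite -(ler_pM2r (_ : 0 < lam - 4))//; lra.
by rewrite /phi /a_ ler_sqrt ?ler_pM2l// mulr_ge0// ltW.
Qed.

Lemma ktot_below lam y : solves y0 c e lam y -> lam = lam0 - 8 * D ->
  16 * D <= lam0 -> alpha < ktot y0 y.
Proof.
move=> sy hl hl0; have hD' := hD; have G0' := G_ge0.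
have [|nu [nu0 _ h2 _ h3]] := estimates sy; first by lra.
have l0 : 0 < lam by lra.
have a0 := a_gt0.
set phi := Num.sqrt _ in h2 h3; set tau := D / lam in h2.
have phi0 : 0 <= phi by exact: sqrtr_ge0.
have tl : tau * lam = D by rewrite /tau; field; rewrite gt_eqF.
have tau0 : 0 <= tau by rewrite divr_ge0 ?ltW//; lra.
have tau8 : tau <= 8^-1 by rewrite /tau ler_pdivrMr//; lra.
have h4 : (1 - tau) * (a_ * lam0 - 3 / 2 * a_ - 2 * phi) <= lam * phi.
  have := ler_wpM2l (ltW l0) h2.
  have : 0 <= 1 - tau by lra.
  by move=> /ler_wpM2l/(_ _ _ h3); lra.
have h5 : tau * lam0 <= 2 * D.
  have h : lam0 <= 2 * lam by lra.
  by rewrite -tl; have := ler_wpM2l tau0 h; lra.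
have h6 : a_ * (tau * lam0) <= a_ * (2 * D) by rewrite ler_wpM2l// ltW.
have h7 : 0 <= tau * phi by rewrite mulr_ge0.
have h8 : 0 <= tau * a_ by rewrite mulr_ge0// ltW.
have h9 : a_ * (lam + 2) < phi * (lam + 2).
  have : a_ * lam = a_ * (lam0 - 8 * D) by rewrite hl.
  have : a_ * 24 <= a_ * (6 * D) by rewrite ler_wpM2l ?(ltW a0)//; lra.
  by lra.
have : a_ < phi by rewrite -(ltr_pM2r (_ : 0 < lam + 2))//; lra.
move=> h; rewrite ltNge; apply/negP => h'.
by move: h; apply/negP; rewrite -leNgt ler_wsqrtr// ler_pM2l.
Qed.

End Bracket.

(** * Exponential tilts for the l1 problem *)

Section Tilt.
Context {R : realType} {I : finType}.
Implicit Types p h : I -> R.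

Lemma tilt_const_le p h (H d k : R) : distr p -> (forall i, `|h i| <= H) ->
  0 <= d <= 1 -> \sum_i p i * expR (d * h i - k) = 1 -> `|k| <= H.
Proof.
move=> hp hH /andP[d0 d1] s1.
have dh i : `|d * h i| <= H.
  by rewrite normrM ger0_norm//; apply: le_trans (hH i); rewrite ler_piMl.
rewrite ler_norml; apply/andP; split; rewrite leNgt; apply/negP => hk.
- suff : 1 < \sum_i p i * expR (d * h i - k) by rewrite s1 ltxx.
  apply: (@lt_le_trans _ _ (\sum_j p j * expR (- H - k))).
    by rewrite -mulr_suml hp.2 mul1r -expR0 ltr_expR; lra.
  apply: ler_sum => j _; rewrite ler_wpM2l ?hp.1// ler_expR.
  by have := dh j; rewrite ler_norml; lra.
- suff : \sum_i p i * expR (d * h i - k) < 1 by rewrite s1 ltxx.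
  apply: (@le_lt_trans _ _ (\sum_j p j * expR (H - k))).
    apply: ler_sum => j _; rewrite ler_wpM2l ?hp.1// ler_expR.
    by have := dh j; rewrite ler_norml; lra.
  by rewrite -mulr_suml hp.2 mul1r -expR0 ltr_expR; lra.
Qed.

Lemma var_le p h (k : R) : distr p ->
  \sum_i p i * (h i - \sum_j p j * h j) ^+ 2 <= \sum_i p i * (h i + k) ^+ 2.
Proof.
move=> hp; set m := \sum_j p j * h j.
have -> : \sum_i p i * (h i + k) ^+ 2 = \sum_i p i * (h i - m) ^+ 2 + (m + k) ^+ 2.
  have mm : \sum_i p i * (h i - m) = 0.
    under eq_bigr do rewrite mulrBr.
    by rewrite sumrB -mulr_suml hp.2 mul1r -/m subrr.
  have -> : \sum_i p i * (h i + k) ^+ 2 = \sum_i (p i * (h i - m) ^+ 2 +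
      (2 * (m + k) * (p i * (h i - m)) + (m + k) ^+ 2 * p i)).
    by apply: eq_bigr => i _; ring.
  by rewrite !big_split/= -!mulr_sumr mm hp.2; ring.
by rewrite lerDl sqr_ge0.
Qed.

(** A finite-step form of the fact that the derivative of the mean of [h] along an exponential tilt
    is a variance. Both [h] and the exponential may be centred at the mean [m], which leaves
    products of increments for [expR_sub_mul_le]. *)
Lemma tilt_mean_le p h (H d k : R) (p2 : I -> R) : distr p -> distr p2 ->
  (forall i, `|h i| <= H) -> 0 <= d <= 1 ->
  (forall i, p2 i = p i * expR (d * h i - k)) ->
  \sum_i (p2 i - p i) * h i <=
  d * expR (2 * H) * \sum_i p i * (h i - \sum_j p j * h j) ^+ 2.
Proof.
move=> hp hp2 hH d01 p2E; set m := \sum_j p j * h j.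
have s1 : \sum_i p i * expR (d * h i - k) = 1.
  by rewrite -hp2.2; apply: eq_bigr => i _; rewrite p2E.
have kH := tilt_const_le hp hH d01 s1.
have /andP[d0 d1] := d01.
have [i0 _] : exists i : I, True.
  apply: contrapT => ni; have := hp.2; rewrite big1 => [/esym/eqP|i]; first by rewrite oner_eq0.
  by exfalso; apply: ni; exists i.
have H0 : 0 <= H by apply: le_trans (hH i0).
have mH : `|m| <= H.
  apply: (le_trans (ler_norm_sum _ _ _)); rewrite -[leRHS]mul1r -hp.2 mulr_suml.
  by apply: ler_sum => i _; rewrite normrM ger0_norm ?hp.1// ler_wpM2l ?hp.1.
have bd x : `|x| <= H -> d * x - k <= 2 * H.
  move=> xH; have := kH; rewrite ler_norml => /andP[? ?].
  have : `|d * x| <= H by rewrite normrM ger0_norm//; apply: le_trans xH; rewrite ler_piMl.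
  by rewrite ler_norml; lra.
have mm : \sum_i p i * (h i - m) = 0.
  under eq_bigr do rewrite mulrBr.
  by rewrite sumrB -mulr_suml hp.2 mul1r -/m subrr.
have -> : \sum_i (p2 i - p i) * h i =
   \sum_i p i * ((expR (d * h i - k) - expR (d * m - k)) * (h i - m)).
  have -> : \sum_i (p2 i - p i) * h i =
     \sum_i ((p2 i - p i) * h i - (p2 i - p i) * m).
    by rewrite [RHS]sumrB -[X in _ = _ - X]mulr_suml sumrB hp.2 hp2.2 subrr mul0r subr0.
  have -> : \sum_i p i * ((expR (d * h i - k) - expR (d * m - k)) * (h i - m)) =
    \sum_i (p i * ((expR (d * h i - k) - expR (d * m - k)) * (h i - m)) +
            (expR (d * m - k) - 1) * (p i * (h i - m))).
    by rewrite [RHS]big_split/= -[X in _ = _ + X]mulr_sumr mm mulr0 addr0.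
  by apply: eq_bigr => i _; rewrite p2E; ring.
rewrite mulr_sumr; apply: ler_sum => i _.
rewrite [leRHS]mulrCA ler_wpM2l ?hp.1//.
have [dz|dn] := eqVneq d 0; first by rewrite dz !mul0r !sub0r subrr mul0r.
have dp : 0 < d by rewrite lt_def dn.
have := expR_sub_mul_le (bd _ (hH i)) (bd _ mH).
have -> : d * h i - k - (d * m - k) = d * (h i - m) by ring.
move=> h1.
have : d * ((expR (d * h i - k) - expR (d * m - k)) * (h i - m)) <=
       d * (d * expR (2 * H) * (h i - m) ^+ 2).
  by lra.
by rewrite ler_pM2l.
Qed.

End Tilt.

(** * Divergence and duality along the l1 tilts *)

Section L1.
Context {R : realType} {T I : finType}.
Variables (y0 y' g : T -> I -> R) (alpha M A : R).
Hypotheses (hy0 : forall a, distr (y0 a)) (y0_gt0 : forall a i, 0 < y0 a i)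
  (y'_gt0 : forall a i, 0 < y' a i) (hy' : feasible y0 alpha y')
  (hg : forall a i, `|g a i| <= M) (hr : forall a i, `|ln (y' a i / y0 a i)| <= M)
  (hA : A = #|T|%:R) (A1 : 1 <= A) (M0 : 0 <= M)
  (alpha_gt0 : 0 < alpha) (alphaM : alpha <= M) (alphaVM : alpha^-1 <= M).

Let r a i := ln (y' a i / y0 a i).

Definition hdir (a : T) (i : I) : R := r a i + 2 * g a i / A.

Definition zpart (b : R) (a : T) : R := \sum_i y0 a i * expR (b * hdir a i).

Definition ytilt (b : R) (a : T) (i : I) : R :=
  y0 a i * expR (b * hdir a i) / zpart b a.

Let H : R := 3 * M.
Let k b a : R := ln (zpart b a).
Let u b a i := b * hdir a i - k b a.

Let A_gt0 : 0 < A. Proof. exact: lt_le_trans A1. Qed.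

Let gA a i : `|2 * g a i / A| <= 2 * M / A.
Proof.
have A0 : 0 <= A^-1 by rewrite invr_ge0 ltW.
by rewrite normrM (ger0_norm A0) normrM (ger0_norm (_ : 0 <= 2))// ler_wpM2r// ler_pM2l.
Qed.

Let gA2 a i : (2 * g a i / A) ^+ 2 <= (2 * M / A) ^+ 2.
Proof.
have n0 : 0 <= 2 * M / A by rewrite divr_ge0 ?(ltW A_gt0)// mulr_ge0.
by rewrite -[leLHS]real_normK ?num_real// lerXn2r ?nnegrE.
Qed.

Let hH a i : `|hdir a i| <= H.
Proof.
apply: (le_trans (ler_normD _ _)).
have h1 := gA a i; have h2 : 2 * M / A <= 2 * M.
  by rewrite ler_pdivrMr ?A_gt0// ler_peMr// mulr_ge0.
by have := hr a i; rewrite -/(r a i) /H; lra.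
Qed.

Let zpart_gt0 b a : 0 < zpart b a.
Proof.
have h i : 0 <= y0 a i * expR (b * hdir a i) by rewrite mulr_ge0 ?expR_ge0 ?(hy0 a).1.
rewrite lt_def sumr_ge0// andbT; apply/eqP => z0.
have : \sum_i y0 a i = 0.
  apply: big1 => i _.
  have /eqP : y0 a i * expR (b * hdir a i) = 0 by apply: (psumr_eq0P _ z0) => // j _.
  by rewrite mulf_eq0 (gt_eqF (expR_gt0 _)) orbF => /eqP.
by rewrite (hy0 a).2 => /eqP; rewrite oner_eq0.
Qed.

Let ytiltE b a i : ytilt b a i = y0 a i * expR (u b a i).
Proof. by rewrite /ytilt /u expRD expRN lnK ?posrE// mulrA. Qed.

Lemma ytilt_distr b a : distr (ytilt b a).
Proof.
split=> [i|]; last by rewrite -mulr_suml divff// gt_eqF// zpart_gt0.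
by rewrite ytiltE mulr_ge0 ?expR_ge0 ?(hy0 a).1.
Qed.

Let ytilt_gt0 b a i : 0 < ytilt b a i.
Proof. by rewrite ytiltE mulr_gt0 ?expR_gt0. Qed.

Let F b := ktot y0 (ytilt b).

Let kH b a : 0 <= b <= 1 -> `|k b a| <= H.
Proof.
move=> b01; apply: (tilt_const_le (hy0 a) (hH a) b01).
by rewrite -(ytilt_distr b a).2; apply: eq_bigr => i _; rewrite ytiltE.
Qed.

Let uH b a i : 0 <= b <= 1 -> `|u b a i| <= 2 * H.
Proof.
move=> b01; apply: (le_trans (ler_normB _ _)).
have : `|b * hdir a i| <= H.
  rewrite normrM ger0_norm; last by case/andP: b01.
  by apply: le_trans (hH a i); rewrite ler_piMl//; case/andP: b01.
by have := kH a b01; lra.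
Qed.

Let rE a i : y' a i = y0 a i * expR (r a i).
Proof. by rewrite lnK ?posrE ?divr_gt0// mulrCA divff ?mulr1// gt_eqF. Qed.

Let rel b a i : y' a i = ytilt b a i * expR (r a i - u b a i).
Proof. by rewrite ytiltE -mulrA -expRD subrKC -rE. Qed.

Let ler b a i : ytilt b a i = y' a i * expR (u b a i - r a i).
Proof. by rewrite rE -mulrA -expRD subrKC -ytiltE. Qed.

Let abs0 p a : abscont p (y0 a).
Proof. by move=> i /eqP; rewrite gt_eqF. Qed.

Let Q : R := \sum_a \sum_i y0 a i * hdir a i ^+ 2.
Let W : R := \sum_a \sum_i y0 a i * (hdir a i - \sum_j y0 a j * hdir a j) ^+ 2.

(** [gibbs] tests the exponent for [b2] at the tilt [b1]; the normalising constants cancel because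
    both tilts have mass 1. *)
Let F_sub b1 b2 : 0 <= b1 -> b1 <= b2 -> b2 <= 1 ->
  F b2 - F b1 <= b2 * \sum_a \sum_i (ytilt b2 a i - ytilt b1 a i) * hdir a i.
Proof.
move=> b10 b12 b21; rewrite /F /ktot -sumrB mulr_sumr; apply: ler_sum => a _.
have h1 : \sum_i ytilt b1 a i * u b2 a i <= klr (ytilt b1 a) (y0 a).
  apply: gibbs; [exact: ytilt_distr | exact: (hy0 a).1 | exact: abs0 | ].
  by rewrite -(ytilt_distr b2 a).2; apply: eq_bigr => i _; rewrite ytiltE.
rewrite (klr_expR (u := u b2 a)); last exact: ytiltE.
suff : \sum_i ytilt b2 a i * u b2 a i - \sum_i ytilt b1 a i * u b2 a i =
  b2 * \sum_i (ytilt b2 a i - ytilt b1 a i) * hdir a i by lra.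
rewrite -sumrB mulr_sumr.
have -> : \sum_i (b2 * ((ytilt b2 a i - ytilt b1 a i) * hdir a i)) =
  \sum_i (b2 * ((ytilt b2 a i - ytilt b1 a i) * hdir a i) - (ytilt b2 a i - ytilt b1 a i) * k b2 a).
  rewrite [RHS]sumrB -[X in _ = _ - X]mulr_suml sumrB.
  by rewrite (ytilt_distr b2 a).2 (ytilt_distr b1 a).2 subrr mul0r subr0.
by apply: eq_bigr => i _; rewrite /u; ring.
Qed.

Lemma ktot_tilt_lip b1 b2 : 0 <= b1 -> b1 <= b2 -> b2 <= 1 ->
  ktot y0 (ytilt b2) - ktot y0 (ytilt b1) <=
  (b2 - b1) * (expR (4 * H) * \sum_a \sum_i y0 a i * hdir a i ^+ 2).
Proof.
move=> b10 b12 b21; apply: (le_trans (F_sub b10 b12 b21)).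
have d01 : 0 <= b2 - b1 <= 1 by lra.
have E : \sum_a \sum_i (ytilt b2 a i - ytilt b1 a i) * hdir a i <=
    (b2 - b1) * (expR (4 * H) * Q).
  rewrite /Q !mulr_sumr; apply: ler_sum => a _.
  have y12 i : ytilt b2 a i = ytilt b1 a i * expR ((b2 - b1) * hdir a i - (k b2 a - k b1 a)).
    by rewrite !ytiltE -mulrA -expRD; congr (_ * expR _); rewrite /u; ring.
  apply: (le_trans (tilt_mean_le (ytilt_distr b1 a) (ytilt_distr b2 a) (hH a) d01 y12)).
  rewrite -mulrA ler_wpM2l ?subr_ge0//.
  have -> : expR (4 * H) = expR (2 * H) * expR (2 * H) by rewrite -expRD; congr expR; ring.
  rewrite -mulrA ler_wpM2l ?expR_ge0//.
  apply: (le_trans (var_le _ 0 (ytilt_distr b1 a))).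
  rewrite mulr_sumr; apply: ler_sum => i _; rewrite addr0 mulrA ler_wpM2r ?sqr_ge0//.
  rewrite ytiltE mulrC ler_wpM2r ?(hy0 a).1// ler_expR.
  by apply: (le_trans (ler_norm _)); apply: uH; lra.
have [Ep|En] := leP 0 (\sum_a \sum_i (ytilt b2 a i - ytilt b1 a i) * hdir a i).
  by apply: le_trans E; rewrite ler_piMl.
apply: (@le_trans _ _ 0); first by rewrite mulr_ge0_le0 ?(ltW En)//; lra.
apply: mulr_ge0; first by rewrite subr_ge0.
apply: mulr_ge0; rewrite ?expR_ge0// sumr_ge0// => a _; rewrite sumr_ge0// => i _.
by rewrite mulr_ge0 ?sqr_ge0// (hy0 a).1.
Qed.

Let sum_const (x : R) : \sum_(a : T) x = A * x.
Proof. by rewrite sumr_const hA mulr_natl. Qed.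

(** The source of uniformity in [A]. Bounded log-ratios make the second moment of [r] comparable to
    the divergence of [y'], which totals at most [alpha]; the part from [g] is of order [A ^- 2] in
    each of the [A] rows. *)
Lemma hdir_sqr_le : \sum_a \sum_i y0 a i * hdir a i ^+ 2 <=
  8 * expR M * M + 8 * M ^+ 2.
Proof.
have [_ _ K'] := hy'; have A1' := A1; have M0' := M0; have A0 := A_gt0.
have h1 : \sum_a \sum_i y0 a i * r a i ^+ 2 <= 4 * expR M * alpha.
  apply: (@le_trans _ _ (4 * expR M * ktot y0 y')); last first.
    by rewrite ler_wpM2l// mulr_ge0// expR_ge0.
  rewrite mulr_sumr; apply: ler_sum => a _.
  have [hya _ _] := hy'.
  rewrite (klr_kl_fun (hya a) (hy0 a) (rE a)) mulr_sumr; apply: ler_sum => i _.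
  have := kl_fun_quad_lb (r a i).
  have : expR (- M) <= expR (- `|r a i|) by rewrite ler_expR lerN2; exact: hr.
  have : expR M * expR (- M) = 1 by rewrite -expRD subrr expR0.
  have := expR_gt0 M; have := expR_gt0 (- M); have := sqr_ge0 (r a i).
  set s := r a i ^+ 2; set E := expR M; set E' := expR (- M); set t := expR (- `|_|).
  set v := _ + 1 => s0 E'0 E0 EE Et tv.
  have : s <= 4 * E * v.
    have : E' * s <= t * s by rewrite ler_wpM2r.
    move=> h2; have h3 : E' * s <= 4 * v by lra.
    have := ler_wpM2l (ltW E0) h3; rewrite mulrA EE; lra.
  by move=> /(ler_wpM2l ((hy0 a).1 i)); rewrite /=; lra.
have h2 : \sum_a \sum_i y0 a i * hdir a i ^+ 2 <=
   \sum_a (2 * (\sum_i y0 a i * r a i ^+ 2) + 8 * M ^+ 2 / A).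
  apply: ler_sum => a _.
  have -> : 8 * M ^+ 2 / A = \sum_i y0 a i * (8 * M ^+ 2 / A).
    by rewrite -mulr_suml (hy0 a).2 mul1r.
  rewrite mulr_sumr -big_split/=; apply: ler_sum => i _.
  have h3 : (2 * g a i / A) ^+ 2 <= 4 * M ^+ 2 / A.
    apply: (le_trans (gA2 a i)).
    have -> : (2 * M / A) ^+ 2 = 4 * M ^+ 2 / A * A^-1 by field; rewrite gt_eqF.
    rewrite ler_piMr ?invf_le1//.
    by apply: divr_ge0; [apply: mulr_ge0 => //; exact: sqr_ge0 | exact: ltW].
  have h4 : hdir a i ^+ 2 <= 2 * r a i ^+ 2 + 2 * (2 * g a i / A) ^+ 2.
    by rewrite /hdir; have := sqr_ge0 (r a i - 2 * g a i / A); nra.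
  have h5 : hdir a i ^+ 2 <= 2 * r a i ^+ 2 + 8 * M ^+ 2 / A by lra.
  by have := ler_wpM2l ((hy0 a).1 i) h5; lra.
apply: (le_trans h2); rewrite big_split/= -mulr_sumr sum_const.
have -> : A * (8 * M ^+ 2 / A) = 8 * M ^+ 2 by field; rewrite gt_eqF.
have : 4 * expR M * alpha <= 4 * expR M * M by rewrite ler_wpM2l// mulr_ge0// expR_ge0.
by lra.
Qed.

Definition f1 (x : T -> I -> R) : R :=
  \sum_a \sum_i g a i * x a i - A / 2 * \sum_a klr (x a) (y' a).

Let f1E x : (forall a, distr (x a)) ->
  f1 x = A / 2 * (\sum_a \sum_i x a i * hdir a i - ktot y0 x).
Proof.
move=> hx; rewrite /f1 /ktot.
have -> : \sum_a klr (x a) (y' a) = \sum_a (klr (x a) (y0 a) - \sum_i x a i * r a i).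
  apply: eq_bigr => a _; rewrite /klr -sumrB; apply: eq_bigr => i _; rewrite -mulrBr.
  have [->|xn] := eqVneq (x a i) 0; first by rewrite !mul0r.
  have xp : 0 < x a i by rewrite lt_def xn (hx a).1.
  congr (_ * _); rewrite /r !ln_div ?posrE ?divr_gt0//; ring.
rewrite sumrB mulrBr mulrBr.
have -> : \sum_a \sum_i g a i * x a i = A / 2 * \sum_a \sum_i x a i * (2 * g a i / A).
  rewrite mulr_sumr; apply: eq_bigr => a _; rewrite mulr_sumr; apply: eq_bigr => i _.
  by field; rewrite gt_eqF.
have -> : \sum_a \sum_i x a i * hdir a i =
  \sum_a \sum_i x a i * r a i + \sum_a \sum_i x a i * (2 * g a i / A).
  by rewrite -big_split/=; apply: eq_bigr => a _; rewrite -big_split/=; apply: eq_bigr => i _; rewrite /hdir mulrDr.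
by ring.
Qed.

Let gibbs_tilt b x : (forall a, distr (x a)) ->
  b * (\sum_a \sum_i x a i * hdir a i) - ktot y0 x <=
  b * (\sum_a \sum_i ytilt b a i * hdir a i) - F b.
Proof.
move=> hx; rewrite /F /ktot !mulr_sumr -!sumrB; apply: ler_sum => a _.
have ev z : distr z -> \sum_i z i * u b a i = b * (\sum_i z i * hdir a i) - k b a.
  move=> hz; rewrite -[k b a]mul1r -hz.2 mulr_suml mulr_sumr -sumrB.
  by apply: eq_bigr => i _; rewrite /u; ring.
have h1 : \sum_i x a i * u b a i <= klr (x a) (y0 a).
  apply: gibbs; [exact: hx | exact: (hy0 a).1 | exact: abs0 | ].
  by rewrite -(ytilt_distr b a).2; apply: eq_bigr => i _; rewrite ytiltE.
rewrite (klr_expR (p := ytilt b a) (u := u b a)); last exact: ytiltE.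
by move: h1; rewrite !ev//; [lra | exact: ytilt_distr].
Qed.

(** Weak duality with multiplier [A / 2 * ((1 - b) / b)]: the tilt maximises [b] times the mean of
    [hdir] minus the divergence, and the comparison is divided by [b]. *)
Lemma tilt_gap b x : 0 < b <= 1 -> feasible y0 alpha x ->
  f1 x <= f1 (ytilt b) + A / 2 * ((1 - b) / b) * (alpha - ktot y0 (ytilt b)).
Proof.
move=> /andP[b0 b1] [hx _ Kx].
rewrite !f1E//; last by move=> a; exact: ytilt_distr.
have h := gibbs_tilt b hx; rewrite /F in h.
set X := \sum_a \sum_i x a i * hdir a i in h *; set B := \sum_a _ in h *.
set KB := ktot y0 (ytilt b) in h *; set KX := ktot y0 x in h Kx *.
have AV : 0 < A / 2 by rewrite divr_gt0.
rewrite -[X in _ <= _ + X]mulrA -mulrDr ler_pM2l//.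
rewrite -(ler_pM2l b0).
have -> : b * (B - KB + (1 - b) / b * (alpha - KB)) = b * (B - KB) + (1 - b) * (alpha - KB).
  by field; rewrite gt_eqF.
have : (1 - b) * KX <= (1 - b) * alpha by rewrite ler_wpM2l// subr_ge0.
by lra.
Qed.

Let X b := \sum_a klr (y' a) (ytilt b a).

(** As [y'] is feasible and the tilt is not, [ktot y0 y' <= F b], and the terms in [r] cancel with a
    favourable sign. What remains is the mean difference of [g] with weight [2 / A], which Pinsker
    and Young bound by [X b / 2 + 8 * M ^+ 2 / A]; the first term is absorbed. *)
Let X_le b : 0 <= b <= 1 -> alpha < F b -> X b <= 16 * M ^+ 2 / A.
Proof.
move=> b01 Fb; have /andP[b0 b1] := b01; have [hya _ K'] := hy'; have A0 := A_gt0.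
pose E (z w : T -> I -> R) := \sum_a \sum_i z a i * w a i.
have XE : X b = ktot y0 y' - E y' (u b).
  rewrite /X /ktot /E -sumrB; apply: eq_bigr => a _.
  rewrite (klr_expR (rel b a)) (klr_expR (rE a)) -sumrB.
  by apply: eq_bigr => i _; ring.
have Eu z : (forall a, distr (z a)) -> E z (u b) = b * E z hdir - \sum_a k b a.
  move=> hz; rewrite /E mulr_sumr -sumrB; apply: eq_bigr => a _.
  rewrite -[k b a]mul1r -(hz a).2 mulr_suml mulr_sumr -sumrB.
  by apply: eq_bigr => i _; rewrite /u; ring.
have Eh z : E z hdir = E z r + 2 / A * E z g.
  rewrite /E mulr_sumr -big_split/=; apply: eq_bigr => a _.
  by rewrite mulr_sumr -big_split/=; apply: eq_bigr => i _; rewrite /hdir; ring.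
have FE : F b = E (ytilt b) (u b).
  by apply: eq_bigr => a _; rewrite (klr_expR (u := u b a)).
have K'E : ktot y0 y' = E y' r.
  by apply: eq_bigr => a _; rewrite (klr_expR (rE a)).
have pos : 0 <= F b - E (ytilt b) r.
  rewrite FE /E -sumrB; apply: sumr_ge0 => a _.
  have -> : \sum_i ytilt b a i * u b a i - \sum_i ytilt b a i * r a i = klr (ytilt b a) (y' a).
    by rewrite (klr_expR (ler b a)) -sumrB; apply: eq_bigr => i _; ring.
  apply: klr_ge0 => //; first exact: ytilt_distr.
  by move=> i /eqP; rewrite gt_eqF.
have hyt a := ytilt_distr b a.
have X1 : X b <= b * (2 / A * (E (ytilt b) g - E y' g)).
  have e1 := Eu _ hya; have e2 := Eu _ hyt; have e3 := Eh y'; have e4 := Eh (ytilt b).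
  rewrite XE.
  have -> : ktot y0 y' - E y' (u b) = ktot y0 y' - F b + b * (E (ytilt b) hdir - E y' hdir).
    by rewrite FE e1 e2; ring.
  rewrite e3 e4 K'E.
  have h1 : b * (E (ytilt b) r - E y' r) <= b * (F b - E y' r) by rewrite ler_wpM2l//; lra.
  have h2 : b * (F b - E y' r) <= 1 * (F b - E y' r) by rewrite ler_wpM2r//; rewrite K'E in K'; lra.
  by lra.
have X2 : 2 / A * (E (ytilt b) g - E y' g) <= X b / 2 + 8 * M ^+ 2 / A.
  have -> : 8 * M ^+ 2 / A = \sum_(a : T) 8 * M ^+ 2 / A ^+ 2.
    by rewrite sum_const; field; rewrite gt_eqF.
  rewrite /E -sumrB mulr_sumr /X mulr_suml -big_split/=; apply: ler_sum => a _.
  set l := \sum_i `|y' a i - ytilt b a i|.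
  have lX : l ^+ 2 <= 4 * klr (y' a) (ytilt b a).
    by apply: l1_le_klr => // i /eqP; rewrite gt_eqF.
  have lM : \sum_i ytilt b a i * g a i - \sum_i y' a i * g a i <= M * l.
    rewrite -sumrB mulr_sumr; apply: ler_sum => i _; rewrite -mulrBl.
    apply: (le_trans (ler_norm _)); rewrite normrM distrC mulrC.
    by rewrite ler_wpM2r.
  have AV : 0 <= 2 / A by rewrite divr_ge0// ltW.
  have h1 := ler_wpM2l AV lM.
  have h2 : 2 / A * (M * l) <= l ^+ 2 / 8 + 8 * M ^+ 2 / A ^+ 2.
    have -> : 8 * M ^+ 2 / A ^+ 2 = 8 * (M / A) ^+ 2 by field; rewrite gt_eqF.
    have -> : 2 / A * (M * l) = 2 * (M / A) * l by ring.
    by have := sqr_ge0 (l - 8 * (M / A)); lra.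
  by lra.
have X0 : 0 <= X b.
  apply: sumr_ge0 => a _; apply: klr_ge0 => //.
  by move=> i /eqP; rewrite gt_eqF.
have h3 : 0 <= X b / 2 + 8 * M ^+ 2 / A.
  by apply: addr_ge0; apply: divr_ge0; rewrite ?(ltW A0)//; apply: mulr_ge0 => //; exact: sqr_ge0.
have h4 := ler_wpM2l b0 X2.
have h5 : b * (X b / 2 + 8 * M ^+ 2 / A) <= 1 * (X b / 2 + 8 * M ^+ 2 / A) by rewrite ler_wpM2r.
by lra.
Qed.

(** The total variance [W] of [hdir] is bounded on both sides. Infeasibility gives
    [alpha < b ^+ 2 * expR (2 * H) * W]. By [X_le] the tilt is close to [y'], and the exponent of
    [y'] relative to it is [(1 - b) * hdir] up to a row constant and [2 * g / A]; this makes
    [(1 - b) ^+ 2 * W] of order [1 / A]. *)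
Lemma infeasible_bound b : 0 <= b <= 1 -> alpha < ktot y0 (ytilt b) ->
  A * (1 - b) ^+ 2 <=
  (M * expR (2 * H) * (8 * expR (5 * H) * (16 * M ^+ 2) + 8 * M ^+ 2)) * b ^+ 2.
Proof.
move=> b01 Fb; have Xb := X_le b01 Fb; have A0 := A_gt0; have M0' := M0.
have /andP[b0 b1] := b01; have [hya _ _] := hy'; have hyt a := ytilt_distr b a.
have FW : F b <= b ^+ 2 * expR (2 * H) * W.
  rewrite /F /ktot /W mulr_sumr; apply: ler_sum => a _.
  rewrite (klr_expR (u := u b a)); last exact: ytiltE.
  have q1 : \sum_i y0 a i * u b a i <= 0.
    have q : \sum_i y0 a i * expR (u b a i) = 1.
      by rewrite -(hyt a).2; apply: eq_bigr => i _; rewrite ytiltE.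
    apply: (le_trans (gibbs (hy0 a) (hy0 a).1 (@abs0 _ a) q)).
    by rewrite /klr big1// => i _; rewrite divff ?gt_eqF// ln1 mulr0.
  have q2 : \sum_i ytilt b a i * u b a i - \sum_i y0 a i * u b a i =
     b * \sum_i (ytilt b a i - y0 a i) * hdir a i.
    rewrite -sumrB mulr_sumr.
    have -> : \sum_i b * ((ytilt b a i - y0 a i) * hdir a i) =
      \sum_i (b * ((ytilt b a i - y0 a i) * hdir a i) - (ytilt b a i - y0 a i) * k b a).
      by rewrite [RHS]sumrB -[X in _ = _ - X]mulr_suml sumrB (hyt a).2 (hy0 a).2 subrr mul0r subr0.
    by apply: eq_bigr => i _; rewrite /u; ring.
  have := ler_wpM2l b0 (tilt_mean_le (hy0 a) (hyt a) (hH a) b01 (ytiltE b a)).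
  by set V := \sum_i y0 a i * _ ^+ 2; lra.
have TW : (1 - b) ^+ 2 * W <= 8 * expR (5 * H) * X b + 8 * M ^+ 2 / A.
  have -> : 8 * M ^+ 2 / A = \sum_(a : T) 8 * M ^+ 2 / A ^+ 2.
    by rewrite sum_const; field; rewrite gt_eqF.
  rewrite /W /X !mulr_sumr -big_split/=; apply: ler_sum => a _.
  pose w i := r a i - u b a i.
  have wE i : w i = (1 - b) * hdir a i + k b a - 2 * g a i / A by rewrite /w /u /hdir; ring.
  have v1 : (1 - b) ^+ 2 * (\sum_i y0 a i * (hdir a i - \sum_j y0 a j * hdir a j) ^+ 2) <=
    \sum_i y0 a i * ((1 - b) * hdir a i + k b a) ^+ 2.
    apply: le_trans (var_le (fun i => (1 - b) * hdir a i) (k b a) (hy0 a)).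
    rewrite mulr_sumr le_eqVlt; apply/orP; left; apply/eqP; apply: eq_bigr => i _.
    have -> : \sum_j y0 a j * ((1 - b) * hdir a j) = (1 - b) * \sum_j y0 a j * hdir a j.
      by rewrite mulr_sumr; apply: eq_bigr => j _; ring.
    by ring.
  apply: (le_trans v1).
  have -> : 8 * M ^+ 2 / A ^+ 2 = \sum_i y0 a i * (8 * M ^+ 2 / A ^+ 2).
    by rewrite -mulr_suml (hy0 a).2 mul1r.
  rewrite (klr_kl_fun (hya a) (hyt a) (rel b a)) mulr_sumr -big_split/=.
  apply: ler_sum => i _; rewrite -/(w i).
  have s1 : ((1 - b) * hdir a i + k b a) ^+ 2 <= 2 * w i ^+ 2 + 8 * M ^+ 2 / A ^+ 2.
    have -> : (1 - b) * hdir a i + k b a = w i + 2 * g a i / A by rewrite wE; ring.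
    have h3 := gA2 a i.
    have h4 : (2 * M / A) ^+ 2 = 4 * M ^+ 2 / A ^+ 2 by field; rewrite gt_eqF.
    have := sqr_ge0 (w i - 2 * g a i / A).
    have -> : 8 * M ^+ 2 / A ^+ 2 = 2 * (2 * M / A) ^+ 2 by rewrite h4; ring.
    by lra.
  have s2 : w i ^+ 2 <= 4 * expR (3 * H) * (w i * expR (w i) - expR (w i) + 1).
    have wH : `|w i| <= 3 * H.
      apply: (le_trans (ler_normB _ _)); have := hr a i; have := uH a i b01.
      by rewrite -/(r a i) /H; lra.
    have := kl_fun_quad_lb (w i).
    have : expR (- (3 * H)) <= expR (- `|w i|) by rewrite ler_expR lerN2.
    have : expR (3 * H) * expR (- (3 * H)) = 1 by rewrite -expRD subrr expR0.
    have := expR_gt0 (3 * H); have := sqr_ge0 (w i).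
    set s := w i ^+ 2; set E := expR (3 * H); set E' := expR (- (3 * H)); set t := expR (- `|_|).
    set v := _ + 1 => s0 E0 EE Et tv.
    have : E' * s <= t * s by rewrite ler_wpM2r.
    move=> h2; have h3 : E' * s <= 4 * v by lra.
    have := ler_wpM2l (ltW E0) h3; rewrite mulrA EE; lra.
  set v := w i * expR (w i) - expR (w i) + 1 in s2 *.
  have v0 : 0 <= v.
    have := le_trans (sqr_ge0 (w i)) s2; rewrite pmulr_rge0//.
    by rewrite mulr_gt0// expR_gt0.
  have s3 : y0 a i <= expR (2 * H) * ytilt b a i.
    rewrite ytiltE mulrCA -expRD ler_peMr ?(hy0 a).1//.
    apply: le_trans (expR_ge1Dx _); rewrite lerDl.
    by have := uH a i b01; rewrite ler_norml; lra.
  have s4 : y0 a i * w i ^+ 2 <= 4 * expR (5 * H) * (ytilt b a i * v).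
    have e5 : expR (5 * H) = expR (2 * H) * expR (3 * H) by rewrite -expRD; congr expR; ring.
    have h1 := ler_wpM2l ((hy0 a).1 i) s2.
    have h2 : y0 a i * (4 * expR (3 * H) * v) <= expR (2 * H) * ytilt b a i * (4 * expR (3 * H) * v).
      by rewrite ler_wpM2r// !mulr_ge0// expR_ge0.
    apply: (le_trans h1); apply: (le_trans h2).
    by rewrite e5 le_eqVlt; apply/orP; left; apply/eqP; ring.
  have s5 := ler_wpM2l ((hy0 a).1 i) s1.
  by lra.
have aF : 1 <= M * F b.
  have h1 : alpha * alpha^-1 <= alpha * M by rewrite ler_pM2l.
  have h2 : M * alpha <= M * F b by rewrite ler_wpM2l// ltW.
  by move: h1; rewrite divff ?gt_eqF//; lra.
set C := 8 * expR (5 * H) * (16 * M ^+ 2) + 8 * M ^+ 2.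
have t1 : A * ((1 - b) ^+ 2 * W) <= C.
  have := ler_wpM2l (ltW A0) TW.
  have : A * (8 * expR (5 * H) * X b) <= 8 * expR (5 * H) * (16 * M ^+ 2).
    rewrite mulrCA ler_wpM2l ?mulr_ge0 ?expR_ge0//.
    by rewrite -ler_pdivlMl// mulrC.
  have : A * (8 * M ^+ 2 / A) = 8 * M ^+ 2 by field; rewrite gt_eqF.
  by rewrite /C; lra.
have t2 : 1 <= M * (b ^+ 2 * expR (2 * H) * W).
  by apply: (le_trans aF); rewrite ler_wpM2l.
have t3 : 0 <= A * (1 - b) ^+ 2 by rewrite mulr_ge0 ?sqr_ge0// ltW.
have t4 := ler_wpM2l t3 t2; rewrite mulr1 in t4.
apply: (le_trans t4).
have -> : A * (1 - b) ^+ 2 * (M * (b ^+ 2 * expR (2 * H) * W)) =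
  (M * expR (2 * H) * b ^+ 2) * (A * ((1 - b) ^+ 2 * W)) by ring.
have -> : M * expR (2 * H) * C * b ^+ 2 = (M * expR (2 * H) * b ^+ 2) * C by ring.
rewrite ler_wpM2l//; apply: mulr_ge0; last exact: sqr_ge0.
by rewrite mulr_ge0 ?expR_ge0.
Qed.

End L1.

(** * Cost of runs *)

Definition cell (x : nat) : rexpr := RGet x (NConst 0) (NConst 0).
Definition rset (x : nat) (e : rexpr) : cmd := RSet x (NConst 0) (NConst 0) e.
Definition rnat (k : nat) : rexpr := RNat (NConst k).

Definition for_loop (i v : nat) (body : cmd) : cmd :=
  Seq (NSet i (NConst 0))
    (While (BNLt (NVar i) (NVar v)) (Seq body (NSet i (NAdd (NVar i) (NConst 1))))).

Definition sum_loop (acc i v : nat) (e : rexpr) : cmd :=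
  Seq (rset acc (rnat 0)) (for_loop i v (rset acc (RAdd (cell acc) e))).

Definition fill_loop (out a i v : nat) (e : rexpr) : cmd :=
  for_loop i v (RSet out (NVar a) (NVar i) e).

Section Machine.
Context {R : realType}.
Implicit Types (st s : state R) (Q : nat -> state R -> Prop) (c : cmd).

(** A weakest-precondition form: [Q] receives the exact cost, to which each rule adds its share. *)
Definition run c st Q : Prop := exists n s, exec c st n s /\ Q n s.

Lemma run_weaken c st Q Q' : run c st Q -> (forall n s, Q n s -> Q' n s) ->
  run c st Q'.
Proof. by move=> [n [s [h q]]] w; exists n, s; split=> //; exact: w. Qed.

Lemma run_seq c1 c2 st Q :
  run c1 st (fun n1 s1 => run c2 s1 (fun n2 s2 => Q (1 + n1 + n2)%N s2)) ->
  run (Seq c1 c2) st Q.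
Proof.
move=> [n1 [s1 [h1 [n2 [s2 [h2 q]]]]]]; exists (1 + n1 + n2)%N, s2; split=> //.
exact: ExecSeq h1 h2.
Qed.

Lemma run_nset x e st Q : Q (1 + ncost e)%N (nupd st x (neval st e)) ->
  run (NSet x e) st Q.
Proof. by move=> q; exists (1 + ncost e)%N, (nupd st x (neval st e)); split=> //; constructor. Qed.

Lemma run_rset_at x i j e st Q :
  Q (1 + ncost i + ncost j + rcost e)%N
    (rupd st x (neval st i) (neval st j) (reval st e)) ->
  run (RSet x i j e) st Q.
Proof. by move=> q; do 2 eexists; split; [constructor | exact: q]. Qed.

Lemma run_rset x e st Q : Q (3 + rcost e)%N (rupd st x 0 0 (reval st e)) ->
  run (rset x e) st Q.
Proof. exact: run_rset_at. Qed.

Lemma run_skip st Q : Q 1%N st -> run Skip st Q.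
Proof. by move=> q; exists 1%N, st; split=> //; constructor. Qed.

Lemma run_if b c1 c2 st Q :
  (beval st b -> run c1 st (fun n s => Q (1 + bcost b + n)%N s)) ->
  (~~ beval st b -> run c2 st (fun n s => Q (1 + bcost b + n)%N s)) ->
  run (If b c1 c2) st Q.
Proof.
move=> h1 h2; case hb : (beval st b).
  have [n [s [h q]]] := h1 hb; exists (1 + bcost b + n)%N, s; split=> //.
  by constructor; rewrite hb.
have [n [s [h q]]] := h2 (negbT hb); exists (1 + bcost b + n)%N, s; split=> //.
by constructor; rewrite hb.
Qed.

(** Termination follows from the obligation that the guard can hold at pass [k] only if [k < J]. An
    upper bound on the number of passes suffices, as for the l1 loop, whose stopping time depends on
    the data. *)
Lemma run_while b c st (J cost : nat) (Inv : nat -> state R -> Prop) :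
  Inv 0 st ->
  (forall k s, Inv k s -> beval s b ->
     (k < J)%N /\ run c s (fun n s' => (n <= cost)%N /\ Inv k.+1 s')) ->
  run (While b c) st (fun n s =>
    (n <= J * (1 + bcost b + cost) + (1 + bcost b))%N /\
    exists k, Inv k s /\ ~~ beval s b).
Proof.
move=> I0 step.
have main m : forall k s, (m = J - k)%N -> (k <= J)%N -> Inv k s ->
  run (While b c) s (fun n s' => (n <= m * (1 + bcost b + cost) + (1 + bcost b))%N /\
    exists k, Inv k s' /\ ~~ beval s' b).
  elim: m => [|m IH] k s mk kJ Ik; case hb : (beval s b).
  - by have [] := step _ _ Ik hb; lia.
  - exists (1 + bcost b)%N, s; split; first by constructor; rewrite hb.
    by split=> //; exists k; rewrite hb.
  - have [kJ' [n1 [s1 [h1 [n1c I1]]]]] := step _ _ Ik hb.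
    have [|n2 [s2 [h2 [n2c q]]]] := IH k.+1 s1 _ kJ' I1; first by lia.
    exists (1 + bcost b + n1 + n2)%N, s2; split; first exact: ExecWhileStep h1 h2.
    by split=> //; rewrite mulSn; lia.
  - exists (1 + bcost b)%N, s; split; first by constructor; rewrite hb.
    by split=> //; [lia | exists k; rewrite hb].
by apply: main I0 => //; rewrite subn0.
Qed.

Definition frame (xs ys : seq nat) st s : Prop :=
  (forall x, x \notin xs -> nmem s x = nmem st x) /\
  (forall y, y \notin ys -> forall i j, rmem s y i j = rmem st y i j).

Lemma frame_trans xs ys s1 s2 s3 :
  frame xs ys s1 s2 -> frame xs ys s2 s3 -> frame xs ys s1 s3.
Proof.
move=> [n12 r12] [n23 r23]; split=> [x hx|y hy i j]; first by rewrite n23// n12.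
by rewrite r23// r12.
Qed.

Lemma frame_sub xs ys xs' ys' s1 s2 : {subset xs <= xs'} -> {subset ys <= ys'} ->
  frame xs ys s1 s2 -> frame xs' ys' s1 s2.
Proof.
move=> sx sy [n12 r12]; split=> [x hx|y hy i j].
  by rewrite n12//; apply: contra hx => /sx.
by rewrite r12//; apply: contra hy => /sy.
Qed.

Lemma frame_rupd xs ys st s x i j v : x \in ys -> frame xs ys st s ->
  frame xs ys st (rupd s x i j v).
Proof.
move=> xy [n12 r12]; split=> // y hy k l /=; rewrite -r12//.
by case: eqP => // yx; rewrite yx xy in hy.
Qed.

Lemma frame_nupd xs ys st s x v : x \in xs -> frame xs ys st s ->
  frame xs ys st (nupd s x v).
Proof.
move=> xy [n12 r12]; split=> // y hy /=; rewrite -n12//.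
by case: eqP => // yx; rewrite yx xy in hy.
Qed.

Lemma run_for i v n body cost (Inv : nat -> state R -> Prop) st :
  i != v -> nmem st v = n -> Inv 0%N (nupd st i 0) ->
  (forall (k : 'I_n) s, nmem s v = n -> nmem s i = k -> Inv k s ->
     run body s (fun m s' => [/\ (m <= cost)%N, nmem s' v = n, nmem s' i = k
        & Inv k.+1 (nupd s' i k.+1)])) ->
  run (for_loop i v body) st
    (fun m s => (m <= n * (cost + 9) + 7)%N /\ Inv n s).
Proof.
move=> iv sv I0 step; apply: run_seq; apply: run_nset => /=.
apply: run_weaken (@run_while _ _ _ n (cost + 5)
  (fun k s => [/\ nmem s v = n, nmem s i = k, (k <= n)%N & Inv k s]) _ _) _.
- by split=> //=; rewrite ?eqxx// eq_sym (negbTE iv).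
- move=> k s [h1 h2 h3 h4] /=; rewrite h1 h2 => kn; split=> //.
  apply: run_seq; apply: run_weaken (step (Ordinal kn) s h1 h2 h4) _.
  move=> m s' [mc e1 e2 I'] /=; apply: run_nset => /=; split; first by lia.
  rewrite e2 addn1; split=> //=; rewrite ?eqxx//.
  by rewrite eq_sym (negbTE iv).
- move=> m s [/= mc [k [[h1 h2 h3 h4]]]]; rewrite h1 h2 -leqNgt => nk.
  have kn : k = n by apply/eqP; rewrite eqn_leq h3.
  by rewrite kn in h4; split=> //; lia.
Qed.

Lemma sum_ord_lt n (F : 'I_n -> R) (k : 'I_n) :
  \sum_(j < n | (j < k.+1)%N) F j = \sum_(j < n | (j < k)%N) F j + F k.
Proof.
rewrite (bigD1 k) ?ltnSn//= addrC; congr (_ + _); apply: eq_bigl => j.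
by rewrite ltnS ltn_neqAle andbC.
Qed.

Lemma run_sum acc i v n e (F : 'I_n -> R) st : i != v -> nmem st v = n ->
  (forall (k : 'I_n) s, frame [:: i] [:: acc] st s -> nmem s i = k ->
     reval s e = F k) ->
  run (sum_loop acc i v e) st (fun m s =>
    [/\ (m <= n * (rcost e + 16) + 13)%N, frame [:: i] [:: acc] st s
      & rmem s acc 0 0 = \sum_k F k]).
Proof.
move=> iv sv eF; apply: run_seq; apply: run_rset => /=.
set st1 := rupd _ _ _ _ _.
have f1 : frame [:: i] [:: acc] st st1 by apply: frame_rupd; rewrite ?inE.
apply: run_weaken (@run_for i v n _ (rcost e + 7) (fun k s =>
  frame [:: i] [:: acc] st s /\ rmem s acc 0 0 = \sum_(j < n | (j < k)%N) F j)
  st1 iv sv _ _) _.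
- by split; [apply: frame_nupd; rewrite ?inE | rewrite /= eqxx/= big_pred0].
- move=> k s sv' si [fs sa]; apply: run_rset => /=; split=> //; first by lia.
  split; first by apply: frame_nupd; rewrite ?inE//; apply: frame_rupd; rewrite ?inE.
  by rewrite eqxx/= sa (eF k)// sum_ord_lt.
- move=> m s [mc [fs ->]]; split=> //; first by lia.
  by apply: eq_bigl => j; rewrite ltn_ord.
Qed.

(** The expression may read the cell that it is about to overwrite, as the final mixing does; the
    premise on [rmem s out (nmem st a) k] says that this cell is still intact. *)
Lemma run_fill out a i v n e (F : 'I_n -> R) st : i != v -> a != i ->
  nmem st v = n ->
  (forall (k : 'I_n) s, frame [:: i] [:: out] st s -> nmem s i = k ->
     rmem s out (nmem st a) k = rmem st out (nmem st a) k -> reval s e = F k) ->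
  run (fill_loop out a i v e) st (fun m s =>
    [/\ (m <= n * (rcost e + 12) + 7)%N, frame [:: i] [:: out] st s,
      forall k : 'I_n, rmem s out (nmem st a) k = F k
      & forall b j, b != nmem st a -> rmem s out b j = rmem st out b j]).
Proof.
move=> iv ai sv eF.
apply: run_weaken (@run_for i v n _ (rcost e + 3) (fun k s =>
  [/\ frame [:: i] [:: out] st s,
    forall j : 'I_n, (j < k)%N -> rmem s out (nmem st a) j = F j,
    forall j : 'I_n, (k <= j)%N -> rmem s out (nmem st a) j = rmem st out (nmem st a) j
    & forall b j, b != nmem st a -> rmem s out b j = rmem st out b j])
  st iv sv _ _) _.
- by split=> //; apply: frame_nupd; rewrite ?inE.
- move=> k s sv' si [fs lt ge ne]; apply: run_rset_at => /=; rewrite si.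
  have sa : nmem s a = nmem st a by rewrite fs.1// inE.
  rewrite sa (eF k)//; last exact: ge.
  split=> //; first by lia.
  split.
  + by apply: frame_nupd; rewrite ?inE//; apply: frame_rupd; rewrite ?inE.
  + move=> j jk /=; rewrite !eqxx/=; case: eqP => [/val_inj-> //|/eqP jk'].
    by apply: lt; rewrite ltn_neqAle jk' -ltnS.
  + move=> j jk /=; rewrite !eqxx/=; case: eqP => [jk'|_]; last by apply: ge; lia.
    by move: jk; rewrite jk' ltnn.
  + by move=> b j bn /=; rewrite (negbTE bn) andbF; exact: ne.
- move=> m s [mc [fs lt _ ne]]; split=> //; first by lia.
  by move=> k; exact: lt.
Qed.

End Machine.

(** * The l2 program *)

Definition entry (x : nat) : rexpr := RGet x (NVar 2) (NVar 3).
Definition row_sum (acc : nat) (e : rexpr) : cmd := sum_loop acc 3 0 e.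
Definition rhalf (e : rexpr) : rexpr := RDiv e (rnat 2).

(* Cells of the l2 program: 8 D, 9 e, 10 lambda, 11 K, 12 mu, 13 N(mu),
   14 and 15 the bracket of mu, 16 its relative width, 17 the target width,
   18 W, 19 the divergence of one row. *)
Definition zexpr (mu : rexpr) : rexpr :=
  RMul (cell 10) (RLambertW (RMul (RDiv (entry 2) (cell 10))
    (RExp (RDiv (RSub (RAdd (entry 0) (entry 1)) mu) (cell 10))))).

Definition bisect_mu : cmd :=
  Seq (rset 12 (rhalf (RAdd (cell 14) (cell 15))))
  (Seq (row_sum 13 (zexpr (cell 12)))
  (Seq (If (BRLe (rnat 1) (cell 13)) (rset 14 (cell 12)) (rset 15 (cell 12)))
    (rset 16 (rhalf (cell 16))))).

Definition kl_entry : rexpr := RMul (entry 5) (RLn (RDiv (entry 5) (entry 2))).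

Definition solve_row : cmd :=
  Seq (row_sum 12 (RMul (entry 2) (RSub (RAdd (entry 0) (entry 1)) (entry 2))))
  (Seq (row_sum 13 (zexpr (cell 12)))
  (Seq (rset 18 (RMul (RAdd (cell 10) (cell 8))
          (RPow (RMul (RLn (cell 13)) (RLn (cell 13))) (rhalf (rnat 1)))))
  (Seq (rset 14 (RSub (cell 12) (cell 18)))
  (Seq (rset 15 (RAdd (cell 12) (cell 18)))
  (Seq (rset 16 (rnat 1))
  (Seq (While (BRLe (cell 17) (cell 16)) bisect_mu)
  (Seq (row_sum 13 (zexpr (cell 14)))
  (Seq (fill_loop 5 2 3 0 (RDiv (zexpr (cell 14)) (cell 13)))
  (Seq (row_sum 19 kl_entry)
    (rset 11 (RAdd (cell 11) (cell 19)))))))))))).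

Definition solve : cmd := Seq (rset 11 (rnat 0)) (for_loop 2 1 solve_row).

Section Context.
Context {R : realType} {A S : nat}.
Variables (g y' y0 : 'M[R]_(A, S)) (alpha eps : R).
Implicit Types st s : state R.

Definition data_in st : Prop :=
  [/\ nmem st 0 = S, nmem st 1 = A,
    forall (a : 'I_A) (i : 'I_S), [/\ rmem st 0 a i = g a i,
       rmem st 1 a i = y' a i & rmem st 2 a i = y0 a i],
    rmem st 3 0 0 = alpha & rmem st 4 0 0 = eps].

Lemma data_frame xs ys st s : frame xs ys st s ->
  all (leq 2) xs -> all (leq 5) ys -> data_in st -> data_in s.
Proof.
move=> [fn fr] /allP hx /allP hy [h0 h1 h2 h3 h4].
have nx x : (x < 2)%N -> x \notin xs by move=> lx; apply/negP => /hx; lia.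
have ny y : (y < 5)%N -> y \notin ys by move=> ly; apply/negP => /hy; lia.
by split; rewrite ?fn ?fr ?nx ?ny// => a i; rewrite !fr ?ny//; exact: h2.
Qed.

Lemma data_input : data_in (input g y' y0 alpha eps).
Proof.
have mxc (m : 'M[R]_(A, S)) (a : 'I_A) (i : 'I_S) : mx_cells m a i = m a i.
  by rewrite /mx_cells !valK.
by split=> //= a i; split; exact: mxc.
Qed.

End Context.

(** * Execution of the inner maximisation *)

Section SolveRow.
Context {R : realType} {A S : nat}.
Variables (g y' y0 : 'M[R]_(A, S)) (alpha eps lam D eta : R) (k : nat).
Hypotheses (hk : forall j, (j < k)%N -> eta <= 2^-1 ^+ j) (hk' : 2^-1 ^+ k < eta).
Implicit Types st s : state R.

Let c a i := g a i + y' a i.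

Definition row_env st : Prop :=
  [/\ data_in g y' y0 alpha eps st, rmem st 10 0 0 = lam, rmem st 8 0 0 = D
    & rmem st 17 0 0 = eta].

Let cells := [:: 5; 11; 12; 13; 14; 15; 16; 18; 19]%N.
Let cells0 := [:: 12; 13; 14; 15; 16; 18; 19]%N.

Lemma env_frame xs st s : all (leq 2) xs -> frame xs cells st s -> row_env st -> row_env s.
Proof.
move=> hx f [h1 h2 h3 h4]; split; rewrite ?f.2//; exact: data_frame f hx _ h1.
Qed.

Let zexprE s mu (a : 'I_A) (i : 'I_S) : row_env s -> nmem s 2 = a -> nmem s 3 = i ->
  reval s (zexpr mu) = zrow (y0 a) (c a) lam (reval s mu) i.
Proof.
move=> [[_ _ h _ _] e10 _ _] s2 s3 /=; rewrite s2 s3 e10.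
by have [-> -> ->] := h a i.
Qed.

Variable (a : 'I_A).

Let fr := @frame R [:: 3]%N cells0.
Let fr' := @frame R [:: 3]%N cells.

Let fr_sub st s : fr st s -> fr' st s.
Proof. by apply: frame_sub => // x; rewrite !inE => h; rewrite h !orbT. Qed.

Let env_fr st s : fr st s -> row_env st -> row_env s.
Proof. by move=> /fr_sub; exact: env_frame. Qed.

Let row_sum_z st acc mu : acc \in cells0 -> (forall s, frame [:: 3]%N [:: acc] st s ->
    reval s mu = reval st mu) ->
  row_env st -> nmem st 2 = a ->
  run (row_sum acc (zexpr mu)) st (fun m s =>
    [/\ (m <= S * (rcost mu + 42) + 13)%N, frame [:: 3]%N [:: acc] st s
     & rmem s acc 0 0 = nrow (y0 a) (c a) lam (reval st mu)]).
Proof.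
move=> hacc hmu env s2; have [[sS _ _ _ _] _ _ _] := env.
apply: run_weaken (run_sum (F := fun i => zrow (y0 a) (c a) lam (reval st mu) i)
  (erefl : 3 != 0)%N sS _) _.
  move=> i s f si; have env' : row_env s.
    by apply: env_fr env; apply: frame_sub f => // x; rewrite inE => /eqP->.
  have s2' : nmem s 2 = a by rewrite f.1.
  by rewrite (zexprE mu env' s2' si) hmu.
by move=> m s [mc f ->]; split=> //; move: mc => /=; lia.
Qed.

Let fr_acc acc st s : acc \in cells0 -> frame [:: 3]%N [:: acc] st s -> fr st s.
Proof. by move=> h; apply: frame_sub => // x; rewrite inE => /eqP->. Qed.

(** [hk] and [hk'] make [k] the exact number of passes, so that memory ends at the mathematical
    iterate [bis k]. *)
Let run_bisect (bis : nat -> R * R) st :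
  (forall j, bis j.+1 = bstep (fun m => 1 <= nrow (y0 a) (c a) lam m) (bis j)) ->
  row_env st -> nmem st 2 = a ->
  rmem st 14 0 0 = (bis 0).1 -> rmem st 15 0 0 = (bis 0).2 -> rmem st 16 0 0 = 1 ->
  run (While (BRLe (cell 17) (cell 16)) bisect_mu) st (fun m s =>
    [/\ (m <= k * (S * 45 + 80) + 8)%N, fr st s & rmem s 14 0 0 = (bis k).1]).
Proof.
move=> bS env s2 s14 s15 s16.
apply: run_weaken (@run_while _ _ _ _ k (S * 45 + 70) (fun j s =>
  [/\ fr st s, (j <= k)%N, rmem s 14 0 0 = (bis j).1, rmem s 15 0 0 = (bis j).2
    & rmem s 16 0 0 = 2^-1 ^+ j]) _ _) _.
- by split.
- move=> j s [f jk h14 h15 h16].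
  have env' := env_fr f env.
  have s2' : nmem s 2 = a by rewrite f.1.
  have [_ _ _ h17] := env'.
  rewrite /= h16 h17 => guard.
  have jk' : (j < k)%N.
    rewrite ltn_neqAle jk andbT; apply/eqP => e; move: guard.
    by rewrite e leNgt hk'.
  split=> //.
  apply: run_seq; apply: run_rset => /=; rewrite h14 h15.
  set mid := (_ + _) / _; set s1 := rupd _ _ _ _ _.
  have f1 : fr s s1 by apply: frame_rupd.
  have env1 := env_fr f1 env'.
  apply: run_seq; apply: run_weaken (row_sum_z (acc := 13) (mu := cell 12) _ _ env1 _) _ => //.
    by move=> s3 f3 /=; rewrite f3.2.
  move=> m2 s3 [m2c f3 h13].
  have m12 : rmem s3 12 0 0 = mid by rewrite f3.2.
  have {}h13 : rmem s3 13 0 0 = nrow (y0 a) (c a) lam mid by rewrite h13.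
  have f3' : fr s s3 by apply: frame_trans f1 _; exact: fr_acc f3.
  have h3 x : x \notin [:: 12; 13]%N -> rmem s3 x 0 0 = rmem s x 0 0.
    rewrite !inE negb_or => /andP[x1 x2].
    by rewrite f3.2 ?inE// /s1 /= (negbTE x1).
  apply: run_seq; apply: run_if => /=; rewrite h13 => test; apply: run_rset => /=;
    apply: run_rset => /=; rewrite (h3 16)// h16 m12; split; try (move: m2c => /=; lia).
  + rewrite bS /bstep -/mid test; split=> //.
    * by apply: frame_trans f _; do 2 apply: frame_rupd => //.
    * by rewrite /= (h3 15).
    * by rewrite /= exprSr.
  + rewrite bS /bstep -/mid (negbTE test); split=> //.
    * by apply: frame_trans f _; do 2 apply: frame_rupd => //.
    * by rewrite /= (h3 14).
    * by rewrite /= exprSr.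
- move=> m s [/= mc [j [[f jk h14 h15 h16]]]] guard; split=> //; first by lia.
  have [_ _ _ h17] := env_fr f env.
  suff -> : k = j by [].
  apply/eqP; rewrite eqn_leq jk andbT leqNgt; apply/negP => jk'.
  by move: guard; rewrite h16 h17 hk.
Qed.

Lemma run_solve_row st : row_env st -> nmem st 2 = a ->
  run solve_row st (fun m s =>
    [/\ (m <= (k + 4) * (S * 60 + 200))%N, frame [:: 3]%N cells st s,
      forall i : 'I_S, rmem s 5 a i = yrow (y0 a) (c a) lam D k i,
      forall b j, b != a :> nat -> rmem s 5 b j = rmem st 5 b j
    & rmem s 11 0 0 = rmem st 11 0 0 + klr (yrow (y0 a) (c a) lam D k) (y0 a)]).
Proof.
move=> env0 s20; have [[sS _ h0 _ _] h10 h8 h17] := env0.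
have tr' s : fr' st s -> row_env s /\ nmem s 2 = a.
  move=> f; split; last by rewrite f.1.
  exact: (env_frame (erefl : all (leq 2) [:: 3]%N) f env0).
have tr s : fr st s -> row_env s /\ nmem s 2 = a by move=> /fr_sub; exact: tr'.
apply: run_seq.
apply: run_weaken (run_sum (F := fun i => y0 a i * (c a i - y0 a i)) (erefl : 3 != 0)%N sS _) _.
  move=> i s f s3 /=.
  have [[[_ _ h _ _] _ _ _] s2] := tr s (fr_acc (erefl : 12 \in cells0)%N f).
  by rewrite s2 s3; have [-> -> ->] := h a i.
move=> m1 s1 [m1c f1 h12].
have {}h12 : rmem s1 12 0 0 = mu_init (y0 a) (c a) by rewrite h12.
have {}f1 := fr_acc (erefl : 12 \in cells0)%N f1; have [env1 s21] := tr _ f1.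
apply: run_seq.
apply: run_weaken (row_sum_z (acc := 13) (mu := cell 12) _ _ env1 s21) _ => //.
  by move=> s f /=; rewrite f.2.
move=> m2 s2 [m2c f2 h13].
have h12' : rmem s2 12 0 0 = mu_init (y0 a) (c a) by rewrite f2.2.
have h13' : rmem s2 13 0 0 = nrow (y0 a) (c a) lam (mu_init (y0 a) (c a)) by rewrite h13 /= h12.
have {}f2 := frame_trans f1 (fr_acc (erefl : 13 \in cells0)%N f2).
have [[_ k10 k8 _] s22] := tr _ f2.
do 4 (apply: run_seq; apply: run_rset => /=).
rewrite h12' h13' k10 k8.
set s3 := rupd _ _ _ _ _.
have f3 : fr st s3 by do 4 apply: frame_rupd => //.
have [env3 s23] := tr _ f3.
(* The absolute value of [ln N] is computed as the power 1/2 of its square. *)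
have W : (lam + D) * ((ln (nrow (y0 a) (c a) lam (mu_init (y0 a) (c a))) *
    ln (nrow (y0 a) (c a) lam (mu_init (y0 a) (c a)))) `^ (1 / 2)) = wid (y0 a) (c a) lam D.
  by rewrite div1r powR12_sqrt -expr2 ?sqr_ge0// sqrtr_sqr.
apply: run_seq; apply: run_weaken (run_bisect (bis := bracket (y0 a) (c a) lam D) _ env3 s23 _ _ _) _.
- by [].
- by rewrite /s3 /= W.
- by rewrite /s3 /= W.
- by [].
move=> m4 s4 [m4c f4 h14].
have {}f4 := frame_trans f3 f4; have [env4 s24] := tr _ f4.
apply: run_seq; apply: run_weaken (row_sum_z (acc := 13) (mu := cell 14) _ _ env4 s24) _ => //.
  by move=> s f /=; rewrite f.2.
move=> m5 s5 [m5c f5 h13''].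
have h14' : rmem s5 14 0 0 = mu_hat (y0 a) (c a) lam D k by rewrite f5.2.
have {}h13'' : rmem s5 13 0 0 = nrow (y0 a) (c a) lam (mu_hat (y0 a) (c a) lam D k).
  by rewrite h13'' /= h14.
have {}f5 := frame_trans f4 (fr_acc (erefl : 13 \in cells0)%N f5); have [env5 s25] := tr _ f5.
have [[sS5 _ _ _ _] _ _ _] := env5.
apply: run_seq.
apply: run_weaken (run_fill (out := 5) (F := yrow (y0 a) (c a) lam D k)
  (erefl : 3 != 0)%N (erefl : 2 != 3)%N sS5 _) _.
  move=> i s f s3' _.
  have f' : fr' st s.
    by apply: frame_trans (fr_sub f5) _; apply: frame_sub f => // x; rewrite inE => /eqP->.
  have [env' s2'] := tr' _ f'.
  have -> : reval s (RDiv (zexpr (cell 14)) (cell 13)) =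
    reval s (zexpr (cell 14)) / rmem s 13 0 0 by [].
  by rewrite (zexprE _ env' s2' s3') /= !f.2// h14' h13''.
move=> m6 s6 [m6c f6 h5 h5']; rewrite s25 in h5 h5'.
have h11 : rmem s6 11 0 0 = rmem st 11 0 0 by rewrite f6.2// f5.2.
have {}f6 : fr' st s6.
  by apply: frame_trans (fr_sub f5) _; apply: frame_sub f6 => // x; rewrite inE => /eqP->.
have [env6 s26] := tr' _ f6.
have [[sS6 _ _ _ _] _ _ _] := env6.
apply: run_seq.
apply: run_weaken (run_sum (acc := 19) (F := fun i => yrow (y0 a) (c a) lam D k i *
   ln (yrow (y0 a) (c a) lam D k i / y0 a i)) (erefl : 3 != 0)%N sS6 _) _.
  move=> i s f s3' /=.
  have f' := frame_trans f6 (fr_sub (fr_acc (erefl : 19 \in cells0)%N f)).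
  have [[[_ _ h _ _] _ _ _] s2'] := tr' _ f'.
  by rewrite s2' s3'; have [_ _ ->] := h a i; rewrite f.2// h5.
move=> m7 s7 [m7c f7 h19].
have f7' := frame_trans f6 (fr_sub (fr_acc (erefl : 19 \in cells0)%N f7)).
apply: run_rset => /=; split.
- move: m1c m2c m4c m5c m6c m7c => /=; lia.
- exact: frame_rupd.
- by move=> i /=; rewrite f7.2.
- by move=> b j ba /=; rewrite f7.2// h5'// f5.2.
- by rewrite /= h19 f7.2// h11.
Qed.

End SolveRow.

Section Solve.
Context {R : realType} {A S : nat}.
Variables (g y' y0 : 'M[R]_(A, S)) (alpha eps D eta : R) (k : nat).
Hypotheses (hk : forall j, (j < k)%N -> eta <= 2^-1 ^+ j) (hk' : 2^-1 ^+ k < eta).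
Implicit Types st s : state R.

Let c a i := g a i + y' a i.

Definition solution (lam : R) (a : 'I_A) : 'I_S -> R := yrow (y0 a) (c a) lam D k.

Definition solve_cells := [:: 5; 11; 12; 13; 14; 15; 16; 18; 19]%N.

Lemma run_solve lam st : row_env g y' y0 alpha eps lam D eta st ->
  run solve st (fun m s =>
    [/\ (m <= A * ((k + 4) * (S * 60 + 200) + 9) + 20)%N,
      frame [:: 2; 3]%N solve_cells st s,
      forall (a : 'I_A) (i : 'I_S), rmem s 5 a i = solution lam a i
    & rmem s 11 0 0 = ktot y0 (solution lam)]).
Proof.
move=> env; apply: run_seq; apply: run_rset => /=.
set st1 := rupd _ _ _ _ _.
have f1 : frame [:: 2; 3]%N solve_cells st st1 by apply: frame_rupd.
have envf s : frame [:: 2; 3]%N solve_cells st s -> row_env g y' y0 alpha eps lam D eta s.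
  by move=> f; exact: env_frame f env.
have [[_ sA _ _ _] _ _ _] := envf _ f1.
apply: run_weaken (run_for (i := 2) (v := 1) (cost := (k + 4) * (S * 60 + 200))
  (Inv := fun j s => [/\ frame [:: 2; 3]%N solve_cells st s,
    forall (a : 'I_A) (i : 'I_S), (a < j)%N -> rmem s 5 a i = solution lam a i
    & rmem s 11 0 0 = \sum_(a < A | (a < j)%N) klr (solution lam a) (y0 a)])
  _ sA _ _) _ => //.
- by split=> //; [apply: frame_nupd | rewrite big_pred0].
- move=> a s sv si [f h5 h11].
  apply: run_weaken (run_solve_row hk hk' (envf _ f) si) _.
  move=> m s' [mc f' h5' h5'' h11'].
  have f'' : frame [:: 2; 3]%N solve_cells st s'.
    by apply: frame_trans f _; apply: frame_sub f' => // x; rewrite !inE => ->; rewrite orbT.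
  split=> //; [by rewrite f'.1 | by rewrite f'.1 | split].
  + exact: frame_nupd.
  + move=> b i /=; rewrite ltnS leq_eqVlt => /orP[/eqP/val_inj-> //|ba].
    by rewrite h5''; [exact: h5 | rewrite ltn_eqF].
  + by rewrite /= h11' h11 sum_ord_lt.
- move=> m s [mc [f h5 h11]]; split=> //; first by lia.
    by move=> a i; rewrite h5.
  by rewrite h11; apply: eq_bigl => a; rewrite ltn_ord.
Qed.

Variables (G e : R).
Hypotheses (hy0 : forall a, distr (y0 a))
  (hy' : feasible y0 alpha y') (G_ge0 : 0 <= G) (hg : forall a i, `|g a i| <= G)
  (hD : 2 * G + 4 <= D) (e_gt0 : 0 < e) (eD : 2 * e * D <= 1)
  (eta_le : eta <= e ^+ 6).

Lemma solution_solves lam : e <= lam -> solves y0 c e lam (solution lam).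
Proof.
move=> el; have l0 : 0 < lam by exact: lt_le_trans el.
have hc a i : - G <= c a i <= G + 1.
  have [hya _ _] := hy'; have := hg a i; rewrite ler_norml /c.
  by have := (hya a).1 i; have := distr_le1 i (hya a); lra.
split=> a; [exact: yrow_distr | exact: yrow_abscont | ].
have hk6 : 2^-1 ^+ k <= e ^+ 6 by apply: le_trans eta_le; exact: ltW.
have [n1 n2 n3] := yrow_resid (hy0 a) l0 G_ge0 (hc a) hD e_gt0 eD el hk6.
exists (nrow (y0 a) (c a) lam (mu_hat (y0 a) (c a) lam D k)),
  (mu_hat (y0 a) (c a) lam D k + lam * ln (nrow (y0 a) (c a) lam (mu_hat (y0 a) (c a) lam D k))).
by split=> //; [apply/andP | exact: yrow_expR].
Qed.

End Solve.

(* Further cells: 7 max g^2, 20 variance of g, 21 row means, 22 and 23 the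
   bracket of lambda, 24 the divergence at its upper end, 26 the mixing weight;
   array 6 keeps the point computed at the upper end. *)
Definition sq (e : rexpr) : rexpr := RMul e e.

Definition max_g_loop : cmd :=
  for_loop 2 1 (for_loop 3 0
    (If (BRLe (cell 7) (sq (entry 0))) (rset 7 (sq (entry 0))) Skip)).

Definition variance_loop : cmd :=
  for_loop 2 1 (Seq (row_sum 21 (RMul (entry 2) (entry 0)))
    (Seq (row_sum 19 (RMul (entry 2) (sq (RSub (entry 0) (cell 21)))))
      (rset 20 (RAdd (cell 20) (cell 19))))).

Definition bisect_lambda : cmd :=
  Seq (rset 10 (rhalf (RAdd (cell 22) (cell 23))))
    (Seq solve (If (BRLe (cell 11) (cell 3)) (rset 23 (cell 10)) (rset 22 (cell 10)))).

Definition l2_prog : cmd :=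
  Seq (rset 7 (rnat 0))
  (Seq max_g_loop
  (Seq (rset 20 (rnat 0))
  (Seq variance_loop
  (Seq (rset 8 (RAdd (cell 7) (rnat 5)))
  (Seq (rset 9 (RDiv (cell 4) (RMul (rnat 2) (RAdd (cell 8) (cell 3)))))
  (Seq (rset 17 (RPow (cell 9) (rnat 6)))
  (Seq (rset 22 (RPow (RDiv (cell 20) (RMul (rnat 2) (cell 3))) (rhalf (rnat 1))))
  (Seq (rset 23 (RAdd (cell 22) (RMul (rnat 8) (cell 8))))
  (Seq (If (BRLe (RMul (rnat 16) (cell 8)) (cell 22))
          (rset 22 (RSub (cell 22) (RMul (rnat 8) (cell 8)))) (rset 22 (cell 9)))
  (Seq (While (BRLe (cell 9) (RSub (cell 23) (cell 22))) bisect_lambda)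
  (Seq (rset 10 (cell 23))
  (Seq solve
  (Seq (rset 24 (cell 11))
  (Seq (for_loop 2 1 (fill_loop 6 2 3 0 (entry 5)))
  (Seq (rset 10 (cell 22))
  (Seq solve
  (Seq (If (BRLe (cell 11) (cell 3)) (rset 26 (rnat 1))
          (rset 26 (RDiv (RSub (cell 3) (cell 24)) (RSub (cell 11) (cell 24)))))
    (for_loop 2 1 (fill_loop 5 2 3 0
      (RAdd (RMul (RSub (rnat 1) (cell 26)) (entry 6))
            (RMul (cell 26) (entry 5)))))))))))))))))))))).

Section L2Run.
Context {R : realType} {A S : nat}.
Variables (g y' y0 : 'M[R]_(A, S)) (alpha eps : R).
Implicit Types st s : state R.

Local Notation data := (data_in g y' y0 alpha eps).

(** The last clause, minimality, is how the bound [M] reaches the analysis: it yields a computed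
    value at most [M ^+ 2]. *)
Lemma run_max_g st : data st -> rmem st 7 0 0 = 0 ->
  run max_g_loop st (fun m s =>
    [/\ (m <= A * (S * 35 + 20) + 7)%N, frame [:: 2; 3]%N [:: 7]%N st s,
      0 <= rmem s 7 0 0, forall a i, g a i ^+ 2 <= rmem s 7 0 0
    & forall B, 0 <= B -> (forall a i, g a i ^+ 2 <= B) -> rmem s 7 0 0 <= B]).
Proof.
move=> hd h7; have [_ sA _ _ _] := hd.
have df s : frame [:: 2; 3]%N [:: 7]%N st s -> data s by move=> f; exact: data_frame f _ _ hd.
apply: run_weaken (run_for (i := 2) (v := 1) (cost := S * 35 + 10)
  (Inv := fun j s => [/\ frame [:: 2; 3]%N [:: 7]%N st s,
      0 <= rmem s 7 0 0, forall (a : 'I_A) (i : 'I_S), (a < j)%N -> g a i ^+ 2 <= rmem s 7 0 0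
    & forall B, 0 <= B -> (forall a i, g a i ^+ 2 <= B) -> rmem s 7 0 0 <= B])
  _ sA _ _) _ => //.
- by split=> //=; rewrite ?h7//; apply: frame_nupd.
- move=> a s sv si [f p0 ub mx]; have [sS _ _ _ _] := df _ f.
  apply: run_weaken (run_for (i := 3) (v := 0) (cost := 25)
    (Inv := fun j s' => [/\ frame [:: 3]%N [:: 7]%N s s',
      rmem s 7 0 0 <= rmem s' 7 0 0,
      forall i : 'I_S, (i < j)%N -> g a i ^+ 2 <= rmem s' 7 0 0
    & forall B, 0 <= B -> (forall a i, g a i ^+ 2 <= B) -> rmem s' 7 0 0 <= B])
    _ sS _ _) _ => //.
  + by split=> //; apply: frame_nupd.
  + move=> i s1 sv1 si1 [f1 le1 ub1 mx1].
    have f1' : frame [:: 2; 3]%N [:: 7]%N st s1.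
      by apply: frame_trans f _; apply: frame_sub f1 => // x; rewrite !inE => ->; rewrite orbT.
    have [_ _ h _ _] := df _ f1'; have [h0 _ _] := h a i.
    have s12 : nmem s1 2 = a by rewrite f1.1.
    apply: run_if => /=; rewrite s12 si1 h0 -expr2 => test.
      apply: run_rset => /=; split=> //; rewrite s12 si1 h0 -expr2; split.
      * by apply: frame_nupd => //; exact: frame_rupd.
      * exact: le_trans le1 test.
      * move=> j /=; rewrite ltnS leq_eqVlt => /orP[/eqP/val_inj-> //|ji].
        exact: le_trans (ub1 _ ji) test.
      * by move=> B B0 hB /=; exact: hB.
    apply: run_skip; split=> //; split=> //; first exact: frame_nupd.
    move=> j /=; rewrite ltnS leq_eqVlt => /orP[/eqP/val_inj->|ji]; last exact: ub1.
    by move: test; rewrite -ltNge => /ltW.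
  + move=> m s1 [mc [f1 le1 ub1 mx1]].
    have f1' : frame [:: 2; 3]%N [:: 7]%N st s1.
      by apply: frame_trans f _; apply: frame_sub f1 => // x; rewrite !inE => ->; rewrite orbT.
    split; [by lia | by rewrite f1.1 | by rewrite f1.1 | split=> //=].
    * exact: frame_nupd.
    * exact: le_trans p0 le1.
    * move=> b i; rewrite ltnS leq_eqVlt => /orP[/eqP/val_inj->|ba]; first exact: ub1.
      exact: le_trans (ub _ _ ba) le1.
- move=> m s [mc [f p0 ub mx]]; split=> //; first by lia.
  by move=> a i; exact: ub.
Qed.

Lemma run_variance st : data st -> rmem st 20 0 0 = 0 ->
  run variance_loop st (fun m s =>
    [/\ (m <= A * (S * 60 + 60) + 7)%N, frame [:: 2; 3]%N [:: 19; 20; 21]%N st s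
    & rmem s 20 0 0 = \sum_a \sum_i y0 a i * cen y0 g a i ^+ 2]).
Proof.
move=> hd h20; have [_ sA _ _ _] := hd.
have df s : frame [:: 2; 3]%N [:: 19; 20; 21]%N st s -> data s.
  by move=> f; exact: data_frame f _ _ hd.
apply: run_weaken (run_for (i := 2) (v := 1) (cost := S * 60 + 50)
  (Inv := fun j s => frame [:: 2; 3]%N [:: 19; 20; 21]%N st s /\
    rmem s 20 0 0 = \sum_(a < A | (a < j)%N) \sum_i y0 a i * cen y0 g a i ^+ 2)
  _ sA _ _) _ => //.
- by split; [exact: frame_nupd | rewrite big_pred0].
- move=> a s sv si [f h]; have [sS _ _ _ _] := df _ f.
  apply: run_seq; apply: run_weaken (run_sum (acc := 21) (F := fun i => y0 a i * g a i)
    (erefl : 3 != 0)%N sS _) _.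
    move=> i s1 f1 s13 /=.
    have f1' : frame [:: 2; 3]%N [:: 19; 20; 21]%N st s1.
      by apply: frame_trans f _; apply: frame_sub f1 => // x; rewrite !inE => ->; rewrite !orbT.
    have [_ _ hh _ _] := df _ f1'; have [-> _ ->] : [/\ rmem s1 0 (nmem s1 2) (nmem s1 3) = g a i,
       rmem s1 1 (nmem s1 2) (nmem s1 3) = y' a i & rmem s1 2 (nmem s1 2) (nmem s1 3) = y0 a i] by
       rewrite s13 f1.1// si; exact: hh.
    by [].
  move=> m1 s1 [m1c f1 h21].
  have f1' : frame [:: 2; 3]%N [:: 19; 20; 21]%N st s1.
    by apply: frame_trans f _; apply: frame_sub f1 => // x; rewrite !inE => ->; rewrite !orbT.
  have [sS1 _ _ _ _] := df _ f1'.
  apply: run_seq; apply: run_weaken (run_sum (acc := 19)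
    (F := fun i => y0 a i * cen y0 g a i ^+ 2) (erefl : 3 != 0)%N sS1 _) _.
    move=> i s2 f2 s23 /=.
    have f2' : frame [:: 2; 3]%N [:: 19; 20; 21]%N st s2.
      by apply: frame_trans f1' _; apply: frame_sub f2 => // x; rewrite !inE => ->; rewrite ?orbT.
    have [_ _ hh _ _] := df _ f2'; have [-> _ ->] : [/\ rmem s2 0 (nmem s2 2) (nmem s2 3) = g a i,
       rmem s2 1 (nmem s2 2) (nmem s2 3) = y' a i & rmem s2 2 (nmem s2 2) (nmem s2 3) = y0 a i] by
       rewrite s23 f2.1// f1.1// si; exact: hh.
    by rewrite f2.2// h21.
  move=> m2 s2 [m2c f2 h19].
  have f2' : frame [:: 2; 3]%N [:: 19; 20; 21]%N st s2.
    by apply: frame_trans f1' _; apply: frame_sub f2 => // x; rewrite !inE => ->; rewrite ?orbT.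
  apply: run_rset => /=; split.
  + by move: m1c m2c => /=; lia.
  + by rewrite f2.1// f1.1.
  + by rewrite f2.1// f1.1.
  + split; first by apply: frame_nupd => //; exact: frame_rupd.
    by rewrite /= h19 f2.2// f1.2// h sum_ord_lt.
- move=> m s [mc [f ->]]; split=> //; first by lia.
  by apply: eq_bigl => a; rewrite ltn_ord.
Qed.

Lemma run_fill_rows out e (F : 'I_A -> 'I_S -> R) st : (4 < out)%N -> (rcost e <= 40)%N ->
  data st ->
  (forall (a : 'I_A) (i : 'I_S) s, frame [:: 2; 3]%N [:: out] st s -> nmem s 2 = a -> nmem s 3 = i ->
     rmem s out a i = rmem st out a i -> reval s e = F a i) ->
  run (for_loop 2 1 (fill_loop out 2 3 0 e)) st (fun m s =>
    [/\ (m <= A * (S * 52 + 20) + 7)%N, frame [:: 2; 3]%N [:: out] st s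
    & forall (a : 'I_A) (i : 'I_S), rmem s out a i = F a i]).
Proof.
move=> ho he hd eF; have [_ sA _ _ _] := hd.
have df s : frame [:: 2; 3]%N [:: out] st s -> data s.
  by move=> f; apply: data_frame f _ _ hd => //=; rewrite ho.
apply: run_weaken (run_for (i := 2) (v := 1) (cost := S * 52 + 10)
  (Inv := fun j s => [/\ frame [:: 2; 3]%N [:: out] st s,
     forall (a : 'I_A) (i : 'I_S), (a < j)%N -> rmem s out a i = F a i
   & forall (a : 'I_A) (i : 'I_S), (j <= a)%N -> rmem s out a i = rmem st out a i])
  _ sA _ _) _ => //.
- by split=> //; exact: frame_nupd.
- move=> a s sv si [f lt ge]; have [sS _ _ _ _] := df _ f.
  have sub s1 : frame [:: 3]%N [:: out] s s1 -> frame [:: 2; 3]%N [:: out] st s1.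
    by move=> f1; apply: frame_trans f _; apply: frame_sub f1 => // x; rewrite !inE => ->; rewrite orbT.
  apply: run_weaken (run_fill (F := F a) (erefl : 3 != 0)%N (erefl : 2 != 3)%N sS _) _.
    move=> i s1 f1 s13 h1; apply: eF => //; [exact: sub | by rewrite f1.1 | ].
    by move: h1; rewrite si => ->; exact: ge.
  rewrite si => m s1 [mc f1 h1 h2]; split; [ | by rewrite f1.1 | by rewrite f1.1 | split].
  + by apply: (leq_trans mc); have := leq_mul2l S (rcost e + 12) 52; lia.
  + by apply: frame_nupd => //; exact: sub.
  + move=> b i; rewrite ltnS leq_eqVlt => /orP[/eqP/val_inj->|ba]; first exact: h1.
    by rewrite /= h2 ?lt//; rewrite ltn_eqF.
  + by move=> b i ab; rewrite /= h2 ?ge//; [exact: ltnW | rewrite gtn_eqF].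
- move=> m s [mc [f lt _]]; split=> //; first by lia.
  by move=> a i; exact: lt.
Qed.

End L2Run.

Lemma half_le_ln2 {R : realType} : 2^-1 <= ln (2 : R).
Proof.
rewrite -ler_expR lnK ?posrE//.
by have := expR_quad_ub (lexx (2^-1 : R)); lra.
Qed.

(** The factor 2 comes from [half_le_ln2]; [k] is the first exponent at which [2^-1 ^+ k] drops
    below [x]. *)
Lemma exists_halving {R : realType} (x : R) : 0 < x <= 1 ->
  exists k : nat, [/\ forall j, (j < k)%N -> x <= 2^-1 ^+ j, 2^-1 ^+ k < x
    & k%:R <= 1 + 2 * ln x^-1].
Proof.
move=> /andP[x0 x1].
have ex : exists k, 2^-1 ^+ k < x.
  exists (Num.bound x^-1).
  have b := archi_boundP (ltW (_ : 0 < x^-1)); have {}b := b _; have {}b : x^-1 < (Num.bound x^-1)%:R.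
    by apply: b; rewrite invr_gt0.
  rewrite exprVn invf_plt ?posrE ?exprn_gt0//; apply: (lt_trans b).
  by rewrite -natrX ltr_nat; exact: ltn_expl.
have [k kx mink] := ex_minnP ex.
have lt j : (j < k)%N -> x <= 2^-1 ^+ j.
  by move=> jk; rewrite leNgt; apply/negP => /mink; lia.
exists k; split=> //.
have l0 : 0 <= ln x^-1 by rewrite ln_ge0// invf_ge1.
case: k lt {kx mink} => [_|k lt]; first by rewrite addr_ge0// mulr_ge0.
have := lt k (ltnSn k); rewrite exprVn -[leLHS]invrK lef_pV2 ?posrE ?invr_gt0 ?exprn_gt0//.
rewrite -ler_ln ?posrE ?invr_gt0 ?exprn_gt0// lnXn// -[_ *+ k]mulr_natr => h.
have l2 := @half_le_ln2 R.
by have := ler_wpM2r (ler0n R k) l2; rewrite -[k.+1]addn1 natrD; lra.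
Qed.

(** * Correctness and cost of the l2 program *)

Section L2.
Context {R : realType} {A S : nat}.
Variables (g y' y0 : 'M[R]_(A, S)) (alpha eps : R).
Hypotheses (A_gt0 : (0 < A)%N) (S_gt0 : (0 < S)%N)
  (hy0 : forall a, distr (y0 a)) (alpha_gt0 : 0 < alpha)
  (hy' : feasible y0 alpha y') (eps_gt0 : 0 < eps) (eps_le : eps <= 2^-1).
Implicit Types st s : state R.

Let c a i := g a i + y' a i.

(** Chosen so that [2 * e * (D + alpha) = eps] with [D = v + 5]. This gives both [2 * e * D <= 1]
    for the rows and [2 * e * alpha <= eps] for the total loss. *)
Definition l2_width (v : R) : R := eps / (2 * (v + 5 + alpha)).

Section Fixed.
Variables (v : R) (k : nat).
Hypotheses (v_ge0 : 0 <= v) (hv : forall a i, g a i ^+ 2 <= v).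
Let D := v + 5.
Let e := l2_width v.
Hypotheses (hk : forall j, (j < k)%N -> e ^+ 6 <= 2^-1 ^+ j) (hk' : 2^-1 ^+ k < e ^+ 6).

Let e_gt0 : 0 < e.
Proof. by have := alpha_gt0; have := v_ge0 => *; rewrite divr_gt0 ?eps_gt0//; lra. Qed.

Let eDa : 2 * e * (D + alpha) = eps.
Proof.
have := alpha_gt0; have := v_ge0 => v0 a0.
by rewrite /e /l2_width /D; field; rewrite gt_eqF//; lra.
Qed.

Let eD : 2 * e * D <= 1.
Proof.
have := eDa; have := eps_le; have e0 := e_gt0; have a0 := alpha_gt0.
by have : 0 <= e * alpha by [rewrite mulr_ge0 ?ltW]; lra.
Qed.

Let e_le : e <= 2^-1.
Proof.
have := eD; have e0 := e_gt0; have v0 := v_ge0; rewrite /D.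
by have : 0 <= e * v by [rewrite mulr_ge0// ltW]; lra.
Qed.

(** Dominates [|g|] through [2 * |g| <= g ^+ 2 + 1], and makes [2 * G + 4] equal to [D]. *)
Let G := (v + 1) / 2.

Let G_ge0 : 0 <= G. Proof. by have := v_ge0; rewrite /G; lra. Qed.

Let hg a i : `|g a i| <= G.
Proof.
have := hv a i; rewrite -real_normK ?num_real// /G.
by have := sqr_ge0 (`|g a i| - 1); lra.
Qed.

Let hD : 2 * G + 4 <= D. Proof. by rewrite le_eqVlt; apply/orP; left; apply/eqP; rewrite /G /D; field. Qed.

Let sol := solution g y' y0 D k.

Let sol_solves lam : e <= lam -> solves y0 c e lam (sol lam).
Proof.
exact: (solution_solves hk' hy0 hy' G_ge0 hg hD e_gt0 eD (lexx _)).
Qed.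

Let l0 := lam0 y0 g alpha.
(** For large [l0], [ktot_below] guarantees an infeasible lower end. Otherwise [e] is taken, which
    may be feasible but is then so small that its duality gap is acceptable. The bracket has length
    at most [24 * D] in both cases. *)
Definition l2_lo : R := if 16 * D <= l0 then l0 - 8 * D else e.
Definition l2_hi : R := l0 + 8 * D.

Let l0_ge0 : 0 <= l0. Proof. exact: sqrtr_ge0. Qed.

Lemma l2_lo_ge : e <= l2_lo.
Proof.
rewrite /l2_lo; case: ifP => // h; have := e_le; have := v_ge0; move: h; rewrite /D; lra.
Qed.

Lemma l2_bracket_width : e <= l2_hi - l2_lo <= 24 * D.
Proof.
have e0 := e_gt0; have e1 := e_le; have v0 := v_ge0; have l00 := l0_ge0.
rewrite /l2_hi /l2_lo; case: ifP => [h|/negbT].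
  by apply/andP; split; rewrite /D; lra.
by rewrite -ltNge => h; move: h; rewrite /D => h; apply/andP; split; lra.
Qed.

Lemma l2_hi_feasible : ktot y0 (sol l2_hi) <= alpha.
Proof.
have e0 : 0 <= e by exact: ltW e_gt0.
have eh : e <= l2_hi.
  by have := l2_lo_ge; have := e_gt0; have /andP[? _] := l2_bracket_width; lra.
by apply: (ktot_above hy0 alpha_gt0 G_ge0 hg hD e0 e_le hy' (sol_solves eh)).
Qed.

Lemma l2_lo_infeasible : l2_lo = e \/ alpha < ktot y0 (sol l2_lo).
Proof.
have e0 : 0 <= e by exact: ltW e_gt0.
have := sol_solves l2_lo_ge; rewrite /l2_lo; case: ifP => [h s|_ _]; [right|by left].
exact: (ktot_below hy0 alpha_gt0 G_ge0 hg hD e0 e_le hy' s).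
Qed.

Definition l2_weight (lo hi : R) : R :=
  if ktot y0 (sol lo) <= alpha then 1
  else (alpha - ktot y0 (sol hi)) / (ktot y0 (sol lo) - ktot y0 (sol hi)).

(** A feasible lower end must be [e], and its slack costs at most [e * alpha], so its point is
    returned alone. Otherwise [mix_gap] applies. In both cases the loss is at most
    [e * alpha + e ^+ 2 / 2 * alpha]. *)
Lemma l2_output_correct lo hi : e <= lo -> lo <= hi -> hi - lo <= e ->
  ktot y0 (sol hi) <= alpha -> (lo = e \/ alpha < ktot y0 (sol lo)) ->
  let y := mix (l2_weight lo hi) (sol hi) (sol lo) in
  feasible y0 alpha y /\
  forall x, feasible y0 alpha x -> ftot c x <= ftot c y + eps.
Proof.
move=> elo lohi hilo Fhi Flo y.
have e0 := e_gt0; have e1 := e_le; have a0 := alpha_gt0; have v0 := v_ge0.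
have ea : 2 * (e * alpha) <= eps.
  by rewrite -eDa; have : 0 <= e * D by [rewrite mulr_ge0 ?ltW// /D; lra]; lra.
have eea : e ^+ 2 / 2 * alpha <= e * alpha.
  rewrite ler_wpM2r ?(ltW a0)//.
  by have : e * e <= e * 2^-1 by [rewrite ler_wpM2l// ltW]; lra.
have elh : e <= hi by exact: le_trans lohi.
have slo := sol_solves elo; have shi := sol_solves elh.
have lo0 : 0 < lo by exact: lt_le_trans elo.
rewrite /y /l2_weight; case: ifPn => [h|].
  have loe : lo = e by case: Flo => // h2; move: h; rewrite leNgt h2.
  have me : mix 1 (sol hi) (sol lo) = sol lo.
    by apply/funext => a; apply/funext => i; rewrite /mix; ring.
  rewrite me; have [d q _] := slo; split; first by split.
  move=> x hx; have := solves_gap hy0 lo0 slo hx.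
  have K0 := ktot_ge0 hy0 d q.
  have h1 : lo * (alpha - ktot y0 (sol lo)) <= e * alpha.
    by rewrite loe ler_pM2l// gerBl -loe.
  have h2 : e ^+ 2 / 2 * ktot y0 (sol lo) <= e ^+ 2 / 2 * alpha.
    by rewrite ler_wpM2l// divr_ge0// sqr_ge0.
  by lra.
rewrite -ltNge => h.
have FF : ktot y0 (sol hi) <= alpha < ktot y0 (sol lo) by rewrite Fhi.
have mg x := mix_gap hy0 lo0 lohi shi slo FF erefl (x := x).
split; first by have [] := mg _ hy'.
move=> x /mg[_ h1]; apply: (le_trans h1).
have : alpha * (hi - lo) <= alpha * e by rewrite ler_pM2l.
by lra.
Qed.

End Fixed.

Local Notation data := (data_in g y' y0 alpha eps).

Let big := iota 5 30.

Lemma run_l2 st : data st ->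
  run l2_prog st (fun m s => exists (v : R) (k J : nat),
    [/\ 0 <= v, forall B, 0 <= B -> (forall a i, g a i ^+ 2 <= B) -> v <= B,
      k%:R <= 1 + 2 * ln (l2_width v ^+ 6)^-1,
      J%:R <= 1 + 2 * ln (24 * (v + 5) / l2_width v) &
      [/\ (m <= 1000 * (A * S) * ((k + 4) * (J + 4)))%N,
        feasible y0 alpha (fun a i => rmem s 5 (val a) (val i)) &
        forall x, feasible y0 alpha x ->
          ftot c x <= ftot c (fun a i => rmem s 5 (val a) (val i)) + eps]]).
Proof.
move=> hd; have df s xs ys : frame xs ys st s -> all (leq 2) xs -> all (leq 5) ys -> data s.
  by move=> f h1 h2; exact: data_frame f h1 h2 hd.
pose fr := @frame R [:: 2; 3]%N big.
have sub ys s s' : all (mem big) ys -> frame [:: 2; 3]%N ys s s' -> fr s s'.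
  by move=> /allP h; apply: frame_sub => // x /h.
have drf s : fr st s -> data s by move=> f; exact: df f _ _.
apply: run_seq; apply: run_rset => /=.
set st1 := rupd _ _ _ _ _.
have f1 : fr st st1 by exact: frame_rupd.
apply: run_seq; apply: run_weaken (run_max_g (drf _ f1) (erefl _)) _.
move=> m1 s1 [m1c f2 v0 hv vmin]; set v := rmem s1 7 0 0 in v0 hv vmin.
have {}f2 : fr st s1 by apply: frame_trans f1 _; exact: sub f2.
apply: run_seq; apply: run_rset => /=.
set st2 := rupd _ _ _ _ _.
have f3 : fr st st2 by exact: frame_rupd.
apply: run_seq; apply: run_weaken (run_variance (drf _ f3) (erefl _)) _.
move=> m2 s2 [m2c f4 h20].
have s2v : rmem s2 7 0 0 = v by rewrite f4.2.
have {}f4 : fr st s2 by apply: frame_trans f3 _; exact: sub f4.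
have [_ _ _ s2a s2e] := drf _ f4.
do 5 (apply: run_seq; apply: run_rset => /=).
rewrite s2v s2a s2e h20.
pose D := v + 5; pose e := l2_width v; pose l0 := lam0 y0 g alpha.
have e_gt0 : 0 < e by rewrite divr_gt0 ?eps_gt0//; have := alpha_gt0; lra.
have eE : eps / (2 * (v + 5 + alpha)) = e by [].
have l0E : ((\sum_a \sum_i y0 a i * cen y0 g a i ^+ 2) / (2 * alpha)) `^ (1 / 2) = l0.
  have al0 := alpha_gt0.
  rewrite -sqr_nm// div1r powR12_sqrt//.
  by rewrite divr_ge0 ?sqr_ge0//; lra.
have etaE : e `^ 6 = e ^+ 6 by rewrite powR_mulrn// ltW.
rewrite eE etaE l0E -/D.
set s3 := rupd _ _ _ _ _.
have f5 : fr st s3 by do 5 apply: frame_rupd => //.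
have e_small : e <= 8^-1.
  rewrite /e /l2_width ler_pdivrMr; last by have := alpha_gt0; lra.
  by have := alpha_gt0; have := eps_le; lra.
have [k [hk hk' kb]] : exists k : nat, [/\ forall j, (j < k)%N -> e ^+ 6 <= 2^-1 ^+ j,
   2^-1 ^+ k < e ^+ 6 & k%:R <= 1 + 2 * ln (e ^+ 6)^-1].
  apply: exists_halving; rewrite exprn_gt0//= exprn_ile1//; lra.
pose lo0 := l2_lo v; pose hi0 := l2_hi v; pose w0 := hi0 - lo0.
have /andP[w_ge w_le] : e <= w0 <= 24 * D := l2_bracket_width v0.
have w_gt0 : 0 < w0 by exact: lt_le_trans w_ge.
have [J [hJ hJ' Jb]] : exists J : nat, [/\ forall j, (j < J)%N -> e / w0 <= 2^-1 ^+ j,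
   2^-1 ^+ J < e / w0 & J%:R <= 1 + 2 * ln (e / w0)^-1].
  by apply: exists_halving; rewrite divr_gt0//= ler_pdivrMr// mul1r.
pose sol := solution g y' y0 D k.
apply: run_seq.
apply: (@run_weaken _ _ _ (fun m s => [/\ (m <= 30)%N, frame [:: 2; 3]%N [:: 22]%N s3 s
  & rmem s 22 0 0 = lo0])).
  apply: run_if => /=; rewrite -/l0 => h; apply: run_rset => /=; split=> //; try exact: frame_rupd.
    by rewrite /lo0 /l2_lo -/l0 -/D h.
  by rewrite /lo0 /l2_lo -/l0 -/D (negbTE h).
move=> m3 s4 [m3c f6 h22].
have h23 : rmem s4 23 0 0 = hi0 by rewrite f6.2.
have h8 : rmem s4 8 0 0 = D by rewrite f6.2.
have h9 : rmem s4 9 0 0 = e by rewrite f6.2.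
have h17 : rmem s4 17 0 0 = e ^+ 6 by rewrite f6.2.
have {}f6 : fr st s4 by apply: frame_trans f5 _; exact: sub f6.
pose lc := [:: 10; 22; 23]%N ++ solve_cells.
have solve_env s lam : frame [:: 2; 3]%N ([:: 6; 24]%N ++ lc) s4 s -> rmem s 10 0 0 = lam ->
    row_env g y' y0 alpha eps lam D (e ^+ 6) s.
  move=> f h; split=> //; rewrite ?f.2//.
  by apply: drf; apply: frame_trans f6 _; exact: sub f.
have sub2 ys s s' : all (mem ([:: 6; 24]%N ++ lc)) ys -> frame [:: 2; 3]%N ys s s' ->
    frame [:: 2; 3]%N ([:: 6; 24]%N ++ lc) s s'.
  by move=> /allP h; apply: frame_sub => // x /h.
set cs := (A * ((k + 4) * (S * 60 + 200) + 9) + 20)%N.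
apply: run_seq.
apply: run_weaken (run_while (J := J) (cost := cs + 40) (Inv := fun j s =>
  [/\ (j <= J)%N, frame [:: 2; 3]%N lc s4 s & exists lo hi,
    [/\ rmem s 22 0 0 = lo, rmem s 23 0 0 = hi, hi - lo = w0 * 2^-1 ^+ j &
     [/\ e <= lo, ktot y0 (sol hi) <= alpha & lo = e \/ alpha < ktot y0 (sol lo)]]]) _ _) _.
- split=> //; exists lo0, hi0; split=> //; first by rewrite expr0 mulr1.
  split; [exact: (l2_lo_ge v0) | exact: (l2_hi_feasible v0 hv hk') |
    exact: (l2_lo_infeasible v0 hv hk')].
- move=> j s [jJ f [lo [hi [slo shi hw [elo Fhi Flo]]]]] /=.
  rewrite shi slo f.2// h9 hw => guard.
  have jJ' : (j < J)%N.
    rewrite ltn_neqAle jJ andbT; apply/eqP => jE; move: guard.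
    by rewrite jE leNgt mulrC -ltr_pdivlMr// hJ'.
  split=> //.
  have lohi : lo <= hi.
    by rewrite -subr_ge0 hw mulr_ge0 ?(ltW w_gt0)// exprn_ge0.
  apply: run_seq; apply: run_rset => /=; rewrite slo shi.
  set mid := (_ + _) / _; set s5 := rupd _ _ _ _ _.
  have f5' : frame [:: 2; 3]%N lc s4 s5 by exact: frame_rupd.
  apply: run_seq; apply: run_weaken (run_solve hk hk' (solve_env _ mid _ _)) _ => //.
    exact: sub2 f5'.
  move=> m4 s6 [m4c f7 _ h11].
  have f7' : frame [:: 2; 3]%N lc s4 s6.
    apply: frame_trans f5' _; apply: frame_sub f7 => // x; rewrite !inE => hx.
    by rewrite hx !orbT.
  have h10 : rmem s6 10 0 0 = mid by rewrite f7.2.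
  have h3 : rmem s6 3 0 0 = alpha.
    have /drf[] : fr st s6 by apply: frame_trans f6 _; exact: sub f7'.
    by [].
  have k22 : rmem s6 22 0 0 = lo by rewrite f7.2.
  have k23 : rmem s6 23 0 0 = hi by rewrite f7.2.
  have emid : e <= mid by rewrite ler_pdivlMr// mulr_natr mulr2n lerD// (le_trans elo).
  have hw2 : mid - lo = w0 * 2^-1 ^+ j.+1 by rewrite exprS mulrCA -hw /mid; field.
  have hw3 : hi - mid = w0 * 2^-1 ^+ j.+1 by rewrite exprS mulrCA -hw /mid; field.
  apply: run_if => /=; rewrite h11 h3 => test; apply: run_rset => /=; rewrite h10; split.
  + by move: m4c; rewrite -/cs; clear; lia.
  + split=> //; first exact: frame_rupd.
    by exists lo, mid; split.
  + by move: m4c; rewrite -/cs; clear; lia.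
  + split=> //; first exact: frame_rupd.
    exists mid, hi; split; [by [] | exact: k23 | exact: hw3 | ].
    by split; [exact: emid | exact: Fhi | right; rewrite ltNge].
move=> m5 s5 [/= m5c [j [[jJ f7 [lo [hi [slo shi hw [elo Fhi Flo]]]]]]]].
rewrite slo shi f7.2// h9 -ltNge => hwe.
have lohi : lo <= hi.
  by rewrite -subr_ge0 hw mulr_ge0 ?(ltW w_gt0)// exprn_ge0.
have f7s : frame [:: 2; 3]%N ([:: 6; 24]%N ++ lc) s4 s5 by exact: sub2 f7.
(* The bisection keeps the bracket but not the points of its ends, so both ends are solved again. *)
apply: run_seq; apply: run_rset => /=; rewrite shi.
set s6 := rupd _ _ _ _ _.
have f8 : frame [:: 2; 3]%N ([:: 6; 24]%N ++ lc) s4 s6 by exact: frame_rupd.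
apply: run_seq; apply: run_weaken (run_solve hk hk' (solve_env _ hi f8 (erefl _))) _.
move=> m6 s7 [m6c f9 h5 h11].
have {}slo : rmem s7 22 0 0 = lo by rewrite f9.2.
have {}f9 : frame [:: 2; 3]%N ([:: 6; 24]%N ++ lc) s4 s7.
  by apply: frame_trans f8 _; exact: sub2 f9.
apply: run_seq; apply: run_rset => /=; rewrite h11.
set s8 := rupd _ _ _ _ _.
have f10 : frame [:: 2; 3]%N ([:: 6; 24]%N ++ lc) s4 s8 by exact: frame_rupd.
have d8 : data s8 by apply: drf; apply: frame_trans f6 _; exact: sub f10.
apply: run_seq; apply: run_weaken (run_fill_rows (out := 6) (e := entry 5) (F := sol hi) _ _ d8 _) _ => //.
  by move=> a i s f sa si _ /=; rewrite sa si f.2//= h5.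
move=> m7 s9 [m7c f11 h6].
have h24 : rmem s9 24 0 0 = ktot y0 (sol hi) by rewrite f11.2.
have {}slo : rmem s9 22 0 0 = lo by rewrite f11.2.
have {}f11 : frame [:: 2; 3]%N ([:: 6; 24]%N ++ lc) s4 s9.
  by apply: frame_trans f10 _; exact: sub2 f11.
apply: run_seq; apply: run_rset => /=; rewrite slo.
set s10 := rupd _ _ _ _ _.
have f12 : frame [:: 2; 3]%N ([:: 6; 24]%N ++ lc) s4 s10 by exact: frame_rupd.
apply: run_seq; apply: run_weaken (run_solve hk hk' (solve_env _ lo f12 (erefl _))) _.
move=> m8 s11 [m8c f13 h5' h11'].
have {}h6 (a : 'I_A) (i : 'I_S) : rmem s11 6 a i = sol hi a i by rewrite f13.2//= h6.
have {}h24 : rmem s11 24 0 0 = ktot y0 (sol hi) by rewrite f13.2.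
have {}f13 : frame [:: 2; 3]%N ([:: 6; 24]%N ++ lc) s4 s11.
  by apply: frame_trans f12 _; exact: sub2 f13.
have d11 : data s11 by apply: drf; apply: frame_trans f6 _; exact: sub f13.
have h3 : rmem s11 3 0 0 = alpha by have [] := d11.
pose t := l2_weight v k lo hi.
apply: run_seq.
apply: (@run_weaken _ _ _ (fun m s => [/\ (m <= 30)%N, frame [:: 2; 3]%N [:: 26]%N s11 s
  & rmem s 26 0 0 = t])).
  apply: run_if => /=; rewrite h11' h3 => h; apply: run_rset => /=; split=> //; try exact: frame_rupd.
    by rewrite /t /l2_weight -/D -/sol h.
  by rewrite /t /l2_weight -/D -/sol (negbTE h) h24 h3 h11'.
move=> m9 s12 [m9c f14 h26].
have f15 : fr st s12.
  by apply: frame_trans (sub _ _ _ _ f14) => //; apply: frame_trans f6 _; exact: sub f13.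
apply: run_weaken (run_fill_rows (out := 5) (F := mix t (sol hi) (sol lo)) _ _ (drf _ f15) _) _ => //.
  move=> a i s f sa si h /=; rewrite sa si h !f.2// h26 !f14.2// h6 h5'.
  by [].
move=> m10 s13 [m10c _ hout] /=.
have [c1 c2] := l2_output_correct v0 hv hk' elo lohi (ltW hwe) Fhi Flo.
have oE : (fun (a : 'I_A) (i : 'I_S) => rmem s13 5 (val a) (val i)) = mix t (sol hi) (sol lo).
  by apply/funext => a; apply/funext => i; exact: hout.
exists v, k, J; rewrite oE; split=> //; last split=> //.
  have D0 : 0 < 24 * (v + 5) by rewrite mulr_gt0// ltr_wpDl.
  apply: (le_trans Jb); rewrite lerD2l ler_pM2l// invf_div ler_ln ?posrE;
    [ | exact: divr_gt0 | exact: divr_gt0].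
  by rewrite ler_pM2r ?invr_gt0.
have AS : (A <= A * S)%N by rewrite leq_pmulr.
have AS1 : (1 <= A * S)%N by rewrite muln_gt0 A_gt0.
set X := (A * S * (k + 4))%N.
have X1 : (A * S <= X)%N by rewrite leq_pmulr// addn_gt0 orbT.
have csX : (cs <= 289 * X)%N.
  have X2 : (A * (k + 4) <= X)%N by rewrite /X mulnAC; apply: leq_pmulr.
  by rewrite /cs; move: AS AS1 X1 X2; rewrite /X; clear; lia.
have JX : (J * cs <= J * (289 * X))%N by rewrite leq_mul2l csX orbT.
have J1 : (J <= J * X)%N by rewrite leq_pmulr// (leq_trans AS1).
have -> : (1000 * (A * S) * ((k + 4) * (J + 4)) = 1000 * (J * X) + 4000 * X)%N.
  by rewrite /X; clear; lia.
move: m1c m2c m3c m5c m6c m7c m8c m9c m10c; rewrite -/cs; clear -AS AS1 X1 csX JX J1.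
by rewrite /=; lia.
Qed.

End L2.

(** * The l1 program *)

(* Cells of the l1 program: 7 sqrt A, 8 z, 9 beta, 10 and 12 the bracket of z,
   11 the divergence at z, 13 the divergence at the upper end, 14 normaliser,
   19 the divergence of one row. *)
Definition tilt_entry : rexpr :=
  RMul (entry 2) (RExp (RMul (cell 9)
    (RAdd (RLn (RDiv (entry 1) (entry 2)))
          (RDiv (RMul (rnat 2) (entry 0)) (RNat (NVar 1)))))).

Definition tilt_row : cmd :=
  Seq (row_sum 14 tilt_entry)
  (Seq (fill_loop 5 2 3 0 (RDiv tilt_entry (cell 14)))
  (Seq (row_sum 19 kl_entry) (rset 11 (RAdd (cell 11) (cell 19))))).

Definition tilt : cmd :=
  Seq (rset 9 (RDiv (RMul (cell 7) (RSub (rnat 1) (cell 8)))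
    (RAdd (RMul (cell 7) (RSub (rnat 1) (cell 8))) (RMul (rnat 2) (cell 8)))))
  (Seq (rset 11 (rnat 0)) (for_loop 2 1 tilt_row)).

Definition bisect_z : cmd :=
  Seq (rset 8 (rhalf (RAdd (cell 10) (cell 12))))
  (Seq tilt
    (If (BRLe (cell 11) (cell 3))
      (Seq (rset 12 (cell 8)) (rset 13 (cell 11))) (rset 10 (cell 8)))).

(** [z = 0] is the unconstrained problem, accepted if feasible. [z = 1] is an infinite multiplier,
    whose point is [y0]; hence the initial divergence 0 in cell 13. The guard compares the duality
    gap with [eps] after multiplication by [1 - z], so that it is meaningful at [z = 1]. *)
Definition l1_prog : cmd :=
  Seq (rset 7 (RPow (RNat (NVar 1)) (rhalf (rnat 1))))
  (Seq (rset 8 (rnat 0))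
  (Seq tilt
  (If (BRLe (cell 11) (cell 3)) Skip
    (Seq (rset 10 (rnat 0))
    (Seq (rset 12 (rnat 1))
    (Seq (rset 13 (rnat 0))
    (Seq (While (BRLe (RMul (cell 4) (RSub (rnat 1) (cell 12)))
                      (RMul (RMul (cell 7) (cell 12)) (RSub (cell 3) (cell 13))))
            bisect_z)
    (Seq (rset 8 (cell 12)) tilt)))))))).

Section L1Run.
Context {R : realType} {A S : nat}.
Variables (g y' y0 : 'M[R]_(A, S)) (alpha eps : R).
Hypotheses (A_gt0 : (0 < A)%N) (S_gt0 : (0 < S)%N).
Implicit Types st s : state R.

Local Notation data := (data_in g y' y0 alpha eps).

Definition tilted (b : R) : 'I_A -> 'I_S -> R := ytilt y0 y' g A%:R b.

Let q : R := Num.sqrt A%:R.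

(* [lam = sqrt A * z / (1 - z)] and [b = (A / 2) / (A / 2 + lam)]. *)
Definition beta (z : R) : R := q * (1 - z) / (q * (1 - z) + 2 * z).

Definition tilt_cells := [:: 5; 9; 11; 14; 19]%N.

Lemma run_tilt z st : data st -> rmem st 7 0 0 = q -> rmem st 8 0 0 = z ->
  run tilt st (fun m s =>
    [/\ (m <= A * (S * 120 + 120) + 60)%N,
      frame [:: 2; 3]%N tilt_cells st s,
      forall (a : 'I_A) (i : 'I_S), rmem s 5 a i = tilted (beta z) a i
    & rmem s 11 0 0 = ktot y0 (tilted (beta z))]).
Proof.
move=> hd h7 h8.
have df s : frame [:: 2; 3]%N tilt_cells st s -> data s.
  by move=> f; exact: data_frame f _ _ hd.
do 2 (apply: run_seq; apply: run_rset => /=); rewrite h7 h8 -/(beta z).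
set st1 := rupd _ _ _ _ _; set b := beta z in st1 *.
have f1 : frame [:: 2; 3]%N tilt_cells st st1 by do 2 apply: frame_rupd => //.
have [_ sA _ _ _] := df _ f1.
apply: run_weaken (run_for (i := 2) (v := 1) (cost := S * 120 + 100)
  (Inv := fun j s => [/\ frame [:: 2; 3]%N tilt_cells st s, rmem s 9 0 0 = b,
    forall (a : 'I_A) (i : 'I_S), (a < j)%N -> rmem s 5 a i = tilted b a i
    & rmem s 11 0 0 = \sum_(a < A | (a < j)%N) klr (tilted b a) (y0 a)])
  _ sA _ _) _ => //.
- by split=> //; [apply: frame_nupd | rewrite big_pred0].
- move=> a s sv si [f h9 h5 h11]; have [sS _ _ _ _] := df _ f.
  have entE (i : 'I_S) s1 xs ys : frame [:: 2; 3]%N tilt_cells st s1 ->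
      frame xs ys s s1 -> (2 \notin xs)%N -> (9 \notin ys)%N -> nmem s1 3 = i ->
      reval s1 tilt_entry = y0 a i * expR (b * hdir y0 y' g A%:R a i).
    move=> f1' fs hx hy s13 /=; have [_ sA1 h _ _] := df _ f1'.
    by rewrite s13 sA1 fs.1// si (fs.2 9%N)// h9; have [-> -> ->] := h a i.
  have sub s1 s2 acc : acc \in tilt_cells -> frame [:: 3]%N [:: acc] s1 s2 ->
      frame [:: 2; 3]%N tilt_cells s1 s2.
    by move=> ha; apply: frame_sub => x; rewrite inE => /eqP->.
  apply: run_seq.
  apply: run_weaken (run_sum (acc := 14) (F := fun i => y0 a i * expR (b * hdir y0 y' g A%:R a i))
    (erefl : 3 != 0)%N sS _) _.
    move=> i s1 f2 s13.
    exact: (entE i s1 [:: 3]%N [:: 14]%N (frame_trans f (sub _ _ 14%N isT f2)) f2).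
  move=> m1 s1 [m1c f2 h14].
  have s12 : nmem s1 2 = a by rewrite f2.1.
  have f2' := frame_trans f (sub _ _ 14%N isT f2); have [sS1 _ _ _ _] := df _ f2'.
  apply: run_seq.
  apply: run_weaken (run_fill (out := 5) (F := tilted b a) (erefl : 3 != 0)%N
     (erefl : 2 != 3)%N sS1 _) _.
    move=> i s2 f3 s23 _.
    have -> : reval s2 (RDiv tilt_entry (cell 14)) = reval s2 tilt_entry / rmem s2 14 0 0 by [].
    have fs : frame [:: 3]%N [:: 14; 5]%N s s2.
      apply: (frame_trans (s2 := s1)); first by apply: frame_sub f2 => // x; rewrite !inE => ->.
      by apply: frame_sub f3 => // x; rewrite !inE => ->; rewrite orbT.
    by rewrite (entE i s2 _ _ (frame_trans f2' (sub _ _ 5%N isT f3)) fs)// f3.2// h14.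
  move=> m2 s2 [m2c f3 k5 k5']; rewrite s12 in k5 k5'.
  have f3' := frame_trans f2' (sub _ _ 5%N isT f3); have [sS2 _ _ _ _] := df _ f3'.
  have s22 : nmem s2 2 = a by rewrite f3.1.
  apply: run_seq.
  apply: run_weaken (run_sum (acc := 19) (F := fun i => tilted b a i * ln (tilted b a i / y0 a i))
    (erefl : 3 != 0)%N sS2 _) _.
    move=> i s3 f4 s33 /=.
    have f4' := frame_trans f3' (sub _ _ 19%N isT f4); have [_ _ h _ _] := df _ f4'.
    rewrite s33 f4.1// s22 f4.2// k5; congr (_ * ln (_ / _)).
    by have [_ _] := h a i.
  move=> m3 s3 [m3c f4 h19].
  have f4' := frame_trans f3' (sub _ _ 19%N isT f4).
  apply: run_rset => /=; split.
  + by move: m1c m2c m3c => /=; clear; lia.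
  + by rewrite f4.1// f3.1// f2.1.
  + by rewrite f4.1.
  + split.
    * by apply: frame_nupd => //; apply: frame_rupd.
    * by rewrite /= f4.2// f3.2// f2.2.
    * move=> c i /=; rewrite ltnS leq_eqVlt => /orP[/eqP/val_inj->|ca].
        by rewrite f4.2// k5.
      by rewrite f4.2// k5' ?ltn_eqF// f2.2// h5.
    * by rewrite /= h19 f4.2// f3.2// f2.2// h11 sum_ord_lt.
- move=> m s [mc [f _ h5 h11]]; split=> //; first by move: mc => /=; clear; lia.
    by move=> a i; rewrite h5.
  by rewrite h11; apply: eq_bigl => a; rewrite ltn_ord.
Qed.

Variable M : R.
Hypotheses (hy0 : forall a, distr (y0 a)) (y0_gt0 : forall a i, 0 < y0 a i)
  (y'_gt0 : forall a i, 0 < y' a i) (hy' : feasible y0 alpha y')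
  (hg : forall a i, `|g a i| <= M) (hr : forall a i, `|ln (y' a i / y0 a i)| <= M)
  (M0 : 0 <= M) (alpha_gt0 : 0 < alpha) (alphaM : alpha <= M) (alphaVM : alpha^-1 <= M)
  (eps_gt0 : 0 < eps) (eps_le : eps <= 2^-1).

Let AE : A%:R = #|'I_A|%:R :> R. Proof. by rewrite card_ord. Qed.

Let A1 : 1 <= A%:R :> R. Proof. by rewrite ler1n. Qed.

Let q2 : q ^+ 2 = A%:R. Proof. by rewrite sqr_sqrtr. Qed.

Let q_gt0 : 0 < q. Proof. by rewrite sqrtr_gt0 ltr0n. Qed.

Let den_gt0 z : 0 <= z <= 1 -> 0 < q * (1 - z) + 2 * z.
Proof.
move=> /andP[z0 z1]; have [zz|zn] := eqVneq z 0.
  by rewrite zz subr0 mulr1 mulr0 addr0.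
have zp : 0 < z by rewrite lt_def zn.
by rewrite ltr_wpDl// ?mulr_gt0// mulr_ge0 ?(ltW q_gt0)// subr_ge0.
Qed.

Let beta01 z : 0 <= z <= 1 -> 0 <= beta z <= 1.
Proof.
move=> z01; have d := den_gt0 z01; have /andP[z0 z1] := z01.
have p : 0 <= q * (1 - z) by rewrite mulr_ge0 ?(ltW q_gt0)// subr_ge0.
rewrite /beta divr_ge0 ?(ltW d)//= ler_pdivrMr// mul1r lerDl mulr_ge0//.
Qed.

Let onemb z : 0 <= z <= 1 -> 1 - beta z = 2 * z / (q * (1 - z) + 2 * z).
Proof. by move=> z01; have d := den_gt0 z01; rewrite /beta; field; rewrite gt_eqF. Qed.

Let F z := ktot y0 (tilted (beta z)).

Let lip_const : R := expR (4 * (3 * M)) * (8 * expR M * M + 8 * M ^+ 2).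
Let tail_const : R := M * expR (2 * (3 * M)) *
       (8 * expR (5 * (3 * M)) * (16 * M ^+ 2) + 8 * M ^+ 2).
Let kap : R := (2 + tail_const)^-1.

(** A bracket width that forces the guard to fail; it only serves to count passes. Here [kap] bounds
    [1 - z] from below at infeasible points: one factor [kap] comes from the lower end of the
    bracket and two from the upper end, where [1 - hi >= kap / 2]. *)
Definition l1_width : R := eps * kap ^+ 3 / (8 * (1 + lip_const)).

Let sq0 : 0 <= M ^+ 2. Proof. exact: sqr_ge0. Qed.

Let lip_ge0 : 0 <= lip_const.
Proof. by rewrite mulr_ge0 ?expR_ge0// addr_ge0// !mulr_ge0 ?expR_ge0. Qed.

Let tail_ge0 : 0 <= tail_const.
Proof.
apply: mulr_ge0; first by rewrite mulr_ge0 ?expR_ge0.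
by apply: addr_ge0; apply: mulr_ge0 => //; apply: mulr_ge0; rewrite ?expR_ge0.
Qed.

Let kap_gt0 : 0 < kap.
Proof. by have := tail_ge0; rewrite invr_gt0; lra. Qed.

Let kap_le : kap <= 2^-1.
Proof. by have := tail_ge0 => t0; rewrite lef_pV2 ?posrE//; lra. Qed.

Let F_sub z1 z2 : 0 <= z1 -> z1 <= z2 -> z2 <= 1 ->
  F z1 - F z2 <= 2 * q * (z2 - z1) / ((q * (1 - z1) + 2 * z1) * (q * (1 - z2) + 2 * z2)) * lip_const.
Proof.
move=> z10 z12 z21.
have z1b : 0 <= z1 <= 1 by rewrite z10 (le_trans z12).
have z2b : 0 <= z2 <= 1 by rewrite z21 (le_trans z10).
have d1 := den_gt0 z1b; have d2 := den_gt0 z2b.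
have e : beta z1 - beta z2 =
   2 * q * (z2 - z1) / ((q * (1 - z1) + 2 * z1) * (q * (1 - z2) + 2 * z2)).
  by rewrite /beta; field; rewrite !gt_eqF.
have b12 : 0 <= beta z1 - beta z2.
  rewrite e divr_ge0//; last by rewrite mulr_ge0// ltW.
  by rewrite !mulr_ge0 ?(ltW q_gt0)// subr_ge0.
have /andP[b10 b11] := beta01 z1b; have /andP[b20 b21] := beta01 z2b.
have b21' : beta z2 <= beta z1 by rewrite -subr_ge0.
apply: (le_trans (ktot_tilt_lip hy0 y0_gt0 hg hr A1 M0 b20 b21' b11)).
rewrite -e ler_wpM2l// ler_wpM2l ?expR_ge0//.
exact: (hdir_sqr_le hy0 y0_gt0 y'_gt0 hy' hg hr AE A1 M0 alphaM).
Qed.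

(** In the variable [z] both sides of [infeasible_bound] carry the factor [q ^+ 2], so [A]
    disappears. The bound [tail_const <= (1 + tail_const) ^+ 2] permits taking square roots. *)
Let infeasible_z z : 0 <= z <= 1 -> alpha < F z -> kap <= 1 - z.
Proof.
move=> z01 Fz; have d := den_gt0 z01; have /andP[z0 z1] := z01.
have := infeasible_bound hy0 y0_gt0 y'_gt0 hy' hg hr AE A1 M0 alpha_gt0 alphaVM (beta01 z01) Fz.
rewrite -/tail_const onemb// /beta.
set d' := q * (1 - z) + 2 * z in d *.
rewrite !exprMn exprVn !mulrA ler_pM2r ?invr_gt0 ?exprn_gt0// -q2 => h.
have h2 : (2 * z) ^+ 2 <= ((1 + tail_const) * (1 - z)) ^+ 2.
  have qq : 0 < q ^+ 2 by rewrite exprn_gt0.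
  have h3 : (2 * z) ^+ 2 <= tail_const * (1 - z) ^+ 2.
    by rewrite -(ler_pM2l qq); lra.
  apply: (le_trans h3); rewrite exprMn ler_wpM2r ?sqr_ge0//.
  by have := tail_ge0; have := sqr_ge0 tail_const; lra.
have t0 := tail_ge0.
have h4 : 2 * z <= (1 + tail_const) * (1 - z).
  move: h2; rewrite ler_sqr ?nnegrE ?mulr_ge0 ?subr_ge0// ?addr_ge0//.
have h5 : 1 <= (1 - z) * (2 + tail_const) by lra.
by rewrite /kap -[leLHS]mul1r ler_pdivrMr//; lra.
Qed.

Let F1 : F 1 = 0.
Proof.
rewrite /F /beta subrr mulr0 mul0r; apply: big1 => a _.
apply: big1 => i _.
have -> : tilted 0 a i = y0 a i.
  rewrite /tilted /ytilt /zpart mul0r expR0 mulr1.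
  under eq_bigr do rewrite mul0r expR0 mulr1.
  by rewrite (hy0 a).2 divr1.
by rewrite divff ?gt_eqF// ln1 mulr0.
Qed.

Lemma l1_width_gt0 : 0 < l1_width.
Proof.
rewrite /l1_width divr_gt0 ?mulr_gt0 ?exprn_gt0//.
by have := lip_ge0; lra.
Qed.

Let width_lip : l1_width * (8 * (1 + lip_const)) = eps * kap ^+ 3.
Proof.
have := lip_ge0 => l0.
by rewrite /l1_width; field; rewrite gt_eqF//; lra.
Qed.

Let width_le : l1_width <= kap / 2.
Proof.
have l0 := lip_ge0; have w0 := l1_width_gt0; have k0 := kap_gt0; have k1 := kap_le.
have e0 := eps_gt0; have e1 := eps_le.
have h1 : l1_width * 8 <= eps * kap ^+ 3.
  by rewrite -width_lip ler_pM2l// ler_peMr//; lra.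
have h2 : kap ^+ 3 <= kap by rewrite -[leRHS]mulr1 exprS ler_pM2l// exprn_ile1//; lra.
have h3 : eps * kap ^+ 3 <= 2^-1 * kap.
  by apply: ler_pM => //; rewrite ?exprn_ge0 ?ltW.
lra.
Qed.

(** The multiplier carries a factor [q], and the Lipschitz bound in [z] carries [q] over a product
    of two denominators, each at least a multiple of [q]. All powers of [q] cancel, which is the
    purpose of scaling the multiplier by the square root of [A]. *)
Let stop lo hi : 0 <= lo -> lo <= hi -> hi <= 1 -> alpha < F lo -> F hi <= alpha ->
  hi - lo < l1_width -> q * hi * (alpha - F hi) < eps * (1 - hi).
Proof.
move=> lo0 lohi hi1 Flo Fhi wd.
have l01 : 0 <= lo <= 1 by rewrite lo0 (le_trans lohi).
have h01 : 0 <= hi <= 1 by rewrite hi1 (le_trans lo0).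
have klo := infeasible_z l01 Flo; have k0 := kap_gt0; have w2 := width_le.
have khi : kap / 2 <= 1 - hi by lra.
have fs := F_sub lo0 lohi hi1.
have dlo := den_gt0 l01; have dhi := den_gt0 h01.
set Dl := q * (1 - lo) + 2 * lo in fs dlo; set Dh := q * (1 - hi) + 2 * hi in fs dhi.
have l0 := lip_ge0; have q0 := q_gt0; have e0 := eps_gt0.
have hDl : q * kap <= Dl.
  apply: (@le_trans _ _ (q * (1 - lo))); first by rewrite ler_pM2l.
  by rewrite lerDl mulr_ge0.
have hDh : q * (1 - hi) <= Dh by rewrite lerDl mulr_ge0// (le_trans lo0).
have p1 : 0 < 1 - hi by lra.
have hD : q * kap * (q * (1 - hi)) <= Dl * Dh.
  by apply: ler_pM => //; rewrite mulr_ge0// ltW.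
have D0 : 0 < q * kap * (q * (1 - hi)) by rewrite !mulr_gt0.
have s1 : 2 * q * (hi - lo) / (Dl * Dh) <= 2 * q * (hi - lo) / (q * kap * (q * (1 - hi))).
  rewrite ler_wpM2l ?lef_pV2 ?posrE ?mulr_gt0//.
  by rewrite !mulr_ge0 ?(ltW q0)// subr_ge0.
have s2 : 2 * q * (hi - lo) / (q * kap * (q * (1 - hi))) = 2 * (hi - lo) / (q * kap * (1 - hi)).
  by field; rewrite !gt_eqF.
have s3 : alpha - F hi <= 2 * (hi - lo) / (q * kap * (1 - hi)) * lip_const.
  have := ler_wpM2r l0 s1; rewrite s2; lra.
have s4 : q * hi * (alpha - F hi) <= q * (2 * (hi - lo) / (q * kap * (1 - hi)) * lip_const).
  apply: (@le_trans _ _ (q * (alpha - F hi))); last by rewrite ler_pM2l.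
  by rewrite -mulrA ler_pM2l// ler_piMl// subr_ge0.
have s5 : q * (2 * (hi - lo) / (q * kap * (1 - hi)) * lip_const) =
   2 * (hi - lo) * lip_const / kap / (1 - hi).
  by field; rewrite !gt_eqF.
apply: (le_lt_trans s4); rewrite s5 ltr_pdivrMr// ltr_pdivrMr//.
have s6 : 2 * (hi - lo) * lip_const <= 2 * l1_width * lip_const.
  by rewrite ler_wpM2r// ler_pM2l// ltW.
have s7 : 2 * l1_width * lip_const < eps * kap ^+ 3 / 4.
  by have := width_lip; have := l1_width_gt0; lra.
have s8 : eps * (kap ^+ 3 / 4) <= eps * ((1 - hi) * (1 - hi) * kap).
  rewrite ler_pM2l//.
  have -> : kap ^+ 3 / 4 = (kap / 2) * (kap / 2) * kap by field.
  by rewrite ler_pM2r//; apply: ler_pM => //; rewrite divr_ge0// ltW.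
lra.
Qed.

Let correct z : 0 <= z <= 1 -> F z <= alpha ->
  q * z * (alpha - F z) < eps * (1 - z) \/ z = 0 ->
  feasible y0 alpha (tilted (beta z)) /\
  forall x, feasible y0 alpha x ->
    f1 y' g A%:R x <= f1 y' g A%:R (tilted (beta z)) + eps.
Proof.
move=> z01 Fz hz; have /andP[z0 z1] := z01.
have p1 : 0 < 1 - z.
  case: hz => [h|->]; last by lra.
  have : 0 < eps * (1 - z).
    by apply: le_lt_trans h; rewrite mulr_ge0 ?subr_ge0// mulr_ge0// ltW.
  by rewrite pmulr_rgt0.
have small : q * z * (alpha - F z) <= eps * (1 - z).
  case: hz => [/ltW//|->]; rewrite mulr0 mul0r subr0 mulr1.
  by rewrite ltW.
have d := den_gt0 z01.
have b0 : 0 < beta z <= 1.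
  have /andP[_ ->] := beta01 z01; rewrite andbT.
  by rewrite /beta divr_gt0// mulr_gt0.
split.
  split=> // a; first exact: ytilt_distr.
  by move=> i yi; have := y0_gt0 a i; rewrite yi ltxx.
move=> x hx; apply: (le_trans (tilt_gap g hy0 y0_gt0 y'_gt0 A1 b0 hx)).
rewrite lerD2l.
have -> : A%:R / 2 * ((1 - beta z) / beta z) = q * z / (1 - z).
  rewrite onemb// /beta -q2; field; rewrite !gt_eqF//.
by rewrite -/(F z) mulrAC ler_pdivrMr.
Qed.

Lemma run_l1 st : data st ->
  run l1_prog st (fun m s => exists J : nat,
    [/\ J%:R <= 1 + 2 * ln l1_width^-1, (m <= 1000 * (A * S) * (J + 4))%N,
      feasible y0 alpha (fun a i => rmem s 5 (val a) (val i)) &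
      forall x, feasible y0 alpha x -> f1 y' g A%:R x <=
        f1 y' g A%:R (fun a i => rmem s 5 (val a) (val i)) + eps]).
Proof.
move=> hd.
pose big := [:: 7; 8; 10; 12; 13]%N ++ tilt_cells.
have drf s : frame [:: 2; 3]%N big st s -> data s by move=> f; exact: data_frame f _ _ hd.
have sub ys s s' : all (mem big) ys -> frame [:: 2; 3]%N ys s s' -> frame [:: 2; 3]%N big s s'.
  by move=> /allP h; apply: frame_sub => // x /h.
have outE s z : (forall (a : 'I_A) (i : 'I_S), rmem s 5 a i = tilted (beta z) a i) ->
   (fun (a : 'I_A) (i : 'I_S) => rmem s 5 (val a) (val i)) = tilted (beta z).
  by move=> h; apply/funext => a; apply/funext => i; exact: h.
have [J [hJ hJ' Jb]] : exists J : nat, [/\ forall j, (j < J)%N -> l1_width <= 2^-1 ^+ j,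
   2^-1 ^+ J < l1_width & J%:R <= 1 + 2 * ln l1_width^-1].
  apply: exists_halving; rewrite l1_width_gt0 /=.
  by apply: (le_trans width_le); have := kap_le; lra.
have AS : (A <= A * S)%N by rewrite leq_pmulr.
have AS1 : (1 <= A * S)%N by rewrite muln_gt0 A_gt0.
do 2 (apply: run_seq; apply: run_rset => /=).
have [_ sA _ _ _] := hd; rewrite sA div1r powR12_sqrt// -/q.
set st1 := rupd _ _ _ _ _.
have f1 : frame [:: 2; 3]%N big st st1 by do 2 apply: frame_rupd => //.
apply: run_seq; apply: run_weaken (run_tilt (z := 0) (drf _ f1) (erefl _) (erefl _)) _.
move=> m1 s1 [m1c f2 h5 h11].
have h7 : rmem s1 7 0 0 = q by rewrite f2.2.
have {}f2 : frame [:: 2; 3]%N big st s1 by apply: frame_trans f1 _; exact: sub f2.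
have [_ _ _ h3 _] := drf _ f2.
apply: run_if => /=; rewrite h11 h3 -/(F 0) => test.
  apply: run_skip => /=; exists J; rewrite (outE _ _ h5).
  have z01 : 0 <= (0 : R) <= 1 by rewrite lexx ler01.
  have [c1 c2] := correct z01 test (or_intror erefl).
  by split=> //; move: m1c AS AS1; clear; nia.
rewrite -ltNge in test.
do 3 (apply: run_seq; apply: run_rset => /=).
set s2 := rupd _ _ _ _ _.
have f3 : frame [:: 2; 3]%N big st s2 by do 3 apply: frame_rupd => //.
set cs := (A * (S * 120 + 120) + 60)%N in m1c.
apply: run_seq.
apply: run_weaken (run_while (J := J) (cost := cs + 60) (Inv := fun j s =>
  [/\ (j <= J)%N, frame [:: 2; 3]%N big st s, rmem s 7 0 0 = q & exists lo hi,
    [/\ rmem s 10 0 0 = lo, rmem s 12 0 0 = hi, rmem s 13 0 0 = F hi &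
     [/\ hi - lo = 2^-1 ^+ j, 0 <= lo, hi <= 1, alpha < F lo & F hi <= alpha]]]) _ _) _.
- split; [by [] | exact: f3 | exact: h7 | exists 0, 1].
  split; [by [] | by [] | by rewrite F1 | ].
  by split; [rewrite subr0 expr0 | | | exact: test | rewrite F1 ltW].
- move=> j s [jJ f s7 [lo [hi [slo shi s13 [hw lo0 hi1 Flo Fhi]]]]] /=.
  have [_ _ _ s3 s4] := drf _ f.
  have lohi : lo <= hi by rewrite -subr_ge0 hw exprn_ge0.
  rewrite s7 shi s13 s3 s4 => guard.
  have jJ' : (j < J)%N.
    rewrite ltn_neqAle jJ andbT; apply/eqP => jE.
    by move: guard; rewrite leNgt (stop lo0 lohi hi1 Flo Fhi)// hw jE.
  split=> //.
  apply: run_seq; apply: run_rset => /=; rewrite slo shi.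
  set mid := (_ + _) / _; set s5 := rupd _ _ _ _ _.
  have f5 : frame [:: 2; 3]%N big st s5 by exact: frame_rupd.
  apply: run_seq; apply: run_weaken (run_tilt (z := mid) (drf _ f5) s7 (erefl _)) _.
  move=> m6 s6 [m6c f6 _ k11].
  have k8 : rmem s6 8 0 0 = mid by rewrite f6.2.
  have k7 : rmem s6 7 0 0 = q by rewrite f6.2.
  have k10 : rmem s6 10 0 0 = lo by rewrite f6.2.
  have k12 : rmem s6 12 0 0 = hi by rewrite f6.2.
  have k13 : rmem s6 13 0 0 = F hi by rewrite f6.2.
  have {}f6 : frame [:: 2; 3]%N big st s6 by apply: frame_trans f5 _; exact: sub f6.
  have [_ _ _ k3 _] := drf _ f6.
  have hw2 : mid - lo = 2^-1 ^+ j.+1 by rewrite exprS -hw /mid; field.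
  have hw3 : hi - mid = 2^-1 ^+ j.+1 by rewrite exprS -hw /mid; field.
  have pj : 0 <= 2^-1 ^+ j.+1 :> R by rewrite exprn_ge0.
  have lom : lo <= mid by rewrite -subr_ge0 hw2.
  have mhi : mid <= hi by rewrite -subr_ge0 hw3.
  apply: run_if => /=; rewrite k11 k3 -/(F mid) => t.
    apply: run_seq; do 2 (apply: run_rset => /=); rewrite k8 k11; split.
      by move: m6c; rewrite -/cs; clear; lia.
    split=> //; first by do 2 apply: frame_rupd => //.
    exists lo, mid; split=> //; split=> //; exact: le_trans hi1.
  apply: run_rset => /=; rewrite k8; split; first by move: m6c; rewrite -/cs; clear; lia.
  split=> //; first by apply: frame_rupd => //.
  exists mid, hi; split=> //; split=> //; first exact: le_trans lom.
  by rewrite ltNge.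
move=> m3 s3 [/= m3c [j [[jJ f s7 [lo [hi [slo shi s13 [hw lo0 hi1 Flo Fhi]]]]]]]].
have [_ _ _ s3a s3e] := drf _ f.
rewrite s7 shi s13 s3a s3e -ltNge => guard.
have lohi : lo <= hi by rewrite -subr_ge0 hw exprn_ge0.
apply: run_seq; apply: run_rset => /=; rewrite shi.
set s4 := rupd _ _ _ _ _.
have f5 : frame [:: 2; 3]%N big st s4 by exact: frame_rupd.
apply: run_weaken (run_tilt (z := hi) (drf _ f5) s7 (erefl _)) _.
move=> m4 s5 [m4c _ k5 _]; exists J; rewrite (outE _ _ k5).
have h01 : 0 <= hi <= 1 by rewrite hi1 (le_trans lo0).
have [c1 c2] := correct h01 Fhi (or_introl guard).
split=> //.
have csX : (cs <= 300 * (A * S))%N by rewrite /cs; move: AS AS1; clear; lia.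
have JX : (J * cs <= J * (300 * (A * S)))%N by rewrite leq_mul2l csX orbT.
have J1 : (J <= J * (A * S))%N by rewrite leq_pmulr.
move: m1c m3c m4c; rewrite -/cs; move: AS1 csX JX J1; clear.
by rewrite /=; lia.
Qed.

End L1Run.

(** * From divergences in R to the proximal problem *)

Section Bridge.
Context {R : realType} {A S : nat}.
Implicit Types (y g : 'M[R]_(A, S)) (alpha eps : R).

Lemma simplexP y a : simplex (row a y) <-> distr (y a).
Proof.
have e : \sum_s (row a y) 0 s = \sum_s y a s by apply: eq_bigr => s _; rewrite mxE.
split=> -[p0 p1]; first by split=> [s|]; [have := p0 s; rewrite mxE | rewrite -e].
by split=> [s|]; [rewrite mxE | rewrite e].
Qed.

Lemma kl_term_ninfty (p q : R) : kl_term p q != -oo%E.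
Proof. by rewrite /kl_term; case: ifP => // _; case: ifP. Qed.

Lemma kl_termE (p q : R) : (q = 0 -> p = 0) -> kl_term p q = (p * ln (p / q))%:E.
Proof.
rewrite /kl_term => qp; case: ifPn => [/eqP->|pn]; first by rewrite mul0r.
by case: ifP => // /eqP/qp p0; rewrite p0 eqxx in pn.
Qed.

Lemma KLE y (y0 : 'M[R]_(A, S)) a : abscont (y a) (y0 a) ->
  KL (row a y) (row a y0) = (klr (y a) (y0 a))%:E.
Proof.
move=> yq; rewrite /KL /klr -sumEFin; apply: eq_bigr => s _.
by rewrite !mxE kl_termE//; exact: yq.
Qed.

Lemma KL_ninfty y (y0 : 'M[R]_(A, S)) a : KL (row a y) (row a y0) != -oo%E.
Proof. by rewrite /KL esum_eqNy negb_exists; apply/forallP => s /=; exact: kl_term_ninfty. Qed.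

(** A coordinate with [y0 = 0] and [y != 0] contributes [+oo], and no term is [-oo], so a finite
    total forces absolute continuity; on such points the real-valued divergence is faithful. *)
Lemma kl_ballP (y0 : 'M[R]_(A, S)) alpha y : kl_ball y0 alpha y <-> feasible y0 alpha y.
Proof.
split=> [[hy hK]|[hy yq hK]]; last first.
  split=> [a|]; first exact/simplexP.
  rewrite (eq_bigr _ (fun a _ => KLE (yq a))) sumEFin lee_fin; exact: hK.
have yq a : abscont (y a) (y0 a).
  move=> s q0; apply/eqP/negPn/negP => yn.
  suff : (\sum_(a < A) KL (row a y) (row a y0) = +oo)%E.
    by move=> e; move: hK; rewrite e leye_eq.
  apply/eqP; rewrite esum_eqy => [|b _]; last exact: KL_ninfty.
  apply/existsP; exists a => /=; rewrite /KL esum_eqy => [|b _]; last exact: kl_term_ninfty.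
  by apply/existsP; exists s => /=; rewrite !mxE /kl_term (negbTE yn) q0 eqxx.
split=> //; first by move=> a; exact/simplexP.
by move: hK; rewrite (eq_bigr _ (fun a _ => KLE (yq a))) sumEFin lee_fin.
Qed.

Lemma approx_proxP D (y0 y' : 'M[R]_(A, S)) alpha g eps y (f : 'M[R]_(A, S) -> R) :
  (forall z : 'M[R]_(A, S), feasible y0 alpha z -> objective D g y' z = (f z)%:E) ->
  feasible y0 alpha y ->
  (forall z : 'M[R]_(A, S), feasible y0 alpha z -> f z <= f y + eps) ->
  approx_prox D (kl_ball y0 alpha) g y' eps y.
Proof.
move=> fE hy hf; split; first exact/kl_ballP.
rewrite fE//; apply: ge_ereal_sup => _ [z /kl_ballP hz <-].
by rewrite fE// lee_fin; exact: hf.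
Qed.

(** Expanding the square moves [y'] into the linear term, up to a constant that does not affect
    gaps. *)
Lemma objective_l2E g (y' z : 'M[R]_(A, S)) : objective D_l2 g y' z =
  (ftot (fun a i => g a i + y' a i) z - 2^-1 * \sum_a \sum_i y' a i ^+ 2)%:E.
Proof.
rewrite /objective /D_l2 -EFinB; congr EFin.
rewrite /ftot /frow /inner !mulr_sumr -!sumrB; apply: eq_bigr => a _.
by rewrite !mulr_sumr -!sumrB; apply: eq_bigr => i _; field.
Qed.

Lemma objective_l1E alpha g (y0 y' z : 'M[R]_(A, S)) : (forall a s, 0 < y' a s) ->
  feasible y0 alpha z -> objective D_l1 g y' z = (f1 y' g A%:R z)%:E.
Proof.
move=> y'p hz; rewrite /objective /D_l1.
have zy' a : abscont (z a) (y' a) by move=> s y0'; have := y'p a s; rewrite y0' ltxx.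
by rewrite (eq_bigr _ (fun a _ => KLE (zy' a))) sumEFin -EFinM -EFinB.
Qed.

Lemma output_fun (st : state R) :
  fun_of_matrix (output A S st) = (fun a i => rmem st 5 (val a) (val i)).
Proof. by apply/funext => a; apply/funext => i; rewrite mxE. Qed.

End Bridge.

(** * Absorption of constants and the complexity bounds *)

Lemma ln_inv_ge_half {R : realType} (eps : R) : 0 < eps <= 2^-1 -> 2^-1 <= ln eps^-1.
Proof.
move=> /andP[e0 e1].
have l2 := @half_le_ln2 R.
apply: (le_trans l2); rewrite ler_ln ?posrE ?invr_gt0//.
by rewrite -[leLHS]invrK lef_pV2 ?posrE ?invr_gt0.
Qed.

(** For [eps <= 2^-1] the logarithm is at least 1/2, so additive constants are absorbed into it. *)
Lemma affine_log_le {R : realType} (l c b : R) : 2^-1 <= l -> 0 <= c ->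
  c + b * l <= (2 * c + b) * l.
Proof. by move=> hl c0; have := ler_wpM2l c0 hl; lra. Qed.

Lemma natr_cost_le {R : realType} (K a b c k : nat) (C l : R) :
  (c <= K * (a * b) * k)%N -> k%:R <= C * l -> c%:R <= K%:R * C * (a%:R * b%:R * l).
Proof.
move=> hc hk; apply: (@le_trans _ _ (K * (a * b) * k)%:R); first by rewrite ler_nat.
rewrite !natrM -[leRHS]mulrA [C * _]mulrCA [leRHS]mulrA.
by rewrite ler_wpM2l// mulr_ge0// mulr_ge0.
Qed.

Theorem proposition3p3 (R : realType) :
  (exists prog : cmd, forall M : R, exists C : R,
     forall (S A : nat) (g y' y0 : 'M[R]_(A, S)) (alpha eps : R),
       (0 < S)%N -> (0 < A)%N ->
       (forall a, simplex (row a y0)) -> 0 < alpha ->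
       kl_ball y0 alpha y' ->
       magnitude_le M g alpha ->
       0 < eps <= 2^-1 ->
       exists (st : state R) (n : nat),
         [/\ exec prog (input g y' y0 alpha eps) n st,
             approx_prox D_l2 (kl_ball y0 alpha) g y' eps (output A S st)
           & n%:R <= C * (A%:R * S%:R * ln (eps^-1) ^+ 2)])
  /\
  (exists prog : cmd, forall M : R, exists C : R,
     forall (S A : nat) (g y' y0 : 'M[R]_(A, S)) (alpha eps : R),
       (0 < S)%N -> (0 < A)%N ->
       (forall a, simplex (row a y0)) -> 0 < alpha ->
       kl_ball y0 alpha y' ->
       (forall a s, 0 < y' a s) ->
       magnitude_le M g alpha ->
       log_ratio_le M y' y0 ->
       0 < eps <= 2^-1 ->
       exists (st : state R) (n : nat),
         [/\ exec prog (input g y' y0 alpha eps) n st,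
             approx_prox D_l1 (kl_ball y0 alpha) g y' eps (output A S st)
           & n%:R <= C * (A%:R * S%:R * ln (eps^-1))]).
Proof.
split.
- exists l2_prog => M.
  (* [B / eps] bounds the inverse of [l2_width], and [E] the initial length of the multiplier
     bracket. In [C1], 12 is twice the exponent 6 of the row tolerance, and 5 is the 4 additional
     passes plus the 1 of [exists_halving]. *)
  pose B := 2 * (M ^+ 2 + 5 + M).
  pose E := 24 * (M ^+ 2 + 5).
  pose C1 := 2 * (5 + 12 * ln B) + 12; pose C2 := 2 * (5 + 2 * ln E + 2 * ln B) + 2.
  exists (1000 * (C1 * C2)) => S A g y' y0 alpha eps S0 A0 hs alpha0 /kl_ballP hy' [hg aM aVM] eps01.
  have hy0 a : distr (y0 a) by exact/simplexP.
  have /andP[eps0 eps1] := eps01; have lh := ln_inv_ge_half eps01.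
  have M0 : 0 < M by exact: lt_le_trans aM.
  have [m [st [run_st [v [k [J [v0 vmin kb Jb [mb hf hgap]]]]]]]] :=
    run_l2 A0 S0 hy0 alpha0 hy' eps0 eps1 (data_input g y' y0 alpha eps).
  exists st, m; split=> //.
    apply: (approx_proxP (f := fun z => ftot (fun a i => g a i + y' a i) z - 2^-1 * \sum_a \sum_i y' a i ^+ 2)).
    - by move=> z _; exact: objective_l2E.
    - by rewrite output_fun.
    - by move=> z /hgap; rewrite output_fun; lra.
  have vM : v <= M ^+ 2.
    apply: vmin => [|a i]; first exact: sqr_ge0.
    by rewrite -[leLHS]real_normK ?num_real// lerXn2r ?nnegrE// ?(ltW M0)// (le_trans _ (hg a i)).
  have B1 : 1 <= B by rewrite /B; have := sqr_ge0 M; lra.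
  have E1 : 1 <= E by rewrite /E; have := sqr_ge0 M; lra.
  have d0 : 0 < 2 * (v + 5 + alpha) by lra.
  have w0 : 0 < l2_width alpha eps v by rewrite divr_gt0.
  have lw : ln (l2_width alpha eps v)^-1 <= ln B + ln eps^-1.
    rewrite -lnM ?posrE ?invr_gt0//; last by lra.
    rewrite ler_ln ?posrE ?invr_gt0 ?mulr_gt0 ?invr_gt0//; last by lra.
    by rewrite /l2_width invf_div ler_wpM2r ?invr_ge0 ?(ltW eps0)// /B; lra.
  have k1 : (k + 4)%:R <= C1 * ln eps^-1.
    rewrite natrD; apply: le_trans (affine_log_le (c := 5 + 12 * ln B) 12 lh _); last first.
      by have := ln_ge0 B1; lra.
    move: kb; rewrite -exprVn lnXn ?invr_gt0// -[_ *+ 6]mulr_natr; lra.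
  have J1 : (J + 4)%:R <= C2 * ln eps^-1.
    rewrite natrD; apply: le_trans (affine_log_le (c := 5 + 2 * ln E + 2 * ln B) 2 lh _); last first.
      by have := ln_ge0 B1; have := ln_ge0 E1; lra.
    have h1 : ln (24 * (v + 5) / l2_width alpha eps v) <= ln E + ln (l2_width alpha eps v)^-1.
      have E0 : 0 < E by lra.
      have v5 : 0 < 24 * (v + 5) by lra.
      rewrite -lnM ?posrE ?invr_gt0// ler_ln ?posrE; [ | exact: divr_gt0 | exact: divr_gt0].
      by rewrite ler_wpM2r ?invr_ge0 ?(ltW w0)// /E; lra.
    lra.
  have kJ : (k + 4)%:R * (J + 4)%:R <= (C1 * ln eps^-1) * (C2 * ln eps^-1).
    by apply: ler_pM; rewrite ?ler0n.
  apply: natr_cost_le mb _; rewrite natrM; apply: (le_trans kJ).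
  by rewrite expr2 mulrACA.
- exists l1_prog => M.
  (* The width is linear in [eps], hence its evaluation at 1. The absolute value keeps the constant
     nonnegative before the sign of [M] is known. *)
  pose C1 := 2 * (5 + 2 * `|ln (l1_width 1 M)^-1|) + 2.
  exists (1000 * C1) => S A g y' y0 alpha eps S0 A0 hs alpha0 hb y'p [hg aM aVM] hr eps01.
  have hy0 a : distr (y0 a) by exact/simplexP.
  have /kl_ballP hy' := hb.
  have /andP[eps0 eps1] := eps01; have lh := ln_inv_ge_half eps01.
  have M0 : 0 <= M by apply: le_trans aM; exact: ltW.
  (* A feasible [y'] is absolutely continuous with respect to [y0], so its positivity passes to
     [y0]. *)
  have y0p a i : 0 < y0 a i.
    rewrite lt_def (hy0 a).1 andbT; apply/eqP => q0.
    by have [_ /(_ a i q0) e _] := hy'; have := y'p a i; rewrite e ltxx.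
  have [m [st [run_st [J [Jb mb hf hgap]]]]] :=
    run_l1 A0 S0 hy0 y0p y'p hy' hg hr M0 alpha0 aM aVM eps0 eps1 (data_input g y' y0 alpha eps).
  exists st, m; split=> //.
    apply: (approx_proxP (f := fun z => f1 y' g A%:R z)).
    - by move=> z; exact: objective_l1E.
    - by rewrite output_fun.
    - by move=> z /hgap; rewrite output_fun.
  have w1 : 0 < l1_width 1 M by exact: l1_width_gt0.
  have we : l1_width eps M = eps * l1_width 1 M by rewrite /l1_width mul1r [RHS]mulrA.
  have J1 : (J + 4)%:R <= C1 * ln eps^-1.
    rewrite natrD; apply: le_trans (affine_log_le (c := 5 + 2 * `|ln (l1_width 1 M)^-1|) 2 lh _); last first.
      by have := normr_ge0 (ln (l1_width 1 M)^-1); lra.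
    move: Jb; rewrite we invfM lnM ?posrE ?invr_gt0//.
    by have := ler_norm (ln (l1_width 1 M)^-1); lra.
  exact: natr_cost_le mb J1.
Qed.
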